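(* Suppose $g\in G_-^m$ is regular with singularity data $\Gamma_g=(z_1,\dots,z_N,\pi_1,\dots,\pi_N)$, and $\pi_k$ is the projection onto (the line spanned by) $v_k\in\mathbb C^n$ for each $1\le k\le N$. Let $F(x,t)=(f_{km}(x,t))$ be the $N\times N$ matrix defined by $$f_{mk}(x,t)=\frac{v_m^*\,e^{a(\bar z_m-z_k)x+b(\bar z_m^j-z_k^j)t}\,v_k}{z_m-\bar z_k}.$$ Suppose $F(x,t)$ is invertible. Set $F(x,t)^{-1}=(f^{km}(x,t))$ and $$P_k(x,t)=\left(\sum_{m=1}^Ne^{-(az_mx+bz_m^jt)}v_mf^{mk}(x,t)\right)v_k^*\,e^{a\bar z_kx+b\bar z_k^jt}.$$ Then the $N$-soliton $\tilde u=g*0$ of the $j$-th flow on $\mathcal S(\mathbb R,\mathcal U_a^\perp)$ defined by $b$ and its trivialization $\tilde E$ are given by $$\tilde u(x,t)=(g*0)(x,t)=\sum_{k=1}^N[P_k(x,t),a],$$ $$\tilde E(x,t,\lambda)=g(\lambda)\,e^{a\lambda x+b\lambda^jt}\left(I+\sum_{k=1}^N\frac{P_k(x,t)^*}{\lambda-\bar z_k}\right).$$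
   Context: Fix a diagonal $a\in u(n)$, $b\in u(n)$ with $[a,b]=0$, and an integer $j\ge1$. $\mathcal U_a^\perp$ is the orthogonal complement in $u(n)$ (trace form) of $\{y\in u(n):[a,y]=0\}$, and $\mathcal S(\mathbb R,\mathcal U_a^\perp)$ is the Schwartz class. For $v\in\mathcal S(\mathbb R,\mathcal U_a^\perp)$ let $\mu(x,\lambda)\in GL(n,\mathbb C)$ be its reduced wave function: $\mu$ is meromorphic in $\lambda\in\mathbb C\setminus\mathbb R$, has an asymptotic expansion $\mu\sim I+\mu_1(x)\lambda^{-1}+\mu_2(x)\lambda^{-2}+\cdots$ at $\lambda=\infty$ with $v=[a,\mu_1]$, the map $H(x,\lambda)=\mu(0,\lambda)^{-1}e^{a\lambda x}\mu(x,\lambda)$ is holomorphic in $\lambda\in\mathbb C$ with $H^{-1}H_x=a\lambda+v$, and $\lim_{x\to-\infty}\mu(x,\lambda)=I$. $Q_{b,k}(v)$ is the coefficient of $\lambda^{-k}$ in the asymptotic expansion of $\mu^{-1}b\mu$ at $\lambda=\infty$; thus $Q_{b,0}(v)=b$ and $(Q_{b,k}(v))_x+[v,Q_{b,k}(v)]=[Q_{b,k+1}(v),a]$ for $k\ge0$. For functions $u(x,t)$ this is applied for each fixed $t$. The $j$-th flow is $u_t=(Q_{b,j}(u))_x+[u,Q_{b,j}(u)]$. The trivialization of a solution $u$ is the solution $E(x,t,\lambda)$ of $E_x=E(a\lambda+u)$, $E_t=E(b\lambda^j+Q_{b,1}(u)\lambda^{j-1}+\dots+Q_{b,j}(u))$,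 $E(0,0,\lambda)=I$; for $u=0$ it is $e^{a\lambda x+b\lambda^jt}$. $G_-^m$ is the group of rational maps $g$ from $S^2=\mathbb C\cup\{\infty\}$ to $GL(n,\mathbb C)$ (invertible off a finite set) with $g(\infty)=I$, $g(\bar\lambda)^*g(\lambda)=I$. It acts on the solutions of the $j$-th flow that are Schwartz in $x$: factor $gE(x,t,\cdot)=\tilde E(x,t,\cdot)\tilde g(x,t,\cdot)$ with $\tilde g(x,t,\cdot)\in G_-^m$ and $\tilde E(x,t,\cdot)$ holomorphic and invertible on $\mathbb C$ with $\tilde E(x,t,\bar\lambda)^*\tilde E(x,t,\lambda)=I$; then $g*u=\tilde u$ with $\tilde E^{-1}\tilde E_x=a\lambda+\tilde u$, and $\tilde E$ is the trivialization of $\tilde u$. A zero of $g\in G_-^m$ is a point where $g$ is holomorphic but not invertible (zeros and poles occur in conjugate pairs). $g$ is regular if it has only simple poles and all its poles and zeros are distinct. All projections are Hermitian projections. For a projection $\pi$, $h_{z,\pi}(\lambda)=I+\frac{z-\bar z}{\lambda-z}\pi$. For regular $g$ with poles $z_1,\dots,z_N$ there are unique projections $\pi_1,\dots,\pi_N$ such that $gh_{z_k,\pi_k}^{-1}$ is holomorphic and non-singular at $z_k$ for all $k$; $\Gamma_g=(z_1,\dots,z_N,\pi_1,\dots,\pi_N)$ is the singularity data of $g$.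
   Formalization: In the exponents of f_{mk} and P_k, z and z̄ are interchanged (as printed, Ẽ is not holomorphic); and that ũ solves the j-th flow with trivialization Ẽ is claimed only if every y in u(n) commuting with a commutes with b (it fails e.g. for a=0). *)

(* Defs.v *)
From HB Require Import structures.
From mathcomp Require Import all_boot all_order all_algebra.
From mathcomp Require Import all_classical all_reals all_analysis.
From mathcomp Require Import complex.

Set Implicit Arguments.
Unset Strict Implicit.
Unset Printing Implicit Defensive.

Import Order.TTheory GRing.Theory Num.Theory numFieldNormedType.Exports.

Local Open Scope classical_set_scope.
Local Open Scope ring_scope.
Local Open Scope sesquilinear_scope.

Section Defs.
Context {R : realType} {n : nat}.

(* [C] is the field of complex numbers with the topology of its norm. *)
Local Notation C := (R[i]^o).
Local Notation M := 'M[R[i]]_n.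
Implicit Types (a b y : M) (g : R[i] -> M) (z w : R[i]) (x t : R).

Definition lie (A B : M) : M := A *m B - B *m A.

Definition u_alg (A : M) : Prop := A ^t* = - A.

Definition U_perp a (A : M) : Prop :=
  u_alg A /\ forall y, u_alg y -> lie a y = 0 -> \tr (A *m y) = 0.

Definition expmx (A : M) : M :=
  \matrix_(i, j)
    lim ((fun m : nat => (\sum_(k < m) (k`!%:R)^-1 *: A ^+ k) i j : C) @ \oo).

(* f'(x) = L for a matrix-valued function of a real variable. *)
Definition is_mderive (f : R -> M) x (L : M) : Prop :=
  forall i j,
    is_derive x 1 (fun s => complex.Re (f s i j)) (complex.Re (L i j)) /\
    is_derive x 1 (fun s => complex.Im (f s i j)) (complex.Im (L i j)).

Definition schwartz_fun (f : R -> R) : Prop :=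
  (forall (m : nat) x, derivable (derive1n m f) x 1) /\
  (forall k m : nat, exists B : R,
     forall x, `|x ^+ k * derive1n m f x| <= B).

Definition schwartz a (v : R -> M) : Prop :=
  (forall x, U_perp a (v x)) /\
  (forall i j, schwartz_fun (fun x => complex.Re (v x i j)) /\
               schwartz_fun (fun x => complex.Im (v x i j))).

Definition holomorphic_at (f : R[i] -> M) z : Prop :=
  \forall w \near (z : C), forall i j,
    derivable ((fun s => f s i j) : C -> C) w 1.

Definition meromorphic_at (f : R[i] -> M) z : Prop :=
  exists (m : nat) (h : R[i] -> M), holomorphic_at h z /\
    \forall w \near (z : C)^', f w = (w - z) ^- m *: h w.

(* f is holomorphic and invertible at z once a removable singularity at z has
   been removed; the value of f at z itself is irrelevant. *)
Definition holomorphic_unit_at (f : R[i] -> M) z : Prop :=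
  exists h : R[i] -> M, [/\ holomorphic_at h z, h z \in unitmx &
    \forall w \near (z : C)^', f w = h w].

(* f ~ sum_k c_k w^(-k) as w tends to infinity in C \ R. *)
Definition asymptotic (f : R[i] -> M) (c : nat -> M) : Prop :=
  forall K : nat, exists B r : R, forall w, w \isn't Num.real ->
    (r%:C)%C < `|w| -> forall i j,
    `|(f w - \sum_(k < K.+1) w ^- k *: c k) i j| <= (B%:C)%C / `|w| ^+ K.+1.

(* Z is a discrete subset of C \ R off which mu is holomorphic and invertible;
   it can be taken independent of x because
   mu(x, w) = e^(-a w x) mu(0, w) H(x, w) with H(x, .) entire and invertible.
   H extends over R and Z the expression mu(0, w)^-1 e^(a w x) mu(x, w), which
   only makes sense off these sets. *)
Definition reduced_wave a (v : R -> M) (mu : R -> R[i] -> M) : Prop :=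
  exists (c : nat -> R -> M) (Z : set R[i]) (H : R -> R[i] -> M),
  [/\ forall x, [/\ asymptotic (mu x) (c^~ x), c 0%N x = 1%:M &
                    v x = lie a (c 1%N x)],
      (forall w, w \isn't Num.real -> \forall s \near (w : C)^', ~ Z s) /\
      (forall x w, w \isn't Num.real -> meromorphic_at (mu x) w),
      forall w, w \isn't Num.real -> ~ Z w ->
        forall x, [/\ holomorphic_at (mu x) w, mu x w \in unitmx &
          H x w = invmx (mu 0 w) *m expmx ((w * (x%:C)%C) *: a) *m mu x w],
      forall w, w \isn't Num.real -> ~ Z w ->
        forall i j, mu x w i j @[x --> -oo] --> ((1%:M : M) i j : C) &
      forall x w, [/\ holomorphic_at (H x) w, H x w \in unitmx &
        is_mderive (H^~ w) x (H x w *m (w *: a + v x))]].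

(* Q k x = Q_{b,k}(v)(x) *)
Definition Qcoeffs a b (v : R -> M) (Q : nat -> R -> M) : Prop :=
  exists mu, reduced_wave a v mu /\
    forall x, asymptotic (fun w => invmx (mu x w) *m b *m mu x w) (Q^~ x).

Definition jflow_solution a b (j : nat) (u : R -> R -> M) : Prop :=
  (forall t, schwartz a (u^~ t)) /\
  exists Q : nat -> R -> R -> M,
    (forall t, Qcoeffs a b (u^~ t) (fun k x => Q k x t)) /\
    (forall x t, exists2 Qx : M,
       is_mderive (fun s => Q j s t) x Qx &
       is_mderive (fun s => u x s) t (Qx + lie (u x t) (Q j x t))).

Definition trivialization a b (j : nat) (u : R -> R -> M)
    (E : R -> R -> R[i] -> M) : Prop :=
  exists Q : nat -> R -> R -> M,
    (forall t, Qcoeffs a b (u^~ t) (fun k x => Q k x t)) /\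
    forall w,
      [/\ E 0 0 w = 1%:M,
          forall x t, is_mderive (fun s => E s t w) x
            (E x t w *m (w *: a + u x t)) &
          forall x t, is_mderive (fun s => E x s w) t
            (E x t w *m (w ^+ j *: b +
               \sum_(1 <= k < j.+1) w ^+ (j - k) *: Q k x t))].

(* The trivialization of the solution u = 0. *)
Definition vacuum a b (j : nat) (x t : R) (w : R[i]) : M :=
  expmx ((w * (x%:C)%C) *: a + (w ^+ j * (t%:C)%C) *: b).

(* A rational map is a function g equal to p / q in lowest terms (p and q have
   no common zero). The poles of g are then the roots of q, and only at these
   points is the value of g irrelevant. *)
Definition lowest_terms g (p : 'M[{poly R[i]}]_n) (q : {poly R[i]}) : Prop :=
  [/\ q != 0,
      forall w, ~~ root q w -> g w = (q.[w])^-1 *: map_mx (horner_eval w) p &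
      forall w, root q w -> map_mx (horner_eval w) p != 0].

Definition pole g w : Prop :=
  exists p q, lowest_terms g p q /\ root q w.

Definition simple_pole g w : Prop :=
  exists p q, lowest_terms g p q /\ mup w q = 1%N.

Definition zero g w : Prop := ~ pole g w /\ g w \notin unitmx.

Definition G_minus g : Prop :=
  [/\ exists p q, lowest_terms g p q,
      exists s : seq R[i], forall w, w \notin s -> g w \in unitmx,
      forall i j (e : R), 0 < e -> exists r : R, forall w,
        (r%:C)%C < `|w| -> `|g w i j - (1%:M : M) i j| < (e%:C)%C &
      forall w, ~ pole g w -> ~ pole g w^* -> (g w^*) ^t* *m g w = 1%:M].

(* The zeros of g are the conjugates of its poles, so the poles and zeros are
   all distinct when the conjugate of a pole is a zero (hence not a pole). *)
Definition regular g : Prop :=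
  forall w, pole g w -> simple_pole g w /\ zero g w^*.

Definition h_factor z (pi : M) w : M := 1%:M + ((z - z^*) / (w - z)) *: pi.

Definition hermitian_projection (pi : M) : Prop :=
  pi *m pi = pi /\ pi ^t* = pi.

Definition singularity_data g (N : nat) (z : 'I_N -> R[i]) (pi : 'I_N -> M)
    : Prop :=
  [/\ injective z,
      forall w, pole g w <-> exists k, w = z k,
      forall k, hermitian_projection (pi k) &
      forall k, holomorphic_unit_at
        (fun w => g w *m invmx (h_factor (z k) (pi k) w)) (z k)].

Definition projects_onto_line (pi : M) (v : 'cV[R[i]]_n) : Prop :=
  v != 0 /\
  forall y : 'cV[R[i]]_n, (exists s, pi *m s = y) <-> (exists c, y = c *: v).

(* The action of g on a solution with trivialization E: g E = Et gt is the
   factorization, and ut is the transform, with Et^-1 Et_x = a w + ut. *)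
Definition dressed a g (E : R -> R -> R[i] -> M)
    (ut : R -> R -> M) (Et : R -> R -> R[i] -> M) : Prop :=
  exists gt : R -> R -> R[i] -> M,
  [/\ forall x t, G_minus (gt x t),
      forall x t w, [/\ holomorphic_at (Et x t) w, Et x t w \in unitmx &
        (Et x t w^*) ^t* *m Et x t w = 1%:M],
      forall x t w, ~ pole g w -> ~ pole (gt x t) w ->
        g w *m E x t w = Et x t w *m gt x t w &
      forall x t w, is_mderive (fun s => Et s t w) x
        (Et x t w *m (w *: a + ut x t))].

(* With w_k = vacuum(x, t, z_k)^t* v_k = e^(- (a z'_k x + b z'_k^j t)) v_k,
   where z'_k is the conjugate of z_k, the entries of F are
   w_m^t* w_k / (z_m - z'_k), and P_k = (sum_m (F^-1)_mk w_m) w_k^t*.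
   The conjugates are placed in the exponents so that the line of w_k is the
   one that cancels the singularities of g * vacuum at z_k and z'_k. *)
Section Formulas.
Variables (a b : M) (j N : nat) (z : 'I_N -> R[i]) (v : 'I_N -> 'cV[R[i]]_n).

Definition soliton_F (x t : R) : 'M[R[i]]_N :=
  \matrix_(m, k)
    (((v m) ^t* *m
      expmx (((z m - (z k)^*) * (x%:C)%C) *: a +
             ((z m ^+ j - (z k)^* ^+ j) * (t%:C)%C) *: b) *m
      v k) ord0 ord0 / (z m - (z k)^*)).

Definition soliton_P (k : 'I_N) (x t : R) : M :=
  (\sum_m invmx (soliton_F x t) m k *:
     (expmx (- (((z m)^* * (x%:C)%C) *: a +
                ((z m)^* ^+ j * (t%:C)%C) *: b)) *m v m)) *m
  ((v k) ^t* *m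
     expmx ((z k * (x%:C)%C) *: a + (z k ^+ j * (t%:C)%C) *: b)).

End Formulas.
End Defs.

(* Main.v *)
Require Import Defs.
From HB Require Import structures.
From mathcomp Require Import all_boot all_order all_algebra perm.
From mathcomp Require Import all_classical all_reals all_analysis.
From mathcomp Require Import complex.
From mathcomp Require Import ring lra zify.

Set Implicit Arguments.
Unset Strict Implicit.
Unset Printing Implicit Defensive.

Import Order.TTheory GRing.Theory Num.Theory numFieldNormedType.Exports.

Local Open Scope classical_set_scope.
Local Open Scope ring_scope.
Local Open Scope sesquilinear_scope.

(** The dressed solution exists in closed form, and the theorem reduces to the algebra
    of one matrix. For a matrix [W] whose columns [w_k] are attached to the poles
    [z_k], let [F_mk = w_m^* w_k / (z_m - conj z_k)], let [Z] and [Z^~] be the diagonal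
    matrices of the [z_k] and of their conjugates, and for diagonal [D], [E] put
    [S(D, E) = W D F^-1 E W^*]. The Lyapunov equation
    [Z F - F Z^~ = W^* W] becomes the rule
    [S(D, Z E) = S(D Z^~, E) + S(D, 1) S(1, E)] (lemma [S_lyapunov]). It shows that
    [gsol w = 1 + S(1, (w - Z)^-1)] is a unitary rational map with the poles [z_k],
    whose inverse is [ginv w = 1 - S((w - Z^~)^-1, 1)]. The matrix [F] is
    invertible: with suitable signs on its rows, [i] times the Cauchy matrix
    [1 / (z_m - conj z_k)] has a positive definite real part, as the Schur complements
    of Cauchy matrices are again Cauchy matrices
    ([cauchy_signed_bound], [F_unit]).

    Comparing residues and using unitarity, [g] is [gsol] for the columns [v_k]
    ([data_explicit]). Let [M] be the vacuum and take the columns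
    [w_k = M(conj z_k)^-1 v_k]. In the product of [g], [M] and [ginv] all residues
    cancel ([residue_pole], [residue_zero]), so the product is an entire function
    [Et], and [g M = Et gsol] is the required factorization. It is unique by
    Liouville's theorem for rational maps ([factor_unique]). The two formulas are the
    partial fractions of [gsol] and [ginv].

    In [x] and [t] the columns satisfy linear equations, which give the derivatives
    of all the [S(D, E)] ([S_flow]), hence those of [Et] ([Et_xder], [Et_tder]). The
    coefficients [Q_k] are those of [gsol b ginv] at infinity, and both their
    recursion in [x] and the evolution of the solution in [t] are instances of the
    same identities ([Q_xflow], [u_flow]).

    As [x] tends to either infinity, the columns can be rescaled so that they converge
    rapidly to eigenvectors of [a]. The inverse of [F] stays bounded, since the
    positivity above is uniform ([Finv_bound]), and all the [S(D, E)] converge rapidly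
    to matrices commuting with [a] ([S_conv], [S_inf_comm]). The entries of the
    matrices [S((Z^~)^p, Z^q)] that join different eigenvalues of [a] therefore decay
    rapidly, and they generate an ideal that is closed under differentiation. The
    solution [[S(1, 1), a]] lies in it, so it is a Schwartz function
    ([soliton_schwartz]). The limit at [x = -oo] also provides the constant left
    factor that normalizes [ginv] to a reduced wave function ([mu_reduced_wave]). That
    factor lies in the centralizer of [a], hence commutes with [b], and so it does not
    affect the coefficients [Q_k]. *)

(** * Complex numbers over a real type *)

Section ComplexBasics.
Context {R : realType}.
Local Notation C := R[i].
Implicit Types (z w : C).

(** Real-valued modulus: unlike [`|z|], it lives in a totally ordered field. *)
Definition nrm z : R := complex.Re `|z|.

Lemma nrmE z : `|z| = ((nrm z)%:C)%C.
Proof. by rewrite /nrm (RRe_real (normr_real _)). Qed.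

Lemma nrm_ge0 z : 0 <= nrm z.
Proof. by rewrite -ler0c -nrmE normr_ge0. Qed.

Lemma nrmM z w : nrm (z * w) = nrm z * nrm w.
Proof. by apply: complexI; rewrite rmorphM /= -!nrmE normrM. Qed.

Lemma nrmD z w : nrm (z + w) <= nrm z + nrm w.
Proof. by rewrite -lecR rmorphD /= -!nrmE ler_normD. Qed.

Lemma nrmN z : nrm (- z) = nrm z.
Proof. by rewrite /nrm normrN. Qed.

Lemma nrmB z w : nrm (z - w) <= nrm z + nrm w.
Proof. by rewrite (le_trans (nrmD _ _)) // nrmN. Qed.

Lemma nrmBC z w : nrm (z - w) = nrm (w - z).
Proof. by rewrite -nrmN opprB. Qed.

Lemma nrmV z : nrm z^-1 = (nrm z)^-1.
Proof. by apply: complexI; rewrite fmorphV /= -!nrmE normfV. Qed.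

Lemma nrm0 : nrm 0 = 0. Proof. by rewrite /nrm normr0. Qed.

Lemma nrm1 : nrm 1 = 1. Proof. by rewrite /nrm normr1. Qed.

Lemma nrmX z k : nrm (z ^+ k) = nrm z ^+ k.
Proof. by elim: k => [|k IH]; rewrite ?expr0 ?nrm1 // !exprS nrmM IH. Qed.

Lemma nrm_eq0 z : (nrm z == 0) = (z == 0).
Proof. by rewrite -(inj_eq (@complexI R)) /= -nrmE normr_eq0. Qed.

Lemma nrm_gt0 z : (0 < nrm z) = (z != 0).
Proof. by rewrite lt_neqAle nrm_ge0 andbT eq_sym nrm_eq0. Qed.

Lemma nrm_conj z : nrm z^* = nrm z.
Proof. by rewrite /nrm norm_conjC. Qed.

Lemma nrm_real (r : R) : nrm (r%:C)%C = `|r|.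
Proof. by rewrite /nrm normc_def /= expr0n /= addr0 sqrtr_sqr. Qed.

Lemma nrm_sum I (s : seq I) (P : pred I) (f : I -> C) :
  nrm (\sum_(i <- s | P i) f i) <= \sum_(i <- s | P i) nrm (f i).
Proof.
elim/big_ind2: _ => // [|x a y b xa yb]; first by rewrite nrm0.
exact: le_trans (nrmD _ _) (lerD xa yb).
Qed.

Lemma nrm_Re z : `|complex.Re z| <= nrm z.
Proof. by rewrite -lecR -nrmE normc_ge_Re. Qed.

Lemma nrm_Im z : `|complex.Im z| <= nrm z.
Proof.
have -> : complex.Im z = complex.Re (- 'i%C * z).
  by case: z => p q /=; ring.
apply: le_trans (nrm_Re _) _; rewrite nrmM nrmN.
by rewrite {1}/nrm normc_def /= expr0n expr1n add0r sqrtr1 mul1r.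
Qed.

Lemma ReImE z : z = ((complex.Re z)%:C)%C + 'i%C * ((complex.Im z)%:C)%C.
Proof. exact: complexE. Qed.

Lemma nrm_ReIm z : nrm z <= `|complex.Re z| + `|complex.Im z|.
Proof.
rewrite {1}[z]ReImE; apply: le_trans (nrmD _ _) _.
rewrite nrmM !nrm_real.
by rewrite [nrm 'i%C]/nrm normc_def /= expr0n expr1n add0r sqrtr1 mul1r.
Qed.

Lemma ReD z w : complex.Re (z + w) = complex.Re z + complex.Re w.
Proof. by case: z; case: w. Qed.
Lemma ImD z w : complex.Im (z + w) = complex.Im z + complex.Im w.
Proof. by case: z; case: w. Qed.
Lemma ReN z : complex.Re (- z) = - complex.Re z. Proof. by case: z. Qed.
Lemma ImN z : complex.Im (- z) = - complex.Im z. Proof. by case: z. Qed.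
Lemma ReM z w : complex.Re (z * w) =
  complex.Re z * complex.Re w - complex.Im z * complex.Im w.
Proof. by case: z; case: w. Qed.
Lemma ImM z w : complex.Im (z * w) =
  complex.Re z * complex.Im w + complex.Im z * complex.Re w.
Proof. by case: z; case: w => *; rewrite /= addrC addrC. Qed.
Lemma Re_conj z : complex.Re z^* = complex.Re z. Proof. by case: z. Qed.
Lemma Im_conj z : complex.Im z^* = - complex.Im z. Proof. by case: z. Qed.

Lemma nrm_sqr z : nrm z ^+ 2 = complex.Re z ^+ 2 + complex.Im z ^+ 2.
Proof.
rewrite /nrm normc_def /= sqr_sqrtr //.
by rewrite addr_ge0 // sqr_ge0.
Qed.

Lemma mul_conj z : z * z^* = ((nrm z ^+ 2)%:C)%C.
Proof.
by rewrite nrm_sqr; case: z => p q /=; simpc; congr (Complex _ _); ring.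
Qed.

Lemma normC_lt z (r : R) : (`|z| < (r%:C)%C) = (nrm z < r).
Proof. by rewrite nrmE ltcR. Qed.

Lemma pos_complex (e : C) : 0 < e -> exists2 r : R, 0 < r & e = (r%:C)%C.
Proof.
case: e => p q; rewrite ltcE /= => /andP[/eqP -> p0].
by exists p.
Qed.

Lemma cvgCP T (F : set_system T) (FF : Filter F) (f : T -> C) (l : C) :
  (f x : C^o) @[x --> F] --> (l : C^o) <->
  forall e : R, 0 < e -> \forall x \near F, nrm (f x - l) < e.
Proof.
split=> [/cvgrPdist_lt fl e e0|fl].
  have := fl (e%:C)%C; rewrite ltcR => /(_ e0).
  by apply: filterS => x; rewrite distrC normC_lt.
apply/cvgrPdist_lt => e /pos_complex[r r0 ->].
by apply: filterS (fl r r0) => x; rewrite distrC normC_lt.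
Qed.

Lemma near_nrm w (P : C -> Prop) :
  (\forall s \near (w : C^o), P s) <->
  exists2 r : R, 0 < r & forall s, nrm (s - w) < r -> P s.
Proof.
split=> [/nbhs_ballP[e /= /pos_complex[r r0 ->] eP]|[r r0 rP]].
  exists r => // s sw; apply: eP.
  by rewrite -ball_normE /ball_ /= distrC normC_lt.
apply/nbhs_ballP; exists (r%:C)%C; first by rewrite /= ltcR.
by move=> s; rewrite -ball_normE /ball_ /= distrC normC_lt => /rP.
Qed.

Lemma dnear_nrm w (P : C -> Prop) :
  (\forall s \near (w : C^o)^', P s) <->
  exists2 r : R, 0 < r & forall s, s != w -> nrm (s - w) < r -> P s.
Proof.
rewrite /= near_withinE; split=> [/near_nrm[r r0 rP]|[r r0 rP]].
  by exists r => // s a b; apply: rP.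
by apply/near_nrm; exists r => // s a b; apply: rP.
Qed.

Lemma continuous_nrm (f : C^o -> C^o) w : {for w, continuous f} ->
  forall e : R, 0 < e ->
  exists2 r : R, 0 < r & forall s, nrm (s - w) < r -> nrm (f s - f w) < e.
Proof. by move=> /cvgCP fc e /fc /near_nrm. Qed.

Lemma dnear_finite w (s : seq C) : \forall x \near (w : C^o)^', x \notin s.
Proof.
elim: s => [|y s IH]; first by near=> x.
have : \forall x \near (w : C^o)^', x != y.
  apply/dnear_nrm; have [->|wy] := eqVneq w y.
    by exists 1.
  exists (nrm (y - w)); first by rewrite nrm_gt0 subr_eq0 eq_sym.
  by move=> x _; apply: contraTneq => ->; rewrite ltxx.
move: IH; apply: filterS2 => x xs xy.
by rewrite inE negb_or xy.
Unshelve. all: by end_near. Qed.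

Lemma near_dnear w (P : C -> Prop) :
  (\forall s \near (w : C^o), P s) -> \forall s \near (w : C^o)^', P s.
Proof. by move=> /near_nrm[r r0 rP]; apply/dnear_nrm; exists r => // s _ /rP. Qed.

(** A removable discrepancy: [C] has no isolated point. *)
Lemma continuous_eq_off (f g : C^o -> C^o) w :
  {for w, continuous f} -> {for w, continuous g} ->
  (\forall x \near (w : C^o)^', f x = g x) -> f w = g w.
Proof.
move=> fc gc /dnear_nrm[r0 r00 fg].
apply/eqP; rewrite -subr_eq0 -nrm_eq0 eq_le nrm_ge0 andbT leNgt.
apply/negP => d0.
have e0 : 0 < nrm (f w - g w) / 2 by lra.
have [r1 r10 fr] := continuous_nrm fc e0.
have [r2 r20 gr] := continuous_nrm gc e0.
pose r := Num.min r0 (Num.min r1 r2) / 2.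
have [rp r0' r1' r2'] : [/\ 0 < r, r < r0, r < r1 & r < r2].
  have m0 : 0 < Num.min r0 (Num.min r1 r2) by rewrite !lt_min r00 r10 r20.
  rewrite /r.
  have a1 : Num.min r0 (Num.min r1 r2) <= r0 by rewrite ge_min lexx.
  have a2 : Num.min r0 (Num.min r1 r2) <= r1 by rewrite !ge_min lexx orbT.
  have a3 : Num.min r0 (Num.min r1 r2) <= r2 by rewrite !ge_min lexx !orbT.
  by split; lra.
pose x := w + (r%:C)%C.
have xw : nrm (x - w) = r by rewrite /x addrAC subrr add0r nrm_real gtr0_norm.
have xNw : x != w by rewrite -subr_eq0 -nrm_eq0 xw gt_eqF.
have := fr x; have := gr x; rewrite xw => /(_ r2') g2 /(_ r1') f2.
have fgx : f x = g x by apply: fg => //; rewrite xw.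
have : nrm (f w - g w) <= nrm (f x - f w) + nrm (g x - g w).
  rewrite (_ : f w - g w = (g x - g w) - (f x - f w)).
    by rewrite [leRHS]addrC; apply: nrmB.
  by rewrite fgx; ring.
lra.
Qed.

End ComplexBasics.

(** * Adjoints *)

Section Adjoint.
Context {R : realType}.
Local Notation C := R[i].

Lemma adjE m p (A : 'M[C]_(m, p)) i j : (A ^t*) i j = (A j i)^*.
Proof. by rewrite mxE mxE. Qed.

Lemma adjK m p (A : 'M[C]_(m, p)) : A ^t* ^t* = A.
Proof. by apply/matrixP => i j; rewrite !adjE conjCK. Qed.

Lemma adj0 m p : (0 : 'M[C]_(m, p)) ^t* = 0.
Proof. by apply/matrixP => i j; rewrite adjE !mxE conjC0. Qed.

Lemma adjD m p (A B : 'M[C]_(m, p)) : (A + B) ^t* = A ^t* + B ^t*.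
Proof. by apply/matrixP => i j; rewrite adjE !mxE rmorphD. Qed.

Lemma adjN m p (A : 'M[C]_(m, p)) : (- A) ^t* = - A ^t*.
Proof. by apply/matrixP => i j; rewrite adjE !mxE rmorphN. Qed.

Lemma adjB m p (A B : 'M[C]_(m, p)) : (A - B) ^t* = A ^t* - B ^t*.
Proof. by rewrite adjD adjN. Qed.

Lemma adjZ m p c (A : 'M[C]_(m, p)) : (c *: A) ^t* = c^* *: A ^t*.
Proof. by apply/matrixP => i j; rewrite adjE !mxE rmorphM. Qed.

Lemma adjM m p q (A : 'M[C]_(m, p)) (B : 'M[C]_(p, q)) :
  (A *m B) ^t* = B ^t* *m A ^t*.
Proof.
apply/matrixP => i j; rewrite adjE !mxE rmorph_sum; apply: eq_bigr => k _.
by rewrite !adjE rmorphM mulrC.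
Qed.

Lemma adj1 m : (1%:M : 'M[C]_m) ^t* = 1%:M.
Proof. by apply/matrixP => i j; rewrite adjE !mxE eq_sym conjC_nat. Qed.

Lemma adj_sum m p I (r : seq I) (P : pred I) (F : I -> 'M[C]_(m, p)) :
  (\sum_(i <- r | P i) F i) ^t* = \sum_(i <- r | P i) (F i) ^t*.
Proof.
by elim/big_rec2: _ => [|i A B _ <-]; rewrite ?adj0 ?adjD.
Qed.

Lemma adj_diag m (d : 'rV[C]_m) :
  (diag_mx d) ^t* = diag_mx (map_mx (fun c => c^*) d).
Proof.
apply/matrixP => i j; rewrite adjE !mxE eq_sym.
by case: eqP => [->|_]; rewrite ?mulr1n ?mulr0n ?conjC0.
Qed.

Lemma adj_inv m (A : 'M[C]_m) : A \in unitmx -> (invmx A) ^t* = invmx (A ^t*).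
Proof.
move=> Au; have e : A ^t* *m (invmx A) ^t* = 1%:M by rewrite -adjM mulVmx ?adj1.
have [Au' _] := mulmx1_unit e.
by rewrite -[LHS](mulKmx Au') e mulmx1.
Qed.

End Adjoint.

(** * Complex-valued functions of a real variable *)

Section ComplexDerivative.
Context {R : realType}.

Lemma rderD (f g : R -> R) (x l l' : R) : is_derive x 1 f l ->
  is_derive x 1 g l' -> is_derive x 1 (fun s => f s + g s) (l + l').
Proof. by move=> fl gl; exact: (is_deriveD fl gl). Qed.

Lemma rderN (f : R -> R) (x l : R) : is_derive x 1 f l ->
  is_derive x 1 (fun s => - f s) (- l).
Proof. by move=> fl; exact: (is_deriveN fl). Qed.

Lemma rderB (f g : R -> R) (x l l' : R) : is_derive x 1 f l ->
  is_derive x 1 g l' -> is_derive x 1 (fun s => f s - g s) (l - l').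
Proof. by move=> fl gl; exact: rderD fl (rderN gl). Qed.

Lemma rderM (f g : R -> R) (x l l' : R) : is_derive x 1 f l ->
  is_derive x 1 g l' -> is_derive x 1 (fun s => f s * g s) (l * g x + f x * l').
Proof.
move=> fl gl; have h := is_deriveM fl gl.
by apply: (is_derive_eq h); rewrite addrC [l * _]mulrC.
Qed.

Lemma rder_cst (c x : R) : is_derive x 1 (fun _ : R => c) 0.
Proof. exact: is_derive_cst. Qed.

Lemma rderX (k : nat) (x : R) :
  is_derive x 1 (fun s : R => s ^+ k.+1) (k.+1%:R * x ^+ k).
Proof.
elim: k => [|k IH].
  by rewrite expr0 mulr1; exact: is_derive_id.
have -> : (fun s : R => s ^+ k.+2) = fun s => s * s ^+ k.+1.
  by apply/funext => s; rewrite exprS.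
apply: (is_derive_eq (rderM (is_derive_id x 1) IH)).
by rewrite -[k.+2%:R]natr1 exprS; ring.
Qed.

Lemma rderV (f : R -> R) (x l : R) : is_derive x 1 f l -> f x != 0 ->
  exists l', is_derive x 1 (fun s => (f s)^-1) l'.
Proof.
move=> [df _] fx0; have /derivableP h := derivableV fx0 df.
by eexists; exact: h.
Qed.

Local Notation C := R[i].
Implicit Types (f g : R -> C) (x : R) (l z : C).

Definition cder f x l : Prop :=
  is_derive x 1 (fun s => complex.Re (f s)) (complex.Re l) /\
  is_derive x 1 (fun s => complex.Im (f s)) (complex.Im l).

Lemma cder_ext f g x l : f =1 g -> cder f x l -> cder g x l.
Proof. by move=> /funext ->. Qed.

Lemma cder_eq f x l l' : cder f x l -> l = l' -> cder f x l'.
Proof. by move=> ? <-. Qed.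

Lemma cder_unique f x l l' : cder f x l -> cder f x l' -> l = l'.
Proof.
move=> [[_ r1] [_ i1]] [[_ r2] [_ i2]].
by rewrite [l]ReImE [l']ReImE -r1 -i1 -r2 -i2.
Qed.

Lemma cder_cst z x : cder (fun _ => z) x 0.
Proof. by split; apply: is_derive_cst. Qed.

Lemma cder_real x : cder (fun s => (s%:C)%C) x 1.
Proof. by split; [apply: is_derive_id|apply: is_derive_cst]. Qed.

Lemma cderD f g x l l' : cder f x l -> cder g x l' ->
  cder (fun s => f s + g s) x (l + l').
Proof.
move=> [fr fi] [gr gi]; split.
  rewrite ReD (_ : (fun s => _) = fun s => complex.Re (f s) + complex.Re (g s)).
    exact: rderD.
  by apply/funext => s; exact: ReD.
rewrite ImD (_ : (fun s => _) = fun s => complex.Im (f s) + complex.Im (g s)).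
  exact: rderD.
by apply/funext => s; exact: ImD.
Qed.

Lemma cderM f g x l l' : cder f x l -> cder g x l' ->
  cder (fun s => f s * g s) x (l * g x + f x * l').
Proof.
move=> [fr fi] [gr gi]; split.
  rewrite (_ : (fun s => _) = fun s => complex.Re (f s) * complex.Re (g s) -
     complex.Im (f s) * complex.Im (g s)); last by apply/funext => s; exact: ReM.
  apply: (is_derive_eq (rderB (rderM fr gr) (rderM fi gi))).
  by rewrite ReD !ReM; ring.
rewrite (_ : (fun s => _) = fun s => complex.Re (f s) * complex.Im (g s) +
   complex.Im (f s) * complex.Re (g s)); last by apply/funext => s; exact: ImM.
apply: (is_derive_eq (rderD (rderM fr gi) (rderM fi gr))).
by rewrite ImD !ImM; ring.
Qed.

Lemma cderZ f x l z : cder f x l -> cder (fun s => z * f s) x (z * l).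
Proof.
move=> fl; apply: cder_eq; first exact: cderM (cder_cst z x) fl.
by rewrite mul0r add0r.
Qed.

Lemma cderN f x l : cder f x l -> cder (fun s => - f s) x (- l).
Proof.
move=> /(cderZ (-1)); rewrite mulN1r; apply: cder_ext => s.
by rewrite mulN1r.
Qed.

Lemma cder_sum I (r : seq I) (P : pred I) (F : I -> R -> C) (L : I -> C) x :
  (forall i, P i -> cder (F i) x (L i)) ->
  cder (fun s => \sum_(i <- r | P i) F i s) x (\sum_(i <- r | P i) L i).
Proof.
move=> FL; elim: r => [|i r IH].
  by rewrite big_nil; apply: cder_ext (cder_cst 0 x) => s; rewrite big_nil.
rewrite big_cons; case: ifP => Pi.
  by apply: cder_ext (cderD (FL i Pi) IH) => s; rewrite big_cons Pi.
by apply: cder_ext IH => s; rewrite big_cons Pi.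
Qed.

Definition cdable f x := exists l, cder f x l.

Lemma cdable_sum I (r : seq I) (P : pred I) (F : I -> R -> C) x :
  (forall i, P i -> cdable (F i) x) ->
  cdable (fun s => \sum_(i <- r | P i) F i s) x.
Proof.
move=> FL; elim: r => [|i r [l IH]].
  by exists 0; apply: cder_ext (cder_cst 0 x) => s; rewrite big_nil.
case Pi: (P i); last first.
  by exists l; apply: cder_ext IH => s; rewrite big_cons Pi.
have [l' Fl] := FL i Pi; exists (l' + l).
by apply: cder_ext (cderD Fl IH) => s; rewrite big_cons Pi.
Qed.

Lemma cdable_prod I (r : seq I) (P : pred I) (F : I -> R -> C) x :
  (forall i, P i -> cdable (F i) x) ->
  cdable (fun s => \prod_(i <- r | P i) F i s) x.
Proof.
move=> FL; elim: r => [|i r [l IH]].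
  by exists 0; apply: cder_ext (cder_cst 1 x) => s; rewrite big_nil.
case Pi: (P i); last first.
  by exists l; apply: cder_ext IH => s; rewrite big_cons Pi.
have [l' Fl] := FL i Pi; eexists.
by apply: cder_ext (cderM Fl IH) => s; rewrite big_cons Pi.
Qed.

(** [f^-1 = conj f / (Re f ^2 + Im f ^2)]. *)
Lemma cdable_inv f x : cdable f x -> f x != 0 -> cdable (fun s => (f s)^-1) x.
Proof.
case=> l [fr fi] fx0.
pose N s := complex.Re (f s) * complex.Re (f s) + complex.Im (f s) * complex.Im (f s).
have N0 : N x != 0 by rewrite /N -!expr2 -nrm_sqr expf_neq0 // nrm_eq0.
have [d dV] := rderV (rderD (rderM fr fr) (rderM fi fi)) N0.
exists (Complex (complex.Re l * (N x)^-1 + complex.Re (f x) * d)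
                (- (complex.Im l * (N x)^-1 + complex.Im (f x) * d))).
split => /=.
  rewrite (_ : (fun s => _) = fun s => complex.Re (f s) * (N s)^-1).
    exact: rderM.
  by apply/funext => s; rewrite /N; case: (f s).
rewrite (_ : (fun s => _) = fun s => - (complex.Im (f s) * (N s)^-1)).
  by apply: rderN; apply: rderM.
by apply/funext => s; rewrite /N; case: (f s).
Qed.

Lemma cder_conj f x l : cder f x l -> cder (fun s => (f s)^*) x l^*.
Proof.
case=> fr fi; split.
  rewrite Re_conj (_ : (fun s => _) = (fun s => complex.Re (f s))) //.
  by apply/funext => s; rewrite Re_conj.
rewrite Im_conj (_ : (fun s => _) = - (fun s => complex.Im (f s))).
  exact: is_deriveN.
by apply/funext => s; rewrite Im_conj.
Qed.

End ComplexDerivative.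

Section MatrixDerivative.
Context {R : realType}.
Local Notation C := R[i].

(** [is_mderive] for rectangular matrices, which the columns [W] require. *)
Definition mder m p (f : R -> 'M[C]_(m, p)) x (L : 'M[C]_(m, p)) : Prop :=
  forall i j, cder (fun s => f s i j) x (L i j).

Lemma mder_is_mderive m (f : R -> 'M[C]_m) x L : mder f x L -> is_mderive f x L.
Proof. by []. Qed.

Lemma mder_ext m p (f g : R -> 'M[C]_(m, p)) x L :
  f =1 g -> mder f x L -> mder g x L.
Proof. by move=> /funext ->. Qed.

Lemma mder_eq m p (f : R -> 'M[C]_(m, p)) x L L' :
  mder f x L -> L = L' -> mder f x L'.
Proof. by move=> ? <-. Qed.

Lemma mder_unique m p (f : R -> 'M[C]_(m, p)) x L L' :
  mder f x L -> mder f x L' -> L = L'.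
Proof.
by move=> fL fL'; apply/matrixP => i j; apply: cder_unique (fL i j) (fL' i j).
Qed.

Lemma mder_cst m p (A : 'M[C]_(m, p)) x : mder (fun _ => A) x 0.
Proof. by move=> i j; rewrite mxE; apply: cder_cst. Qed.

Lemma mderD m p (f g : R -> 'M[C]_(m, p)) x L L' :
  mder f x L -> mder g x L' -> mder (fun s => f s + g s) x (L + L').
Proof.
move=> fL gL i j; rewrite mxE.
by apply: cder_ext (cderD (fL i j) (gL i j)) => s; rewrite mxE.
Qed.

Lemma mderN m p (f : R -> 'M[C]_(m, p)) x L :
  mder f x L -> mder (fun s => - f s) x (- L).
Proof.
move=> fL i j; rewrite mxE.
by apply: cder_ext (cderN (fL i j)) => s; rewrite mxE.
Qed.

Lemma mderB m p (f g : R -> 'M[C]_(m, p)) x L L' :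
  mder f x L -> mder g x L' -> mder (fun s => f s - g s) x (L - L').
Proof. by move=> fL gL; apply: mderD => //; apply: mderN. Qed.

Lemma mderM m p q (f : R -> 'M[C]_(m, p)) (g : R -> 'M[C]_(p, q)) x L L' :
  mder f x L -> mder g x L' ->
  mder (fun s => f s *m g s) x (L *m g x + f x *m L').
Proof.
move=> fL gL i j; rewrite !mxE -big_split /=.
have /cder_ext := cder_sum (index_enum _) (P := xpredT)
  (fun k _ => cderM (fL i k) (gL k j)).
by apply=> s; rewrite mxE.
Qed.

Lemma mderMl m p q (A : 'M[C]_(m, p)) (g : R -> 'M[C]_(p, q)) x L :
  mder g x L -> mder (fun s => A *m g s) x (A *m L).
Proof.
move=> gL; apply: mder_eq; first exact: mderM (mder_cst A x) gL.
by rewrite mul0mx add0r.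
Qed.

Lemma mderMr m p q (A : 'M[C]_(p, q)) (f : R -> 'M[C]_(m, p)) x L :
  mder f x L -> mder (fun s => f s *m A) x (L *m A).
Proof.
move=> fL; apply: mder_eq; first exact: mderM fL (mder_cst A x).
by rewrite mulmx0 addr0.
Qed.

Lemma mderZ m p (f : R -> 'M[C]_(m, p)) x L (c : C) :
  mder f x L -> mder (fun s => c *: f s) x (c *: L).
Proof.
move=> fL i j; rewrite mxE.
by apply: cder_ext (cderZ c (fL i j)) => s; rewrite mxE.
Qed.

Lemma mder_sum m p I (r : seq I) (P : pred I) (F : I -> R -> 'M[C]_(m, p)) L x :
  (forall i, P i -> mder (F i) x (L i)) ->
  mder (fun s => \sum_(i <- r | P i) F i s) x (\sum_(i <- r | P i) L i).
Proof.
move=> FL i j; rewrite summxE.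
have /cder_ext := cder_sum r (P := P) (fun k Pk => FL k Pk i j).
by apply=> s; rewrite summxE.
Qed.

Lemma mder_adj m p (f : R -> 'M[C]_(m, p)) x L :
  mder f x L -> mder (fun s => (f s) ^t*) x (L ^t*).
Proof.
move=> fL i j; rewrite !mxE.
by apply: cder_ext (cder_conj (fL j i)) => s; rewrite !mxE.
Qed.

Lemma cdable_det m (f : R -> 'M[C]_m) x :
  (forall i j, cdable (fun s => f s i j) x) -> cdable (fun s => \det (f s)) x.
Proof.
move=> fd; apply: cdable_sum => s _.
have [l pl] : cdable (fun t => \prod_i f t i (s i)) x by apply: cdable_prod.
by exists ((-1) ^+ s * l); apply: cderZ.
Qed.

(** Cramer's rule gives differentiability, and the product rule the value. *)
Lemma mder_inv m (f : R -> 'M[C]_m) x L : (forall s, f s \in unitmx) ->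
  mder f x L ->
  mder (fun s => invmx (f s)) x (- (invmx (f x) *m L *m invmx (f x))).
Proof.
move=> fu fL.
have fd i j : cdable (fun s => f s i j) x by exists (L i j).
have [D [_ iD]] : exists D, True /\ mder (fun s => invmx (f s)) x D.
  have e i j : cdable (fun s => invmx (f s) i j) x.
    have [l1 h1] : cdable (fun s => (\det (f s))^-1) x.
      by apply: cdable_inv; [apply: cdable_det|rewrite -unitfE -unitmxE].
    have [l2 h2] : cdable (fun s => \adj (f s) i j) x.
      have [l2 h2] : cdable (fun s => \det (row' j (col' i (f s)))) x.
        apply: cdable_det => k l.
        have [q hq] := fd (lift j k) (lift i l).
        by exists q; apply: cder_ext hq => s; rewrite !mxE.
      exists ((-1) ^+ (j + i) * l2); apply: cder_ext (cderZ _ h2) => s.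
      by rewrite mxE.
    eexists; apply: cder_ext (cderM h1 h2) => s.
    by rewrite /invmx fu [RHS]mxE.
  exists (\matrix_(i, j) sval (cid (e i j))); split=> // i j.
  by rewrite mxE; case: cid.
have := mderM fL iD.
have := mder_cst (1%:M : 'M[C]_m) x.
have -> : (fun s => f s *m invmx (f s)) = (fun _ => 1%:M).
  by apply/funext => s; rewrite mulmxV.
move=> h0 /(mder_unique h0) e0; suff -> : - (invmx (f x) *m L *m invmx (f x)) = D by [].
have /(congr1 (mulmx (invmx (f x)))) := e0.
rewrite mulmx0 mulmxDr !mulmxA mulVmx // mul1mx => /esym /eqP.
by rewrite addrC addr_eq0 => /eqP ->.
Qed.

End MatrixDerivative.

(** * The complex exponential *)

Section ComplexExponential.
Context {R : realType}.
Local Notation C := R[i].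
Implicit Types (z w : C).

Definition cexp z : C :=
  Complex (expR (complex.Re z) * cos (complex.Im z))
          (expR (complex.Re z) * sin (complex.Im z)).

Lemma cexp0 : cexp 0 = 1.
Proof. by rewrite /cexp /= expR0 cos0 sin0 !mul1r. Qed.

Lemma cexpD z w : cexp (z + w) = cexp z * cexp w.
Proof.
case: z => a b; case: w => c d; rewrite /cexp /= expRD cosD sinD; simpc.
by congr (Complex _ _); ring.
Qed.

Lemma cexp_neq0 z : cexp z != 0.
Proof.
apply/eqP => e; have := cexpD z (- z).
by rewrite subrr cexp0 e mul0r => /eqP; rewrite oner_eq0.
Qed.

Lemma nrm_cexp z : nrm (cexp z) = expR (complex.Re z).
Proof.
apply/eqP; rewrite -(@eqrXn2 _ 2%N) ?nrm_ge0 ?expR_ge0 //.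
rewrite nrm_sqr /= !exprMn -mulrDr cos2Dsin2 mulr1.
by [].
Qed.

Lemma cder_cexp (f : R -> C) x l : cder f x l ->
  cder (fun s => cexp (f s)) x (l * cexp (f x)).
Proof.
case=> fr fi.
have e := @is_derive1_comp _ expR (fun s => complex.Re (f s)) x _ _
  (is_derive_expR _) fr.
have c := @is_derive1_comp _ cos (fun s => complex.Im (f s)) x _ _
  (is_derive_cos _) fi.
have d := @is_derive1_comp _ sin (fun s => complex.Im (f s)) x _ _
  (is_derive_sin _) fi.
split.
  apply: (is_derive_eq (rderM e c)).
  by rewrite ReM /=; ring.
apply: (is_derive_eq (rderM e d)).
by rewrite ImM /=; ring.
Qed.

Lemma ge0_of_der (f f' : R -> R) (b : R) : 0 <= b ->
  (forall s : R, is_derive s 1 f (f' s)) ->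
  (forall s, 0 <= s <= b -> 0 <= f' s) -> 0 <= f 0 -> 0 <= f b.
Proof.
move=> b0 fd f'0 f0.
have cf : {within `[0, b], continuous f}.
  apply: derivable_within_continuous => s _; exact: ex_derive.
have [c cb] := MVT_segment b0 (fun s _ => fd s) cf.
rewrite subr0 => e; rewrite -[f b](subrK (f 0)) e.
apply: addr_ge0 f0; apply: mulr_ge0 b0; apply: f'0.
by move: cb; rewrite in_itv.
Qed.

Definition exp_sum k z : C := \sum_(i < k) (i`!%:R)^-1 * z ^+ i.

Lemma exp_sum_der k z s : cder (fun t => exp_sum k.+1 ((t%:C)%C * z)) s
  (z * exp_sum k ((s%:C)%C * z)).
Proof.
rewrite /exp_sum big_distrr /=.
pose F (i : nat) (t : R) : C := (i`!%:R)^-1 * ((t%:C)%C * z) ^+ i.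
have F0 : cder (F 0%N) s 0.
  by apply: cder_ext (cder_cst 1 s) => t; rewrite /F expr0 fact0 invr1 mulr1.
have FX i t : cder (fun t => ((t%:C)%C * z) ^+ i.+1) t
    (i.+1%:R * z * ((t%:C)%C * z) ^+ i).
  elim: i => [|i IH].
    apply: cder_ext; last first.
      apply: cder_eq; first exact: cderM (cder_real t) (cder_cst z t).
      by rewrite mulr0 addr0 expr0 mulr1.
    by move=> u; rewrite expr1.
  apply: cder_ext; last first.
    apply: cder_eq; first exact: (cderM (cderM (cder_real t) (cder_cst z t)) IH).
    by rewrite -[i.+2%:R]natr1 exprS; ring.
  by move=> u; rewrite -exprS.
have FS i : cder (F i.+1) s (z * ((i`!%:R)^-1 * ((s%:C)%C * z) ^+ i)).
  apply: cder_eq; first exact: cderZ (FX i s).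
  have f1 : i.+1%:R != 0 :> C by rewrite pnatr_eq0.
  have f2 : i`!%:R != 0 :> C by rewrite pnatr_eq0 -lt0n fact_gt0.
  rewrite factS natrM; move: (i.+1%:R : C) (i`!%:R : C) f1 f2 => p q p0 q0.
  by field; rewrite p0 q0.
apply: cder_ext; last first.
  apply: cder_eq.
    apply: cderD F0 _.
    by apply: (@cder_sum _ _ (index_enum 'I_k) xpredT) => i _; exact: FS i.
  by rewrite add0r.
by move=> t; rewrite /= big_ord_recl.
Qed.

(** Taylor's remainder, by integrating the bound for the previous order along
    the segment from [0] to [z]. *)
Lemma exp_taylor k z :
  nrm (cexp z - exp_sum k z) <= 2 * expR (nrm z) * (2 * nrm z) ^+ k / k`!%:R.
Proof.
pose K := expR (nrm z).
have K0 : 0 < K by exact: expR_gt0.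
pose r k (s : R) := cexp ((s%:C)%C * z) - exp_sum k ((s%:C)%C * z).
have cs s : cder (fun t => (t%:C)%C * z) s z.
  apply: cder_eq; first exact: cderM (cder_real s) (cder_cst z s).
  by rewrite mul1r mulr0 addr0.
have rd k' s : cder (r k'.+1) s (z * r k' s).
  rewrite /r mulrBr; apply: cderD; first exact: cder_cexp (cs s).
  by apply: cderN; apply: exp_sum_der.
pose B k' (s : R) := K * (2 * nrm z) ^+ k' * s ^+ k' / k'`!%:R.
have Bd k' (s : R) : is_derive s 1 (B k'.+1) (2 * nrm z * B k' s).
  have h2 := rderM (rder_cst (K * (2 * nrm z) ^+ k'.+1 / k'.+1`!%:R) s)
    (rderX k' s).
  rewrite (_ : B k'.+1 = fun t => (K * (2 * nrm z) ^+ k'.+1 / k'.+1`!%:R) * t ^+ k'.+1).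
    apply: (is_derive_eq h2); rewrite mul0r add0r /B exprS factS natrM.
    have f1 : k'.+1%:R != 0 :> R by rewrite pnatr_eq0.
    have f2 : k'`!%:R != 0 :> R by rewrite pnatr_eq0 -lt0n fact_gt0.
    move: (k'.+1%:R : R) (k'`!%:R : R) f1 f2 => p q p0 q0.
    by field; rewrite p0 q0.
  by apply/funext => t; rewrite /B mulrAC.
suff main k' s : 0 <= s <= 1 ->
    `|complex.Re (r k' s)| <= B k' s /\ `|complex.Im (r k' s)| <= B k' s.
  have [] := main k 1; first by rewrite ler01 lexx.
  rewrite /r /B rmorph1 mul1r expr1n mulr1 => a b.
  apply: le_trans (nrm_ReIm _) _; apply: le_trans (lerD a b) _.
  by rewrite -/K; lra.
elim: k' s => [|k' IH] s /andP[s0 s1].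
  have h : nrm (r 0%N s) <= B 0%N s.
    rewrite /r /exp_sum big_ord0 subr0 nrm_cexp /B fact0 !expr0 invr1 !mulr1.
    rewrite ler_expR ReM /= mul0r subr0.
    apply: le_trans (ler_norm _) _; rewrite normrM ger0_norm //.
    apply: le_trans (ler_wpM2r (normr_ge0 _) s1) _; rewrite mul1r.
    exact: nrm_Re.
  by split; apply: le_trans h; [exact: nrm_Re|exact: nrm_Im].
have B0 : B k'.+1 0 = 0 by rewrite /B expr0n mulr0 mul0r.
have r0 : r k'.+1 0 = 0.
  rewrite /r rmorph0 mul0r cexp0 /exp_sum big_ord_recl /= big1 ?addr0.
    by rewrite fact0 invr1 expr0 mulr1 subrr.
  by move=> i _; rewrite expr0n mulr0.
have bnd t : 0 <= t <= s -> nrm (z * r k' t) <= 2 * nrm z * B k' t.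
  move=> /andP[t0 ts]; have [] := IH t; first by rewrite t0 (le_trans ts s1).
  move=> a b; rewrite nrmM -mulrA mulrCA.
  apply: ler_wpM2l (nrm_ge0 _) _ _ _.
  by apply: le_trans (nrm_ReIm _) _; lra.
have pm (f : R -> R) f' : f 0 = 0 -> (forall t : R, is_derive t 1 f (f' t)) ->
    (forall t, 0 <= t <= s -> `|f' t| <= 2 * nrm z * B k' t) ->
    `|f s| <= B k'.+1 s.
  move=> f0 fd fb; rewrite ler_norml; apply/andP; split.
    have := @ge0_of_der (fun t => B k'.+1 t + f t) _ s s0
      (fun t => rderD (Bd k' t) (fd t)).
    rewrite B0 f0 addr0 => /(_ _ (lexx 0)) h.
    rewrite -subr_ge0 opprK addrC; apply: h => t ts.
    by have := fb t ts; rewrite ler_norml => /andP[]; lra.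
  have := @ge0_of_der (fun t => B k'.+1 t - f t) _ s s0
    (fun t => rderB (Bd k' t) (fd t)).
  rewrite B0 f0 subr0 => /(_ _ (lexx 0)) h.
  rewrite -subr_ge0; apply: h => t ts.
  by have := fb t ts; rewrite ler_norml => /andP[]; lra.
split.
  apply: (pm (fun t => complex.Re (r k'.+1 t)) _ _ (fun t => (rd k' t).1)).
    by rewrite r0.
  by move=> t ts; apply: le_trans (nrm_Re _) (bnd t ts).
apply: (pm (fun t => complex.Im (r k'.+1 t)) _ _ (fun t => (rd k' t).2)).
  by rewrite r0.
by move=> t ts; apply: le_trans (nrm_Im _) (bnd t ts).
Qed.

Lemma exp_sum_cvg z : (exp_sum k z : C^o) @[k --> \oo] --> (cexp z : C^o).
Proof.
apply/cvgCP => e e0.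
have K0 : 0 < 2 * expR (nrm z) by rewrite mulr_gt0 // expR_gt0.
have := cvg_series_cvg_0 (@is_cvg_series_exp_coeff R (2 * nrm z)).
move=> /cvgrPdist_lt /(_ (e / (2 * expR (nrm z)))); rewrite divr_gt0 // => /(_ isT).
apply: filterS => k; rewrite sub0r normrN => h.
rewrite nrmBC; apply: le_lt_trans (exp_taylor k z) _.
rewrite -mulrA -ltr_pdivlMl // [ltRHS]mulrC.
exact: le_lt_trans (ler_norm _) h.
Qed.

End ComplexExponential.

(** * Holomorphic functions *)

Section Holomorphic.
Context {R : realType}.
Local Notation C := R[i].
Implicit Types (f g : C -> C) (w z : C).

(** A type of its own, since [derivable] unfolds to an inclusion of filters, which
    tactics would take for an implication. *)
Variant cdiff f w : Prop := CDiff of derivable (f : C^o -> C^o) w 1.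

Lemma cdiffP f w : cdiff f w <-> derivable (f : C^o -> C^o) w 1.
Proof. by split=> [[]|]. Qed.

Lemma cdiff_ext f g w : f =1 g -> cdiff f w -> cdiff g w.
Proof. by move=> /funext ->. Qed.

Lemma cdiff_near f g w : (\forall s \near (w : C^o), f s = g s) ->
  cdiff f w -> cdiff g w.
Proof. by move=> fg [cf]; split; apply: near_eq_derivable cf. Qed.

Lemma cdiff_cst z w : cdiff (fun _ => z) w.
Proof. by split; exact: derivable_cst. Qed.

Lemma cdiff_id w : cdiff (fun s => s) w.
Proof. by split; exact: derivable_id. Qed.

Lemma cdiffD f g w : cdiff f w -> cdiff g w -> cdiff (fun s => f s + g s) w.
Proof. by move=> [cf] [cg]; split; exact: (derivableD cf cg). Qed.

Lemma cdiffM f g w : cdiff f w -> cdiff g w -> cdiff (fun s => f s * g s) w.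
Proof. by move=> [cf] [cg]; split; exact: (derivableM cf cg). Qed.

Lemma cdiffN f w : cdiff f w -> cdiff (fun s => - f s) w.
Proof. by move=> [cf]; split; exact: (derivableN cf). Qed.

Lemma cdiffB f g w : cdiff f w -> cdiff g w -> cdiff (fun s => f s - g s) w.
Proof. by move=> cf cg; exact: cdiffD cf (cdiffN cg). Qed.

Lemma cdiffV f w : f w != 0 -> cdiff f w -> cdiff (fun s => (f s)^-1) w.
Proof. by move=> f0 [cf]; split; exact: (derivableV f0 cf). Qed.

Lemma cdiffX f w k : cdiff f w -> cdiff (fun s => f s ^+ k) w.
Proof.
move=> cf; elim: k => [|k IH].
  by apply: (cdiff_ext _ (cdiff_cst 1 w)) => s; rewrite expr0.
by apply: (cdiff_ext _ (cdiffM cf IH)) => s; rewrite exprS.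
Qed.

Lemma cdiff_sum I (r : seq I) (P : pred I) (F : I -> C -> C) w :
  (forall i, P i -> cdiff (F i) w) -> cdiff (fun s => \sum_(i <- r | P i) F i s) w.
Proof.
move=> FL; elim: r => [|i r IH].
  by apply: (cdiff_ext _ (cdiff_cst 0 w)) => s; rewrite big_nil.
case Pi: (P i).
  by apply: (cdiff_ext _ (cdiffD (FL i Pi) IH)) => s; rewrite big_cons Pi.
by apply: (cdiff_ext _ IH) => s; rewrite big_cons Pi.
Qed.

Lemma cdiff_comp f g w : cdiff f w -> cdiff g (f w) -> cdiff (fun s => g (f s)) w.
Proof.
move=> [/derivable1_diffP cf] [/derivable1_diffP cg].
by split; apply/derivable1_diffP; exact: (differentiable_comp cf cg).
Qed.

Lemma cdiff_cont f w : cdiff f w -> {for w, continuous (f : C^o -> C^o)}.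
Proof. by move=> [/derivable1_diffP /differentiable_continuous]. Qed.

(** A quadratic remainder is what Taylor estimates provide. *)
Lemma cdiff_quad f w l (K : R) : 0 <= K ->
  (forall h, nrm h <= 1 -> nrm (f (w + h) - f w - h * l) <= K * nrm h ^+ 2) ->
  cdiff f w.
Proof.
move=> K0 fq; split; apply/cvg_ex; exists l; apply/cvgCP => e e0.
apply/dnear_nrm; exists (Num.min 1 (e / (K + 1))).
  by rewrite lt_min ltr01 divr_gt0 //; lra.
move=> h h0; rewrite subr0 lt_min => /andP[h1].
rewrite ltr_pdivlMr; last by lra.
move=> he; rewrite /= -[_ *: _]/(_ * _) -[h *: _]/(h * _) mulr1.
have hp : 0 < nrm h by rewrite nrm_gt0.
rewrite (_ : _ - l = h^-1 * (f (w + h) - f w - h * l)).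
  rewrite nrmM nrmV -ltr_pdivlMl ?invr_gt0 // invrK.
  apply: le_lt_trans (fq h (ltW h1)) _; rewrite expr2 mulrCA ltr_pM2l //.
  by nra.
by rewrite [h + w]addrC [RHS]mulrBr mulKf.
Qed.

Lemma cdiff_conj f w : cdiff f w^* -> cdiff (fun s => (f s^*)^*) w.
Proof.
move=> [/cvg_ex[l /cvgCP fl]]; split; apply/cvg_ex; exists (l^*); apply/cvgCP => e e0.
have /dnear_nrm[r r0 rP] := fl e e0.
apply/dnear_nrm; exists r => // h h0; rewrite subr0 => hr.
have := rP h^*; rewrite subr0 nrm_conj hr conjC_eq0 h0 => /(_ isT isT).
rewrite /= -[_ *: (_ - _)]/(_ * _) -[h^* *: _]/(h^* * _) mulr1.
rewrite -[h *: 1]/(h * 1) mulr1 -[_ *: (_ - _)]/(_ * _).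
rewrite -nrm_conj rmorphB rmorphM rmorphB /= fmorphV /= conjCK => h1.
by rewrite rmorphD.
Qed.

Lemma cdiff_cexp w : cdiff (@cexp R) w.
Proof.
(* For [nrm h <= 1] the remainder of order 2 is at most
   [2 e (2 nrm h)^2 / 2! = 4 e (nrm h)^2]. *)
apply: (@cdiff_quad _ _ (cexp w) (nrm (cexp w) * (4 * expR 1))).
  by rewrite mulr_ge0 ?nrm_ge0 // mulr_ge0 // expR_ge0.
move=> h h1; rewrite cexpD.
rewrite (_ : _ - _ = cexp w * (cexp h - exp_sum 2 h)); last first.
  rewrite /exp_sum !big_ord_recl big_ord0 /= /bump /= fact0 !invr1; ring.
rewrite nrmM -mulrA ler_wpM2l ?nrm_ge0 //.
apply: le_trans (exp_taylor _ _) _.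
rewrite (_ : (2`!)%:R = 2) // exprMn.
have : expR (nrm h) <= expR 1 by rewrite ler_expR.
have := expR_gt0 (nrm h); have := sqr_ge0 (nrm h); nra.
Qed.

Definition phi z : C := if z == 0 then 1 else (cexp z - 1) / z.

Lemma phiE z : z * phi z = cexp z - 1.
Proof.
rewrite /phi; case: eqP => [->|/eqP z0]; first by rewrite mul0r cexp0 subrr.
by rewrite mulrC divfK.
Qed.

Lemma cdiff_phi w : cdiff phi w.
Proof.
have [->|w0] := eqVneq w 0; last first.
  have near0 : \forall s \near (w : C^o), (cexp s - 1) / s = phi s.
    apply/near_nrm; exists (nrm w); first by rewrite nrm_gt0.
    move=> s sw; rewrite /phi; case: eqP => // s0; move: sw.
    by rewrite s0 sub0r nrmN ltxx.
  apply: cdiff_near near0 _; apply: cdiffM.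
    by apply: cdiffB; [exact: cdiff_cexp|exact: cdiff_cst].
  by apply: cdiffV => //; exact: cdiff_id.
(* The remainder of order 3 of [exp], at most [2 e (2 nrm h)^3 / 3!], divided by [h]. *)
apply: (@cdiff_quad _ _ 2^-1 (8 / 3 * expR 1)).
  by rewrite mulr_ge0 // ?expR_ge0 // divr_ge0.
move=> h h1; rewrite add0r.
have phi0 : phi 0 = 1 by rewrite /phi eqxx.
have [->|h0] := eqVneq h 0.
  by rewrite phi0 subrr mul0r subrr nrm0 expr0n mulr0.
have hp : 0 < nrm h by rewrite nrm_gt0.
rewrite -(ler_pM2l hp) -nrmM mulrBr mulrBr phiE phi0.
rewrite (_ : _ - _ - _ = cexp h - exp_sum 3 h); last first.
  rewrite /exp_sum !big_ord_recl big_ord0 /= /bump /= fact0 !invr1.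
  by rewrite (_ : (1 + (1 + 0))`! = 2%N) //; field.
apply: le_trans (exp_taylor _ _) _.
rewrite (_ : (3`!)%:R = 6) // exprMn.
have : expR (nrm h) <= expR 1 by rewrite ler_expR.
have := expR_gt0 (nrm h).
have h3 : 0 <= nrm h ^+ 3 by rewrite exprn_ge0 // nrm_ge0.
rewrite (_ : nrm h * _ = 8 / 3 * expR 1 * nrm h ^+ 3); last by ring.
by nra.
Qed.

Definition mdiff m p (f : C -> 'M[C]_(m, p)) w : Prop :=
  forall i j, cdiff (fun s => f s i j) w.

Lemma mdiff_ext m p (f g : C -> 'M[C]_(m, p)) w :
  f =1 g -> mdiff f w -> mdiff g w.
Proof. by move=> /funext ->. Qed.

Lemma mdiff_cst m p (A : 'M[C]_(m, p)) w : mdiff (fun _ => A) w.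
Proof. by move=> i j; apply: cdiff_cst. Qed.

Lemma mdiffD m p (f g : C -> 'M[C]_(m, p)) w :
  mdiff f w -> mdiff g w -> mdiff (fun s => f s + g s) w.
Proof.
move=> ff gg i j.
by apply: (cdiff_ext _ (cdiffD (ff i j) (gg i j))) => s; rewrite mxE.
Qed.

Lemma mdiffN m p (f : C -> 'M[C]_(m, p)) w :
  mdiff f w -> mdiff (fun s => - f s) w.
Proof.
move=> ff i j.
by apply: (cdiff_ext _ (cdiffN (ff i j))) => s; rewrite mxE.
Qed.

Lemma mdiffM m p q (f : C -> 'M[C]_(m, p)) (g : C -> 'M[C]_(p, q)) w :
  mdiff f w -> mdiff g w -> mdiff (fun s => f s *m g s) w.
Proof.
move=> ff gg i j.
have := cdiff_sum (index_enum _) (P := xpredT)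
  (fun k _ => cdiffM (ff i k) (gg k j)).
by apply: cdiff_ext => s; rewrite mxE.
Qed.

Lemma mdiffZ m p (f : C -> C) (g : C -> 'M[C]_(m, p)) w :
  cdiff f w -> mdiff g w -> mdiff (fun s => f s *: g s) w.
Proof.
move=> ff gg i j.
by apply: (cdiff_ext _ (cdiffM ff (gg i j))) => s; rewrite mxE.
Qed.

Lemma mdiff_sum m p I (r : seq I) (P : pred I) (F : I -> C -> 'M[C]_(m, p)) w :
  (forall i, P i -> mdiff (F i) w) ->
  mdiff (fun s => \sum_(i <- r | P i) F i s) w.
Proof.
move=> FF i j.
have := cdiff_sum r (P := P) (fun k Pk => FF k Pk i j).
by apply: cdiff_ext => s; rewrite summxE.
Qed.

Lemma mdiff_diag m (f : C -> 'rV[C]_m) w :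
  mdiff f w -> mdiff (fun s => diag_mx (f s)) w.
Proof.
move=> ff i j; apply: (@cdiff_ext (fun s => f s 0 i *+ (i == j))).
  by move=> s; rewrite mxE.
case: (i == j); last exact: cdiff_cst.
exact: ff.
Qed.

Lemma mdiff_conj m (f : C -> 'M[C]_m) w :
  mdiff f w^* -> mdiff (fun s => (f s^*) ^t*) w.
Proof.
move=> ff i j; apply: (cdiff_ext _ (cdiff_conj (ff j i))) => s.
by rewrite !mxE.
Qed.

(** Identities between holomorphic functions need only be checked away from the
    poles of the factors that occur in them. *)
Lemma mdiff_eq_off m p (f g : C -> 'M[C]_(m, p)) w :
  mdiff f w -> mdiff g w -> (\forall s \near (w : C^o)^', f s = g s) -> f w = g w.
Proof.
move=> ff gg fg; apply/matrixP => i j.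
apply: (@continuous_eq_off R (fun s => f s i j) (fun s => g s i j)).
- exact: cdiff_cont.
- exact: cdiff_cont.
- by apply: filterS fg => s ->.
Qed.

End Holomorphic.

(** * Exponentials of commuting anti-Hermitian matrices *)

Section MatrixExponential.
Context {R : realType} {n : nat}.
Local Notation C := R[i].
Local Notation M := 'M[C]_n.
Implicit Types (a b A B P : M) (d : 'rV[C]_n).

Lemma cvgC_sum (I : finType) (F : I -> nat -> C) (L : I -> C) :
  (forall i, (F i m : C^o) @[m --> \oo] --> (L i : C^o)) ->
  ((\sum_i F i m : C) : C^o) @[m --> \oo] --> ((\sum_i L i : C) : C^o).
Proof.
move=> FL.
have : forall s : seq I, ((\sum_(i <- s) F i m : C) : C^o) @[m --> \oo] -->
    ((\sum_(i <- s) L i : C) : C^o).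
  elim=> [|i s IH].
    rewrite big_nil; under eq_fun do rewrite big_nil.
    exact: cvg_cst.
  rewrite big_cons; under eq_fun do rewrite big_cons.
  exact: cvgD (FL i) IH.
exact.
Qed.

Lemma expmxE A (L : M) :
  (forall i j, ((\sum_(k < m) (k`!%:R)^-1 *: A ^+ k) i j : C^o) @[m --> \oo]
    --> (L i j : C^o)) -> expmx A = L.
Proof.
move=> AL; apply/matrixP => i j; rewrite mxE.
exact: (cvg_lim (@norm_hausdorff _ _) (AL i j)).
Qed.

Lemma exprmx_similar P d k : P \in unitmx ->
  (invmx P *m diag_mx d *m P) ^+ k =
  invmx P *m diag_mx (map_mx (fun c => c ^+ k) d) *m P.
Proof.
move=> Pu; elim: k => [|k IH].
  rewrite expr0 (_ : map_mx _ d = const_mx 1).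
    by rewrite diag_const_mx mulmx1 mulVmx.
  by apply/rowP => i; rewrite !mxE expr0.
rewrite exprS IH -[_ * _]/(_ *m _) !mulmxA; congr (_ *m P).
rewrite mulmxK // -mulmxA mulmx_diag.
by congr (_ *m diag_mx _); apply/rowP => i; rewrite !mxE exprS.
Qed.

(** In the basis that diagonalizes the matrix the partial sums are scalar ones. *)
Lemma expmx_cvg_similar P d i j : P \in unitmx ->
  ((\sum_(k < m) (k`!%:R)^-1 *: (invmx P *m diag_mx d *m P) ^+ k) i j : C^o)
    @[m --> \oo] --> ((invmx P *m diag_mx (map_mx (@cexp R) d) *m P) i j : C^o).
Proof.
move=> Pu.
have -> : (invmx P *m diag_mx (map_mx (@cexp R) d) *m P) i j =
    \sum_l invmx P i l * P l j * cexp (d 0 l).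
  rewrite mxE; apply: eq_bigr => l _.
  by rewrite mul_mx_diag !mxE mulrAC.
rewrite (_ : (fun m : nat => _) = fun m =>
    \sum_l invmx P i l * P l j * exp_sum m (d 0 l)).
  by apply: cvgC_sum => l; apply: cvgM; [exact: cvg_cst|exact: exp_sum_cvg].
apply/funext => m; rewrite summxE.
under [RHS]eq_bigr do rewrite big_distrr.
rewrite exchange_big; apply: eq_bigr => k _ /=.
rewrite exprmx_similar // mxE mxE big_distrr; apply: eq_bigr => l _ /=.
by rewrite mul_mx_diag !mxE; ring.
Qed.

Lemma expmx_similar P d : P \in unitmx ->
  expmx (invmx P *m diag_mx d *m P) =
  invmx P *m diag_mx (map_mx (@cexp R) d) *m P.
Proof. by move=> Pu; apply: expmxE => i j; apply: expmx_cvg_similar. Qed.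

Lemma adj_exp A k : (A ^+ k) ^t* = (A ^t*) ^+ k.
Proof.
elim: k => [|k IH].
  by rewrite !expr0; exact: adj1.
by rewrite exprSr exprS -[_ * A]/(_ *m _) adjM IH.
Qed.

Lemma cvgC_conj (F : nat -> C) (l : C) : (F m : C^o) @[m --> \oo] --> (l : C^o) ->
  ((F m)^* : C^o) @[m --> \oo] --> (l^* : C^o).
Proof.
move=> /cvgCP h; apply/cvgCP => e /h; apply: filterS => m.
by rewrite -nrm_conj rmorphB.
Qed.

Lemma expmx_adj A (L : M) :
  (forall i j, ((\sum_(k < m) (k`!%:R)^-1 *: A ^+ k) i j : C^o) @[m --> \oo]
    --> (L i j : C^o)) -> expmx (A ^t*) = L ^t*.
Proof.
move=> AL; apply: expmxE => i j.
have E m : \sum_(k < m) k`!%:R^-1 *: (A ^t*) ^+ k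
   = (\sum_(k < m) k`!%:R^-1 *: A ^+ k) ^t*.
  rewrite [RHS]adj_sum; apply: eq_bigr => k _.
  by rewrite adjZ -adj_exp fmorphV /= conjC_nat.
have e m : (\sum_(k < m) k`!%:R^-1 *: (A ^t*) ^+ k) i j
   = ((\sum_(k < m) k`!%:R^-1 *: A ^+ k) j i)^*.
  exact: (etrans (congr1 (fun X : M => X i j) (E m)) (adjE _ _ _)).
have -> : (L ^t*) i j = (L j i)^* by exact: adjE.
rewrite (funext e).
exact: cvgC_conj (AL j i).
Qed.

Lemma expmx_adj_similar P d : P \in unitmx ->
  expmx ((invmx P *m diag_mx d *m P) ^t*) =
  (invmx P *m diag_mx (map_mx (@cexp R) d) *m P) ^t*.
Proof. by move=> Pu; apply: expmx_adj => i j; apply: expmx_cvg_similar. Qed.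

(** Normal matrices are diagonalizable and commuting diagonalizable matrices
    are so simultaneously. *)
Lemma codiagonal a b : is_diag_mx a -> u_alg b -> lie a b = 0 ->
  exists P (da db : 'rV[C]_n), [/\ P \in unitmx,
    a = invmx P *m diag_mx da *m P & b = invmx P *m diag_mx db *m P].
Proof.
move=> adiag bu /eqP; rewrite subr_eq0 => /eqP ab.
have simE P A d : P \in unitmx -> similar P A (diag_mx d) ->
    A = invmx P *m diag_mx d *m P.
  move=> Pu /(similarP Pu) PA.
  by rewrite -mulmxA -PA mulKmx.
have bd : exists2 P : M, P \in unitmx & similar_diag P b.
  have bn : b \is normalmx.
    by apply/normalmxP; rewrite bu mulmxN mulNmx.
  exists (spectralmx b); first exact/unitarymx_unit/spectral_unitarymx.
  apply/similar_diagPex; exists (spectral_diag b).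
  have Pu := spectral_unit b.
  by apply/(similarP Pu); rewrite {2}(orthomx_spectralP bn) -mulmxA mulKVmx.
have ad : exists2 P : M, P \in unitmx & similar_diag P a.
  exists 1%:M; first exact: unitmx1.
  apply/similar_diagPex; have /diag_mxP[d ->] := adiag; exists d.
  by apply/similarP; rewrite ?unitmx1 // mul1mx mulmx1.
have [|P Pu] := (codiagonalizableP [:: a; b]).1.
  split.
    move=> f g; rewrite !inE => /orP[]/eqP-> /orP[]/eqP->; rewrite /comm_mx //.
  move=> f; rewrite inE => /orP[/eqP->|]; first exact: ad.
  by rewrite mem_seq1 => /eqP ->; exact: bd.
move=> /allP h.
have ha : similar_diag P a by apply: h; exact: mem_head.
have hb : similar_diag P b by apply: h; rewrite in_cons mem_head orbT.
have [da {}ha] := similar_diagPex ha; have [db {}hb] := similar_diagPex hb.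
by exists P, da, db; split; [exact: Pu|exact: simE Pu ha|exact: simE Pu hb].
Qed.

End MatrixExponential.

(** * Positivity of Cauchy matrices *)

Section Cauchy.
Context {R : realType} {N : nat}.
Local Notation C := R[i].
Variable z : 'I_N -> C.
Hypothesis z_inj : injective z.
Hypothesis z_conj : forall m k, z m != (z k)^*.
Implicit Types (c : 'I_N -> C) (s : R) (A : seq 'I_N).

Definition cauchy s (m k : 'I_N) : C := (s%:C)%C * 'i%C / (z m - (z k)^*).

(** Restricted to the points listed in [A], for an induction on the points. *)
Definition cauchy_form s A c : C :=
  \sum_(m <- A) \sum_(k <- A) cauchy s m k * ((c m)^* * c k).

Definition sqnorm A c : R := \sum_(k <- A) nrm (c k) ^+ 2.

Let den m k : z m - (z k)^* != 0.
Proof. by rewrite subr_eq0. Qed.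

Let den' m k : (z k)^* - z m != 0.
Proof. by rewrite subr_eq0 eq_sym. Qed.

Lemma sqnorm_ge0 A c : 0 <= sqnorm A c.
Proof. by apply: sumr_ge0 => k _; apply: sqr_ge0. Qed.

Lemma nrm_sqrD (x y : C) : nrm (x + y) ^+ 2 <= 2 * nrm x ^+ 2 + 2 * nrm y ^+ 2.
Proof.
have := nrmD x y; have := nrm_ge0 (x + y); have := nrm_ge0 x.
have := nrm_ge0 y; have := sqr_ge0 (nrm x - nrm y); nra.
Qed.

(** A crude form of the Cauchy-Schwarz inequality. *)
Lemma linear_form_bound A (ga : 'I_N -> C) : exists2 K : R, 0 <= K &
  forall c, nrm (\sum_(k <- A) ga k * c k) ^+ 2 <= K * sqnorm A c.
Proof.
elim: A => [|k A [K K0 IH]].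
  by exists 0 => // c; rewrite big_nil nrm0 expr0n /= mul0r.
exists (2 * nrm (ga k) ^+ 2 + 2 * K).
  by rewrite addr_ge0 // mulr_ge0 // sqr_ge0.
move=> c; rewrite big_cons; apply: le_trans (nrm_sqrD _ _) _.
rewrite nrmM exprMn /sqnorm big_cons -/(sqnorm A c).
have := IH c; have := sqr_ge0 (nrm (ga k)); have := sqr_ge0 (nrm (c k)).
have := sqnorm_ge0 A c; set x := _ ^+ 2; set y := nrm (ga k) ^+ 2.
by set X := nrm _ ^+ 2; nra.
Qed.

Lemma weights_bound A (b : 'I_N -> C) : (forall k, k \in A -> b k != 0) ->
  exists2 be : R, 0 < be & forall c,
    be * sqnorm A c <= sqnorm A (fun k => b k * c k).
Proof.
elim: A => [|k A IH] b0.
  by exists 1 => // c; rewrite /sqnorm !big_nil mulr0.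
have [|be be0 {}IH] := IH; first by move=> m mA; apply: b0; rewrite inE mA orbT.
have bk : 0 < nrm (b k) ^+ 2 by rewrite exprn_gt0 // nrm_gt0 b0 // mem_head.
exists (Num.min be (nrm (b k) ^+ 2)); first by rewrite lt_min be0 bk.
move=> c; rewrite /sqnorm !big_cons -/(sqnorm A c) -/(sqnorm A (fun k => b k * c k)).
rewrite nrmM exprMn mulrDr lerD //.
  by rewrite ler_wpM2r ?sqr_ge0 // ge_min lexx orbT.
apply: le_trans (IH c); apply: ler_wpM2r; first exact: sqnorm_ge0.
by rewrite ge_min lexx.
Qed.

(** Completing the square with respect to the first point: the Schur
    complement of a Cauchy matrix is again a Cauchy matrix, up to rescaling the
    variables. *)
Lemma cauchy_form_cons s p A c : s != 0 ->
  cauchy_form s (p :: A) c =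
  cauchy s p p *
    ((nrm (c p + \sum_(k <- A) (z p - (z p)^*) / (z p - (z k)^*) * c k) ^+ 2)%:C)%C
  + cauchy_form s A (fun k => ((z k)^* - (z p)^*) / ((z k)^* - z p) * c k).
Proof.
move=> s0; pose h := cauchy s p p.
pose ga k := (z p - (z p)^*) / (z p - (z k)^*).
have hga k : h * ga k = cauchy s p k.
  rewrite /h /ga /cauchy; field.
  by rewrite !den.
have hgac k : h * (ga k)^* = cauchy s k p.
  rewrite /h /ga /cauchy fmorph_div !rmorphB /= !conjCK; field.
  by rewrite !den !den'.
have schur m k : cauchy s m k = h * ((ga m)^* * ga k) +
   cauchy s m k * ((((z m)^* - (z p)^*) / ((z m)^* - z p))^* *
    (((z k)^* - (z p)^*) / ((z k)^* - z p))).
  rewrite /h /ga /cauchy !fmorph_div !rmorphB /= !conjCK; field.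
  by rewrite !den !den'.
rewrite -mul_conj -/h; set Y := \sum_(k <- A) _.
rewrite {1}/cauchy_form big_cons big_cons -/h.
have -> : \sum_(m <- A) \sum_(k <- p :: A) cauchy s m k * ((c m)^* * c k) =
    \sum_(m <- A) cauchy s m p * ((c m)^* * c p) + cauchy_form s A c.
  by rewrite -big_split; apply: eq_bigr => m _; rewrite big_cons.
have e1 : \sum_(k <- A) cauchy s p k * ((c p)^* * c k) = h * (c p)^* * Y.
  rewrite /Y big_distrr; apply: eq_bigr => k _ /=.
  by rewrite -hga /ga; ring.
have e2 : \sum_(k <- A) cauchy s k p * ((c k)^* * c p) = h * Y^* * c p.
  rewrite /Y rmorph_sum big_distrr big_distrl; apply: eq_bigr => k _ /=.
  by rewrite -/(ga k) rmorphM /= -hgac; ring.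
have e3 : cauchy_form s A c = h * (Y^* * Y) +
   cauchy_form s A (fun k => ((z k)^* - (z p)^*) / ((z k)^* - z p) * c k).
  have -> : h * (Y^* * Y) = \sum_(m <- A) \sum_(k <- A)
      h * ((ga m)^* * ga k) * ((c m)^* * c k).
    rewrite {1}/Y rmorph_sum big_distrl big_distrr; apply: eq_bigr => m _ /=.
    rewrite /Y big_distrr big_distrr; apply: eq_bigr => k _ /=.
    by rewrite -/(ga m) -/(ga k) rmorphM /=; ring.
  rewrite /cauchy_form -big_split; apply: eq_bigr => m _.
  rewrite -big_split; apply: eq_bigr => k _ /=.
  have cj (x y : C) : (x * y)^* = x^* * y^* by exact: rmorphM.
  by rewrite {1}[cauchy s m k]schur (cj _ (c m)); ring.
by rewrite e1 e2 e3 rmorphD /=; ring.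
Qed.

Lemma cauchy_diag s p : cauchy s p p = ((s / (2 * complex.Im (z p)))%:C)%C.
Proof.
have zp : complex.Im (z p) != 0.
  apply/eqP => e; have := den p p; case: (z p) e => x y /= ->.
  by rewrite subr_eq0 eq_complex /= oppr0 !eqxx.
rewrite /cauchy.
have -> : z p - (z p)^* = 'i%C * ((2 * complex.Im (z p))%:C)%C.
  by case: (z p) => x y; simpc => /=; congr (Complex _ _); ring.
rewrite fmorph_div /=.
have i0 : 'i%C != 0 :> C by rewrite eq_complex /= oner_eq0 andbF.
have y0 : ((2 * complex.Im (z p))%:C)%C != 0 :> C.
  by rewrite eq_complex /= eqxx andbT mulf_neq0 // pnatr_eq0.
move: ((2 * complex.Im (z p))%:C)%C y0 'i%C i0 ((s%:C)%C) => Y Y0 I I0 S.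
by field; rewrite Y0 I0.
Qed.

(** The diagonal entry is positive by the sign hypothesis, the Schur complement by
    induction; the rescaling of the variables costs a constant only, since its
    weights do not vanish for distinct points. *)
Lemma cauchy_form_pos s A : s != 0 -> uniq A ->
  (forall k, k \in A -> 0 < s * complex.Im (z k)) ->
  exists2 de : R, 0 < de &
    forall c, de * sqnorm A c <= complex.Re (cauchy_form s A c).
Proof.
move=> s0; elim: A => [_ _|p A IH /= /andP[pA uA] sgn].
  by exists 1 => // c; rewrite /sqnorm /cauchy_form !big_nil mulr0.
have [//||de de0 {}IH] := IH; first by move=> k kA; apply: sgn; rewrite inE kA orbT.
pose b k := ((z k)^* - (z p)^*) / ((z k)^* - z p).
have [be be0 bP] : exists2 be : R, 0 < be & forall c,
    be * sqnorm A c <= sqnorm A (fun k => b k * c k).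
  apply: weights_bound => k kA; apply: mulf_neq0; last by rewrite invr_eq0.
  rewrite -rmorphB conjC_eq0 subr_eq0; apply: contraNneq pA => /z_inj <-.
  exact: kA.
have [K K0 KP] := linear_form_bound A (fun k => (z p - (z p)^*) / (z p - (z k)^*)).
pose h := s / (2 * complex.Im (z p)).
have h0 : 0 < h.
  have sp := sgn p (mem_head _ _).
  have p0 : complex.Im (z p) != 0.
    by apply: contraTneq sp => ->; rewrite mulr0 ltxx.
  have -> : h = (s * complex.Im (z p)) / (2 * complex.Im (z p) ^+ 2).
    by rewrite /h; field; rewrite p0.
  by rewrite divr_gt0 // mulr_gt0 // lt_def sqr_ge0 andbT expf_neq0.
have K1 : 0 < 2 * K + 1 by lra.
(* [nrm (c p) ^+ 2 <= 2 nrm (c p + Y) ^+ 2 + 2 K sqnorm A c]: the first constant lets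
   [h] absorb the first term, the second lets the Schur complement absorb the rest. *)
have mu0' : 0 < Num.min (h / 2) (de * be / (2 * K + 1)).
  by rewrite lt_min (divr_gt0 h0 (ltr0Sn R 1)) (divr_gt0 (mulr_gt0 de0 be0) K1).
exists (Num.min (h / 2) (de * be / (2 * K + 1))); first exact: mu0'.
move=> c; rewrite cauchy_form_cons // cauchy_diag ReD ReM /= !mul0r subr0.
set Y := \sum_(k <- A) _.
have h1 := KP c; rewrite -/Y in h1.
have h2 := IH (fun k => b k * c k); rewrite /b in h2.
have h3 := bP c.
rewrite /sqnorm big_cons -/(sqnorm A c).
have h4 : nrm (c p) ^+ 2 <= 2 * nrm (c p + Y) ^+ 2 + 2 * nrm Y ^+ 2.
  by have := nrm_sqrD (c p + Y) (- Y); rewrite addrK nrmN.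
have S0 := sqnorm_ge0 A c.
set mu := Num.min _ _.
have m1 : mu <= h / 2 by rewrite ge_min lexx.
have m2 : mu * (2 * K + 1) <= de * be.
  by rewrite -ler_pdivlMr ?ge_min ?lexx ?orbT //; lra.
have mu0 : 0 < mu by exact: mu0'.
have u0 := sqr_ge0 (nrm (c p + Y)).
have h5 : de * be * sqnorm A c <= complex.Re (cauchy_form s A (fun k => b k * c k)).
  apply: le_trans h2; rewrite -mulrA ler_wpM2l //; exact: ltW.
rewrite -/h.
apply: (@le_trans _ _ (h * nrm (c p + Y) ^+ 2 + de * be * sqnorm A c)); last first.
  by rewrite lerD2l.
have h6 : mu * (2 * nrm (c p + Y) ^+ 2) <= h * nrm (c p + Y) ^+ 2.
  by rewrite mulrA ler_wpM2r //; lra.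
have h7 : mu * (2 * K + 1) * sqnorm A c <= de * be * sqnorm A c.
  by rewrite ler_wpM2r.
have h8 : mu * nrm (c p) ^+ 2 <= mu * (2 * nrm (c p + Y) ^+ 2 + 2 * (K * sqnorm A c)).
  by rewrite ler_wpM2l ?(ltW mu0) //; lra.
by rewrite mulrDr; lra.
Qed.

(** The sign that makes the two diagonal blocks (poles in the upper and in the
    lower half-plane) positive. *)
Definition zsgn (k : 'I_N) : R := Num.sg (complex.Im (z k)).

Lemma zsgnE k : (0 < complex.Im (z k) /\ zsgn k = 1) \/
  (complex.Im (z k) < 0 /\ zsgn k = -1).
Proof.
have [h|h|e] := ltgtP (complex.Im (z k)) 0.
- by right; rewrite /zsgn ltr0_sg.
- by left; rewrite /zsgn gtr0_sg.
have := z_conj k k; case: (z k) e => x y /= ->.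
by rewrite eq_complex /= oppr0 !eqxx.
Qed.

(** With the signs [zsgn], the off-diagonal blocks contribute purely imaginary
    terms and the diagonal blocks are positive definite Cauchy forms. *)
Lemma cauchy_signed_bound : exists2 de : R, 0 < de & forall c,
  de * (\sum_k nrm (c k) ^+ 2) <=
  complex.Re (\sum_m \sum_k cauchy (zsgn m) m k * ((c m)^* * c k)).
Proof.
pose Ap := [seq k <- index_enum 'I_N | zsgn k == 1].
pose Am := [seq k <- index_enum 'I_N | zsgn k != 1].
have sgp k : zsgn k == 1 -> 0 < complex.Im (z k).
  by case: (zsgnE k) => [[]//|[_ ->]] /eqP h; exfalso; move: h; lra.
have sgm k : zsgn k != 1 -> complex.Im (z k) < 0 /\ zsgn k = -1.
  by case: (zsgnE k) => [[_ ->]|//]; rewrite eqxx.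
have uq : uniq (index_enum 'I_N) by exact: index_enum_uniq.
have [|||d1 d10 P1] := @cauchy_form_pos 1 Ap.
- exact: oner_neq0.
- exact: filter_uniq.
- by move=> k; rewrite mem_filter => /andP[/sgp]; rewrite mul1r.
have [|||d2 d20 P2] := @cauchy_form_pos (-1) Am.
- by rewrite oppr_eq0 oner_eq0.
- exact: filter_uniq.
- by move=> k; rewrite mem_filter => /andP[/sgm[]]; rewrite mulN1r oppr_gt0.
exists (Num.min d1 d2); first by rewrite lt_min d10 d20.
move=> c.
pose f m k := complex.Re (cauchy (zsgn m) m k * ((c m)^* * c k)).
have ReS I (r : seq I) (P : pred I) (F : I -> C) :
    complex.Re (\sum_(i <- r | P i) F i) = \sum_(i <- r | P i) complex.Re (F i).
  by elim/big_rec2: _ => // i x y _ <-; rewrite ReD.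
have -> : complex.Re (\sum_m \sum_k cauchy (zsgn m) m k * ((c m)^* * c k)) =
    \sum_m \sum_k f m k.
  by rewrite ReS; apply: eq_bigr => m _; rewrite ReS.
have opp m k : zsgn m == 1 -> zsgn k != 1 -> f m k + f k m = 0.
  move=> /eqP sm /sgm[_ sk]; rewrite /f sm sk /cauchy.
  rewrite -(Re_conj (_ * ((c k)^* * c m))) -ReD.
  have -> : ((1%:C)%C * 'i%C / (z m - (z k)^*) * ((c m)^* * c k) +
    (((-1)%:C)%C * 'i%C / (z k - (z m)^*) * ((c k)^* * c m))^*) = 0 :> C.
    have -> : ((-1)%:C)%C = -1 :> C by rewrite rmorphN1.
    rewrite !rmorphM fmorphV rmorphB rmorphN1 rmorph1 /= !conjCK.
    have -> : ('i%C : C)^* = - 'i%C by simpc.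
    by field; rewrite den den'.
  by [].
have split_sum (F : 'I_N -> R) :
    \sum_k F k = \sum_(k <- Ap) F k + \sum_(k <- Am) F k.
  by rewrite !big_filter (bigID (fun k => zsgn k == 1)).
have split2 (B : seq 'I_N) : \sum_(m <- B) \sum_k f m k =
    \sum_(m <- B) \sum_(k <- Ap) f m k + \sum_(m <- B) \sum_(k <- Am) f m k.
  by rewrite -big_split; apply: eq_bigr => m _; rewrite split_sum.
rewrite (split_sum (fun m => \sum_k f m k)) !split2.
have cross : \sum_(m <- Ap) \sum_(k <- Am) f m k +
    \sum_(m <- Am) \sum_(k <- Ap) f m k = 0.
  rewrite [X in _ + X]exchange_big -big_split /=.
  rewrite big_seq big1 // => m; rewrite mem_filter => /andP[mp _].
  rewrite -big_split big_seq big1 // => k; rewrite mem_filter => /andP[km _].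
  exact: opp.
have e1 : \sum_(m <- Ap) \sum_(k <- Ap) f m k = complex.Re (cauchy_form 1 Ap c).
  rewrite /cauchy_form ReS big_seq [RHS]big_seq; apply: eq_bigr => m.
  by rewrite mem_filter ReS => /andP[/eqP sm _]; apply: eq_bigr => k _; rewrite /f sm.
have e2 : \sum_(m <- Am) \sum_(k <- Am) f m k = complex.Re (cauchy_form (-1) Am c).
  rewrite /cauchy_form ReS big_seq [RHS]big_seq; apply: eq_bigr => m.
  by rewrite mem_filter ReS => /andP[/sgm[_ sm] _]; apply: eq_bigr => k _; rewrite /f sm.
rewrite e1 e2.
have p1 := P1 c; have p2 := P2 c.
have X0 := sqnorm_ge0 Ap c; have Y0 := sqnorm_ge0 Am c.
rewrite split_sum -/(sqnorm Ap c) -/(sqnorm Am c).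
set mu := Num.min _ _.
have m1 : mu <= d1 by rewrite ge_min lexx.
have m2 : mu <= d2 by rewrite ge_min lexx orbT.
have q1 : mu * sqnorm Ap c <= d1 * sqnorm Ap c by rewrite ler_wpM2r.
have q2 : mu * sqnorm Am c <= d2 * sqnorm Am c by rewrite ler_wpM2r.
by rewrite mulrDr; lra.
Qed.

End Cauchy.

(** * The algebra of the N-soliton *)

Section EntryRules.
Context {R : realType} {m p : nat}.
Local Notation C := R[i].
Implicit Types A B : 'M[C]_(m, p).

Lemma mxDE A B i j : (A + B) i j = A i j + B i j. Proof. exact: mxE. Qed.
Lemma mxNE A i j : (- A) i j = - A i j. Proof. exact: mxE. Qed.
Lemma mxZE c A i j : (c *: A) i j = c * A i j. Proof. exact: mxE. Qed.
Lemma mx0E i j : (0 : 'M[C]_(m, p)) i j = 0. Proof. exact: mxE. Qed.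
End EntryRules.

(* Linear identities between matrices whose products are treated as atoms. *)
Ltac mxabel :=
  let i := fresh in let j := fresh in
  apply/matrixP => i j; rewrite !(mxDE, mxNE, mxZE, mx0E); ring.

Section SolitonAlgebra.
Context {R : realType} {n N : nat}.
Local Notation C := R[i].
Variable z : 'I_N -> C.
Hypothesis z_inj : injective z.
Hypothesis z_conj : forall m k, z m != (z k)^*.
Implicit Types (W : 'M[C]_(n, N)) (D E : 'M[C]_N) (w : C).

Definition Zm : 'M[C]_N := diag_mx (\row_k z k).
Definition Zc : 'M[C]_N := diag_mx (\row_k (z k)^*).

Definition FW W : 'M[C]_N :=
  \matrix_(m, k) ((W ^t* *m W) m k / (z m - (z k)^*)).

Definition nzcols W := forall k, exists l, W l k != 0.

Lemma zden m k : z m - (z k)^* != 0.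
Proof. by rewrite subr_eq0. Qed.

Lemma FWE W m k : FW W m k = (W ^t* *m W) m k / (z m - (z k)^*).
Proof. exact: mxE. Qed.

Lemma ZmE p (X : 'M[C]_(N, p)) m k : (Zm *m X) m k = z m * X m k.
Proof. by rewrite mul_diag_mx mxE mxE. Qed.

Lemma ZcE p (X : 'M[C]_(p, N)) m k : (X *m Zc) m k = X m k * (z k)^*.
Proof. by rewrite mul_mx_diag mxE mxE. Qed.

Lemma F_adj W : (FW W) ^t* = - FW W.
Proof.
apply/matrixP => m k; rewrite adjE mxNE !FWE fmorph_div rmorphB /= conjCK.
have -> : (W ^t* *m W) m k = ((W ^t* *m W) k m)^*.
  by rewrite -adjE adjM adjK.
by rewrite -mulrN -invrN opprB.
Qed.

(** The one identity from which the algebra of the sandwiches follows. *)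
Lemma F_lyapunov W : Zm *m FW W - FW W *m Zc = W ^t* *m W.
Proof.
apply/matrixP => m k; rewrite mxDE mxNE ZmE ZcE FWE.
by field; rewrite zden.
Qed.

(** Each row [l] of [W] contributes a signed Cauchy form in the variables
    [W l k * y k]. Summing over [l] gives a constant that does not depend on [W]. *)
Lemma F_coercive : exists2 de : R, 0 < de & forall W (y : 'cV[C]_N),
  de * (\sum_k (\sum_l nrm (W l k) ^+ 2) * nrm (y k 0) ^+ 2) <=
  \sum_m nrm (y m 0) * nrm ((FW W *m y) m 0).
Proof.
have [de de0 P] := cauchy_signed_bound z_inj z_conj.
exists de => // W y.
have ReS I (r : seq I) (Q : pred I) (G : I -> C) :
    complex.Re (\sum_(i <- r | Q i) G i) = \sum_(i <- r | Q i) complex.Re (G i).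
  by elim/big_rec2: _ => // i a b _ <-; rewrite ReD.
have -> : \sum_k (\sum_l nrm (W l k) ^+ 2) * nrm (y k 0) ^+ 2 =
    \sum_l \sum_k nrm (W l k * y k 0) ^+ 2.
  rewrite exchange_big; apply: eq_bigr => k _; rewrite big_distrl.
  by apply: eq_bigr => l _; rewrite nrmM exprMn.
rewrite big_distrr.
have P' l : de * (\sum_k nrm (W l k * y k 0) ^+ 2) <= complex.Re
    (\sum_m \sum_k cauchy z (zsgn z m) m k * ((W l m * y m 0)^* * (W l k * y k 0))).
  exact: (P (fun k => W l k * y k 0)).
apply: le_trans (ler_sum _ (fun l _ => P' l)) _.
rewrite -ReS exchange_big /=.
have e m : \sum_l \sum_k cauchy z (zsgn z m) m k *
    ((W l m * y m 0)^* * (W l k * y k 0)) =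
    (zsgn z m)%:C%C * 'i%C * (y m 0)^* * (FW W *m y) m 0.
  rewrite exchange_big /= [(FW W *m y) m 0]mxE big_distrr.
  apply: eq_bigr => k _ /=.
  rewrite FWE [(W ^t* *m W) m k]mxE !big_distrl big_distrr.
  apply: eq_bigr => l _ /=; rewrite adjE rmorphM /cauchy /=; ring.
rewrite (eq_bigr _ (fun m _ => e m)) ReS; apply: ler_sum => m _.
apply: le_trans (ler_norm _) _; apply: le_trans (nrm_Re _) _.
rewrite !nrmM nrm_conj nrm_real.
have -> : nrm ('i%C : C) = 1.
  by rewrite /nrm normc_def /= expr0n expr1n add0r sqrtr1.
case: (zsgnE z_conj m) => [[_ ->]|[_ ->]].
  by rewrite normr1 !mul1r.
by rewrite normrN1 !mul1r.
Qed.

(** A null vector of [F] would annihilate the right-hand side of [F_coercive]. *)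
Lemma F_unit W : nzcols W -> FW W \in unitmx.
Proof.
move=> Wnz; rewrite -row_free_unit -kermx_eq0; apply/rowV0P => v /sub_kermxP vF.
have Fv : FW W *m v ^t* = 0.
  have := congr1 (fun X => X ^t*) vF; rewrite adjM F_adj adj0 mulNmx => /eqP.
  by rewrite oppr_eq0 => /eqP.
have [de de0 P] := F_coercive.
have := P W (v ^t*); rewrite Fv.
under [X in _ <= X]eq_bigr do rewrite mx0E nrm0 mulr0.
rewrite [X in _ <= X]big1 // pmulr_rle0 // => le0.
have ge0 k : 0 <= (\sum_l nrm (W l k) ^+ 2) * nrm ((v ^t*) k 0) ^+ 2.
  by rewrite mulr_ge0 ?sqr_ge0 // sumr_ge0 // => l _; apply: sqr_ge0.
have /psumr_eq0P h : \sum_k (\sum_l nrm (W l k) ^+ 2) * nrm ((v ^t*) k 0) ^+ 2 = 0.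
  by apply/eqP; rewrite eq_le le0 sumr_ge0.
apply/rowP => k; rewrite mx0E.
have /eqP := h (fun k _ => ge0 k) k isT.
rewrite mulf_eq0 => /orP[|]; last first.
  by rewrite sqrf_eq0 nrm_eq0 adjE conjC_eq0 => /eqP.
have [l Wl] := Wnz k.
rewrite psumr_eq0 => [/allP /(_ l)|i _]; last exact: sqr_ge0.
by rewrite mem_index_enum /= sqrf_eq0 nrm_eq0 (negPf Wl) => /(_ isT).
Qed.

(** Coercivity, applied to a column of the inverse. The bound is uniform, so it
    persists along the curves of columns considered below. *)
Lemma Finv_bound (c0 : R) : 0 < c0 -> exists B : R, forall W,
  (forall k, c0 <= \sum_l nrm (W l k) ^+ 2) ->
  forall m k, nrm (invmx (FW W) m k) <= B.
Proof.
move=> c00; have [de de0 P] := F_coercive.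
exists ((de * c0)^-1) => W Wc m k.
have Wnz : nzcols W.
  move=> q; apply/existsP; rewrite -[[exists _, _]]negbK; apply/negP.
  rewrite negb_exists => /forallP W0; have := Wc q.
  by rewrite big1 ?leNgt ?c00 // => l _; move: (W0 l); rewrite negbK => /eqP ->;
     rewrite nrm0 expr0n.
have Fu := F_unit Wnz.
pose y := col k (invmx (FW W)).
have yE q : y q 0 = invmx (FW W) q k by rewrite mxE.
have Fy q : (FW W *m y) q 0 = (q == k)%:R.
  have -> : FW W *m y = col k (FW W *m invmx (FW W)).
    by rewrite /y !colE mulmxA.
  by rewrite mulmxV // !mxE.
have rhs : \sum_q nrm (y q 0) * nrm ((FW W *m y) q 0) = nrm (y k 0).
  rewrite (bigD1 k) //= Fy eqxx nrm1 mulr1 big1 ?addr0 // => q /negPf qk.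
  by rewrite Fy qk nrm0 mulr0.
have low q : de * c0 * nrm (y q 0) ^+ 2 <= nrm (y k 0).
  rewrite -rhs; apply: le_trans (P W y); rewrite -mulrA ler_pM2l //.
  rewrite (bigD1 q) //=; apply: (@le_trans _ _
    ((\sum_l nrm (W l q) ^+ 2) * nrm (y q 0) ^+ 2)).
    by rewrite ler_wpM2r ?sqr_ge0.
  rewrite lerDl sumr_ge0 // => i _; rewrite mulr_ge0 ?sqr_ge0 // sumr_ge0 //.
  by move=> l _; apply: sqr_ge0.
rewrite -yE; set B := (de * c0)^-1.
have dc : 0 < de * c0 by rewrite mulr_gt0.
have B0 : 0 < B by rewrite invr_gt0.
have dB : de * c0 * B = 1 by rewrite divff ?gt_eqF.
have t0 := nrm_ge0 (y k 0); have m0 := nrm_ge0 (y m 0).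
have tB : nrm (y k 0) <= B by have := low k; nra.
by have := low m; nra.
Qed.

(** The dressing factor, its inverse, the solution and the coefficients [Q_k] are
    all built from these sandwiches of [F^-1] between diagonal matrices. *)
Definition Smx W D E : 'M[C]_n := W *m D *m invmx (FW W) *m E *m W ^t*.

Lemma SDl W D D' E : Smx W (D + D') E = Smx W D E + Smx W D' E.
Proof. by rewrite /Smx mulmxDr !mulmxDl. Qed.
Lemma SDr W D E E' : Smx W D (E + E') = Smx W D E + Smx W D E'.
Proof. by rewrite /Smx mulmxDr mulmxDl. Qed.
Lemma SNl W D E : Smx W (- D) E = - Smx W D E.
Proof. by rewrite /Smx mulmxN !mulNmx. Qed.
Lemma SZl W c D E : Smx W (c *: D) E = c *: Smx W D E.
Proof. by rewrite /Smx -scalemxAr -!scalemxAl. Qed.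
Lemma SZr W c D E : Smx W D (c *: E) = c *: Smx W D E.
Proof. by rewrite /Smx -scalemxAr -!scalemxAl. Qed.

Lemma S_adj W D E : nzcols W -> (Smx W D E) ^t* = - Smx W (E ^t*) (D ^t*).
Proof.
move=> Wnz; rewrite /Smx !adjM adjK adj_inv ?F_unit // F_adj.
have -> : invmx (- FW W) = - invmx (FW W).
  have Fu := F_unit Wnz.
  have e : - FW W *m - invmx (FW W) = 1%:M by rewrite mulmxN mulNmx opprK mulmxV.
  have [u _] := mulmx1_unit e.
  by rewrite -[RHS](mulKmx u) e mulmx1.
by rewrite !mulmxA !(mulmxN, mulNmx).
Qed.

(** Multiplied by [F^-1] on both sides, the Lyapunov equation carries a factor
    [Zm] across [F^-1] at the price of a product of two sandwiches. *)
Lemma S_lyapunov W D E : nzcols W ->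
  Smx W D (Zm *m E) = Smx W (D *m Zc) E + Smx W D 1%:M *m Smx W 1%:M E.
Proof.
move=> Wnz; have Fu := F_unit Wnz.
have h : invmx (FW W) *m Zm = Zc *m invmx (FW W) +
    invmx (FW W) *m (W ^t* *m W) *m invmx (FW W).
  rewrite -F_lyapunov mulmxBr mulmxBl !mulmxA mulVmx // mul1mx.
  by rewrite mulmxK // addrC subrK.
rewrite /Smx !mulmxA -[_ *m Zm]mulmxA h !(mulmxDr, mulmxDl) !mulmxA.
by rewrite !mulmx1.
Qed.

(** The resolvents of [Zc] and [Zm]. *)
Definition Rc w : 'M[C]_N := diag_mx (\row_k (w - (z k)^*)^-1).
Definition Rm w : 'M[C]_N := diag_mx (\row_k (w - z k)^-1).

Lemma Rc_mul w : (forall k, w != (z k)^*) -> Rc w *m Zc = w *: Rc w - 1%:M.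
Proof.
move=> wz; apply/matrixP => m k; rewrite ZcE mxDE mxNE mxZE !mxE.
have [->|_] := eqVneq m k; last by rewrite !mulr0n mul0r mulr0 subr0.
by rewrite !mulr1n; field; rewrite subr_eq0 wz.
Qed.

Lemma Rm_mul w : (forall k, w != z k) -> Zm *m Rm w = w *: Rm w - 1%:M.
Proof.
move=> wz; apply/matrixP => m k; rewrite ZmE mxDE mxNE mxZE !mxE.
have [->|_] := eqVneq m k; last by rewrite !mulr0n !mulr0 subr0.
by rewrite !mulr1n; field; rewrite subr_eq0 wz.
Qed.

Lemma RcZc w : Rc w *m Zc = Zc *m Rc w.
Proof. by rewrite /Rc /Zc !mulmx_diag; congr diag_mx; apply/rowP => i; rewrite !mxE mulrC. Qed.

Lemma RcE w : (Rc w^*) ^t* = Rm w.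
Proof.
rewrite adj_diag; congr diag_mx; apply/rowP => k.
by rewrite !mxE fmorphV rmorphB /= !conjCK.
Qed.

(** The dressing factor [g~] and its inverse. *)
Definition gsol W w : 'M[C]_n := 1%:M + Smx W 1%:M (Rm w).
Definition ginv W w : 'M[C]_n := 1%:M - Smx W (Rc w) 1%:M.

Lemma gi_adj W w : nzcols W -> (ginv W w^*) ^t* = gsol W w.
Proof. by move=> Wnz; rewrite /ginv /gsol adjB adj1 S_adj // adj1 RcE opprK. Qed.

Lemma gs_adj W w : nzcols W -> (gsol W w^*) ^t* = ginv W w.
Proof. by move=> Wnz; rewrite -gi_adj // conjCK adjK. Qed.

(** The resolvent form of the Lyapunov equation,
    [Rm (W^* W) Rc = Rm F - F Rc], turns the quadratic term into a
    difference of the linear ones. *)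
Lemma gsgi W w : nzcols W -> (forall k, w != z k) -> (forall k, w != (z k)^*) ->
  gsol W w *m ginv W w = 1%:M.
Proof.
move=> Wnz wz wzc; have Fu := F_unit Wnz.
have key : Smx W 1%:M (Rm w) *m Smx W (Rc w) 1%:M = Smx W 1%:M (Rm w) - Smx W (Rc w) 1%:M.
  have h : Rm w *m (W ^t* *m W) *m Rc w = Rm w *m FW W - FW W *m Rc w.
    rewrite -F_lyapunov mulmxBr mulmxBl !mulmxA.
    have RZ : Rm w *m Zm = w *: Rm w - 1%:M.
      rewrite -Rm_mul // /Rm /Zm !mulmx_diag; congr diag_mx.
      by apply/rowP => i; rewrite !mxE mulrC.
    move: (FW W) => f.
    have e1 : Rm w *m Zm *m f *m Rc w = w *: (Rm w *m f *m Rc w) - f *m Rc w.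
      by rewrite RZ mulmxBl mulmxBl mul1mx -!scalemxAl.
    have e2 : Rm w *m f *m Zc *m Rc w = w *: (Rm w *m f *m Rc w) - Rm w *m f.
      by rewrite -mulmxA -RcZc Rc_mul // mulmxBr mulmx1 -scalemxAr.
    by rewrite e1 e2; mxabel.
  rewrite /Smx !mulmx1; move: (FW W) Fu (Rm w) (Rc w) h => f fu r r' h.
  transitivity (W *m invmx f *m (r *m (W ^t* *m W) *m r') *m invmx f *m W ^t*).
    by rewrite !mulmxA.
  rewrite h mulmxBr mulmxBl mulmxBl; congr (_ - _).
    by rewrite !mulmxA (mulmxK fu).
  by rewrite !mulmxA (mulmxKV fu).
rewrite /gsol /ginv mulmxBr mulmx1 mulmxDl mul1mx key; mxabel.
Qed.

Lemma gigs W w : nzcols W -> (forall k, w != z k) -> (forall k, w != (z k)^*) ->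
  ginv W w *m gsol W w = 1%:M.
Proof. by move=> *; apply: mulmx1C; apply: gsgi. Qed.

End SolitonAlgebra.

(** * The flows *)

Section Flows.
Context {R : realType} {n N : nat}.
Local Notation C := R[i].
Variable z : 'I_N -> C.
Hypothesis z_inj : injective z.
Hypothesis z_conj : forall m k, z m != (z k)^*.
Implicit Types (W : 'M[C]_(n, N)) (D E : 'M[C]_N) (c : 'M[C]_n) (w : C) (j : nat).
Local Notation Zm := (Zm z).
Local Notation Zc := (Zc z).
Local Notation F := (FW z).
Local Notation S := (Smx z).

Lemma diag_exp (d : 'rV[C]_N) k : (diag_mx d) ^+ k = diag_mx (map_mx (fun x => x ^+ k) d).
Proof.
elim: k => [|k IH].
  rewrite expr0 (_ : map_mx _ d = const_mx 1) ?diag_const_mx //.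
  by apply/rowP => i; rewrite !mxE expr0.
rewrite exprS IH -[_ * _]/(_ *m _) mulmx_diag; congr diag_mx.
by apply/rowP => i; rewrite !mxE exprS.
Qed.

Lemma ZmXE p (X : 'M[C]_(N, p)) k m i : (Zm ^+ k *m X) m i = z m ^+ k * X m i.
Proof. by rewrite diag_exp mul_diag_mx !mxE. Qed.

Lemma ZcXE p (X : 'M[C]_(p, N)) k i m : (X *m Zc ^+ k) i m = X i m * (z m)^* ^+ k.
Proof. by rewrite diag_exp mul_mx_diag !mxE. Qed.

Lemma Zc_adj k : (Zc ^+ k) ^t* = Zm ^+ k.
Proof.
rewrite !diag_exp adj_diag; congr diag_mx; apply/rowP => i.
by rewrite !mxE rmorphXn /= conjCK.
Qed.

Lemma ZcX k : Zc *m Zc ^+ k = Zc ^+ k.+1. Proof. by rewrite exprS. Qed.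
Lemma ZmX k : Zm *m Zm ^+ k = Zm ^+ k.+1. Proof. by rewrite exprS. Qed.
Lemma ZcXr k : Zc ^+ k *m Zc = Zc ^+ k.+1. Proof. by rewrite exprSr. Qed.

(** Multiplying the columns by [e^(-c conj(z)^j s)] clears the
    denominators of [F] in its derivative, as [(z^j - y^j) / (z - y)] is a polynomial. *)
Lemma F_flow (Wt : R -> 'M[C]_(n, N)) c j s : u_alg c ->
  mder Wt s (- (c *m Wt s *m Zc ^+ j)) ->
  mder (fun t => F (Wt t)) s
    (\sum_(i < j) Zm ^+ (j.-1 - i) *m ((Wt s) ^t* *m c *m Wt s) *m Zc ^+ i).
Proof.
move=> cu dW.
have dWa := mder_adj dW.
have := mderM dWa dW.
have -> : (- (c *m Wt s *m Zc ^+ j)) ^t* *m Wt s +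
    (Wt s) ^t* *m - (c *m Wt s *m Zc ^+ j) =
  Zm ^+ j *m ((Wt s) ^t* *m c *m Wt s) - (Wt s) ^t* *m c *m Wt s *m Zc ^+ j.
  by rewrite adjN !adjM Zc_adj cu !(mulmxN, mulNmx) opprK !mulmxA.
move: ((Wt s) ^t* *m c *m Wt s) => X dG m k.
have e : (fun t => F (Wt t) m k) =
    (fun t => (z m - (z k)^*)^-1 * ((Wt t) ^t* *m Wt t) m k).
  by apply/funext => t; rewrite FWE mulrC.
rewrite e; apply: cder_eq; first exact: cderZ (dG m k).
rewrite mxDE mxNE ZmXE ZcXE [X m k * _]mulrC -mulrBl subrXX -mulrA mulKf ?zden //.
rewrite summxE big_distrl; apply: eq_bigr => i _ /=.
by rewrite ZcXE ZmXE mulrAC.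
Qed.

(** The quadratic term is the contribution of [F_flow]. *)
Lemma S_flow (Wt : R -> 'M[C]_(n, N)) c j s D E : u_alg c ->
  (forall t, nzcols (Wt t)) ->
  mder Wt s (- (c *m Wt s *m Zc ^+ j)) ->
  mder (fun t => S (Wt t) D E) s
    (- (c *m S (Wt s) (Zc ^+ j *m D) E) + S (Wt s) D (E *m Zm ^+ j) *m c -
     \sum_(i < j) S (Wt s) D (Zm ^+ (j.-1 - i)) *m c *m S (Wt s) (Zc ^+ i) E).
Proof.
move=> cu Wnz dW; have dF := F_flow cu dW.
have dI := mder_inv (fun t => F_unit z_inj z_conj (Wnz t)) dF.
have dWa := mder_adj dW.
apply: mder_eq.
  by apply: mderM dWa; apply: mderMr; apply: mderM dI; apply: mderMr; exact: dW.
rewrite adjN !adjM Zc_adj cu /Smx.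
move: (invmx (F (Wt s))) (Wt s) => f W.
rewrite !(mulmxN, mulNmx) opprK !mulmxDl !(mulmxN, mulNmx).
rewrite !mulmx_sumr !mulmx_suml -!sumrN.
rewrite -[LHS]addrA [X in _ + X]addrC [LHS]addrA; congr (_ + _ + _).
- by rewrite !mulmxA.
- by rewrite !mulmxA.
rewrite sumrN mulmx_sumr !mulmx_suml; congr (- _).
by apply: eq_bigr => i _; rewrite !mulmxA.
Qed.

(** The coefficients of [g~] and of its inverse at infinity, and those of
    [g~ c g~^-1]. *)
Definition Gs W k : 'M[C]_n := if k is k'.+1 then S W 1%:M (Zm ^+ k') else 1%:M.
Definition Gi W k : 'M[C]_n := if k is k'.+1 then - S W (Zc ^+ k') 1%:M else 1%:M.
Definition conv (f g : nat -> 'M[C]_n) k : 'M[C]_n := \sum_(i < k.+1) f i *m g (k - i)%N.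
Definition Qc c W k : 'M[C]_n := conv (fun i => Gs W i *m c) (Gi W) k.

Lemma Qc0 c W : Qc c W 0 = c.
Proof. by rewrite /Qc /conv big_ord_recl big_ord0 /= mul1mx mulmx1 addr0. Qed.

Lemma QcS c W k : Qc c W k.+1 = S W 1%:M (Zm ^+ k) *m c - c *m S W (Zc ^+ k) 1%:M
  - \sum_(i < k) S W 1%:M (Zm ^+ (k.-1 - i)) *m c *m S W (Zc ^+ i) 1%:M.
Proof.
rewrite /Qc /conv big_ord_recl big_ord_recr /= subnn mulmx1.
rewrite mul1mx mulmxN.
rewrite [X in _ + (X + _)](_ : _ = - \sum_(i < k)
    S W 1%:M (Zm ^+ (k.-1 - i)) *m c *m S W (Zc ^+ i) 1%:M); first by mxabel.
rewrite (reindex_inj rev_ord_inj) /= -sumrN; apply: eq_bigr => i _.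
have ik := ltn_ord i.
rewrite /bump leq0n add1n /=.
have -> : (k.+1 - (k - i.+1).+1)%N = i.+1 by lia.
by rewrite /= mulmxN; have -> : (k - i.+1 = k.-1 - i)%N by lia.
Qed.

(** The polynomial part of [w^j g~ c g~^-1], which generates the [j]-th flow. *)
Definition Vw c W j w : 'M[C]_n := \sum_(k < j.+1) w ^+ (j - k) *: Qc c W k.

Lemma VwS c W j w : Vw c W j.+1 w = w *: Vw c W j w + Qc c W j.+1.
Proof.
rewrite /Vw big_ord_recr /= subnn expr0 scale1r scaler_sumr; congr (_ + _).
apply: eq_bigr => k _; rewrite scalerA -exprS subSn //.
by rewrite -ltnS.
Qed.

Lemma Vw1 c W w : Vw c W 1 w = w *: c + lie (S W 1%:M 1%:M) c.
Proof.
rewrite /Vw !big_ord_recl big_ord0 addr0 /= /bump /= subnn expr0 scale1r Qc0 expr1.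
congr (_ + _); rewrite -[(1 + 0)%N]/1%N QcS big_ord0 subr0 !expr0.
by [].
Qed.

Lemma S_linl W w D D' E : S W (w *: D - D') E = w *: S W D E - S W D' E.
Proof. by rewrite (SDl _ _ (w *: D)) (SNl _ _ D') (SZl _ _ w D). Qed.

(** Induction on the order of the flow: raising [j] multiplies the polynomial part
    by [w] and adds the next coefficient [Q]. *)
Lemma flow_recursion (A T S0 Sp Q V : nat -> 'M[C]_n) h c w j :
  h = 1%:M - T 0%N -> A 0%N = T 0%N ->
  (forall q, A q.+1 = w *: A q - Sp q) ->
  (forall q, T q.+1 = w *: T q - h *m S0 q) ->
  V 0%N = c -> (forall q, V q.+1 = w *: V q + Q q.+1) ->
  (forall q, Q q.+1 = S0 q *m c - c *m Sp q
    - \sum_(i < q) S0 (q.-1 - i)%N *m c *m Sp i) ->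
  - (- (c *m A j) + T j *m c - \sum_(i < j) T (j.-1 - i)%N *m c *m Sp i) =
  - (w ^+ j *: (c *m h)) + h *m V j.
Proof.
move=> hE A0 AS TS V0 VS QS.
elim: j => [|j IH].
  rewrite big_ord0 subr0 expr0 scale1r V0 A0 hE mulmxBr mulmxBl mulmx1 mul1mx.
  mxabel.
rewrite big_ord_recr /= subnn.
rewrite (eq_bigr (fun i : 'I_j => w *: (T (j.-1 - i)%N *m c *m Sp i) -
    h *m (S0 (j.-1 - i)%N *m c *m Sp i))); last first.
  move=> i _; have -> : (j - i = (j.-1 - i).+1)%N by have := ltn_ord i; lia.
  by rewrite TS mulmxBl mulmxBl -!scalemxAl !mulmxA.
rewrite sumrB -scaler_sumr -mulmx_sumr VS mulmxDr -scalemxAr.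
have -> : h *m V j = w ^+ j *: (c *m h) -
   (- (c *m A j) + T j *m c - \sum_(i < j) T (j.-1 - i)%N *m c *m Sp i).
  by apply: (addrI (- (w ^+ j *: (c *m h)))); rewrite -IH; mxabel.
rewrite QS AS TS !(mulmxBr, mulmxBl) -!scalemxAr -!scalemxAl.
set X := \sum_(i < j) _; set Y := \sum_(i < j) _.
have e1 : h *m (c *m Sp j) = c *m Sp j - T 0%N *m c *m Sp j.
  by rewrite hE mulmxBl mul1mx mulmxA.
rewrite e1 !mulmxA exprS; mxabel.
Qed.

Lemma gi_flow_algebra c W j w : nzcols W -> (forall k, w != (z k)^*) ->
  - (- (c *m S W (Zc ^+ j *m Rc z w) 1%:M) + S W (Rc z w) (Zm ^+ j) *m c -
     \sum_(i < j) S W (Rc z w) (Zm ^+ (j.-1 - i)) *m c *m S W (Zc ^+ i) 1%:M) =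
  - (w ^+ j *: (c *m ginv z W w)) + ginv z W w *m Vw c W j w.
Proof.
move=> Wnz wz.
pose T q := S W (Rc z w) (Zm ^+ q); pose A q := S W (Zc ^+ q *m Rc z w) 1%:M.
apply: (@flow_recursion A T (fun q => S W 1%:M (Zm ^+ q))
   (fun q => S W (Zc ^+ q) 1%:M) (Qc c W) (fun k => Vw c W k w)).
- by [].
- by rewrite /A /T expr0 mul1mx.
- move=> q; have e : Zc ^+ q.+1 *m Rc z w = w *: (Zc ^+ q *m Rc z w) - Zc ^+ q.
    rewrite -ZcXr -mulmxA -RcZc (Rc_mul wz).
    by rewrite mulmxBr mulmx1 -scalemxAr.
  by rewrite /A [in LHS]e; exact: S_linl.
- move=> q; have := S_lyapunov z_inj z_conj (Rc z w) (Zm ^+ q) Wnz.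
  rewrite ZmX (Rc_mul wz) S_linl -/(T q.+1) -/(T q) => ->.
  rewrite /ginv -[S W _ 1%:M]/(T 0%N); move: (S W 1%:M _) (T q) (T 0%N) => X Y Y0.
  by rewrite mulmxBl mul1mx; mxabel.
- by rewrite /Vw big_ord_recl big_ord0 addr0 /= expr0 scale1r Qc0.
- by move=> q; exact: VwS.
by move=> q; exact: QcS.
Qed.

Lemma gi_flow (Wt : R -> 'M[C]_(n, N)) c j s w : u_alg c ->
  (forall t, nzcols (Wt t)) -> (forall k, w != (z k)^*) ->
  mder Wt s (- (c *m Wt s *m Zc ^+ j)) ->
  mder (fun t => ginv z (Wt t) w) s
    (- (w ^+ j *: (c *m ginv z (Wt s) w)) + ginv z (Wt s) w *m Vw c (Wt s) j w).
Proof.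
move=> cu Wnz wz dW; rewrite -gi_flow_algebra //.
have h := S_flow (Rc z w) 1%:M cu Wnz dW; rewrite mul1mx in h.
apply: mder_eq; first exact: mderB (mder_cst 1%:M s) h.
by rewrite sub0r.
Qed.

Lemma conv_shiftl (f g : nat -> 'M[C]_n) k :
  \sum_(i < k.+1) f i.+1 *m g (k - i)%N = conv f g k.+1 - f 0%N *m g k.+1.
Proof. by rewrite /conv [X in _ = X - _]big_ord_recl subn0 addrC addKr. Qed.

Lemma conv_shiftr (f g : nat -> 'M[C]_n) k :
  \sum_(i < k.+1) f i *m g (k - i).+1 = conv f g k.+1 - f k.+1 *m g 0%N.
Proof.
rewrite /conv [X in _ = X - _]big_ord_recr /= subnn addrK.
by apply: eq_bigr => i _; rewrite subSn // -ltnS.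
Qed.

(** [G] and [H] stand for the coefficients of [g~] and [g~^-1], and the brackets for
    their derivatives. The sums are shifted convolutions, and the terms with [a]
    between [G] and [H] cancel because [a] and [c] commute. *)
Lemma conv_flow (G H : nat -> 'M[C]_n) a c v k :
  G 0%N = 1%:M -> H 0%N = 1%:M -> c *m a = a *m c ->
  \sum_(i < k.+1) ((G i.+1 *m a - a *m G i.+1 - v *m G i) *m c *m H (k - i)%N +
    G i *m c *m (H (k - i).+1 *m a - a *m H (k - i).+1 + H (k - i)%N *m v)) =
  lie (conv (fun i => G i *m c) H k.+1) a - lie v (conv (fun i => G i *m c) H k).
Proof.
move=> G0 H0 ac.
have e1 := conv_shiftl (fun i => G i *m a *m c) H k.
have e2 := conv_shiftl (fun i => G i *m c) H k.
have e3 := conv_shiftr (fun i => G i *m c) H k.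
have e4 := conv_shiftr (fun i => G i *m a *m c) H k.
rewrite (eq_bigr (fun i : 'I_k.+1 =>
   (G i.+1 *m a *m c *m H (k - i)%N - a *m (G i.+1 *m c *m H (k - i)%N)
    - v *m (G i *m c *m H (k - i)%N)) +
   (G i *m c *m H (k - i).+1 *m a - G i *m a *m c *m H (k - i).+1
    + G i *m c *m H (k - i)%N *m v))); last first.
  move=> i _; move: (G i) (G i.+1) (H (k - i)%N) (H (k - i).+1) => g g' h h'.
  congr (_ + _); first by rewrite 4!mulmxBl !mulmxA.
  have mD (x p q r : 'M[C]_n) : x *m (p - q + r) = x *m p - x *m q + x *m r.
    by rewrite mulmxDr mulmxBr.
  have e : g *m c *m (a *m h') = g *m a *m c *m h'.
    by rewrite mulmxA -[g *m c *m a]mulmxA ac mulmxA.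
  by rewrite mD e (mulmxA (g *m c) h' a) (mulmxA (g *m c) h v).
have lin (X1 X2 X3 X4 X5 X6 : 'I_k.+1 -> 'M[C]_n) :
    \sum_i ((X1 i - a *m X2 i - v *m X3 i) + (X4 i *m a - X5 i + X6 i *m v)) =
    \sum_i X1 i - a *m (\sum_i X2 i) - v *m (\sum_i X3 i) +
    ((\sum_i X4 i) *m a - \sum_i X5 i + (\sum_i X6 i) *m v).
  by rewrite !big_split /= !sumrN -!mulmx_sumr -!mulmx_suml.
rewrite lin e1 e2 e3 e4 -[\sum_(i < k.+1) _]/(conv (fun i => G i *m c) H k) /=.
rewrite G0 H0 /lie !mul1mx !mulmx1.
move: (conv _ H k) (conv _ H k.+1) (conv _ H k.+1) => X Y U.
rewrite !mulmxBl !mulmxBr !mulmxA -[_ *m c *m a]mulmxA ac !mulmxA.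
mxabel.
Qed.

Section XFlow.
Variables (a : 'M[C]_n) (Wt : R -> 'M[C]_(n, N)) (x : R).
Hypotheses (au : u_alg a) (Wnz : forall t, nzcols (Wt t))
  (dW : mder Wt x (- (a *m Wt x *m Zc))).
Local Notation u := (lie (S (Wt x) 1%:M 1%:M) a).

Lemma S_xflow D E : mder (fun t => S (Wt t) D E) x
  (- (a *m S (Wt x) (Zc *m D) E) + S (Wt x) D (E *m Zm) *m a -
   S (Wt x) D 1%:M *m a *m S (Wt x) 1%:M E).
Proof.
have := @S_flow Wt a 1 x D E au Wnz; rewrite expr1 => /(_ dW).
by rewrite big_ord_recl big_ord0 addr0 /= !expr0.
Qed.

Lemma Gs_xflow k : mder (fun t => Gs (Wt t) k) x
  (Gs (Wt x) k.+1 *m a - a *m Gs (Wt x) k.+1 - u *m Gs (Wt x) k).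
Proof.
case: k => [|k] /=.
  apply: mder_eq; first exact: mder_cst.
  by rewrite expr0 mulmx1 subrr.
apply: mder_eq; first exact: S_xflow.
have -> : S (Wt x) (Zc *m 1%:M) (Zm ^+ k) = S (Wt x) 1%:M (Zm ^+ k.+1) -
    S (Wt x) 1%:M 1%:M *m S (Wt x) 1%:M (Zm ^+ k).
  have := S_lyapunov z_inj z_conj 1%:M (Zm ^+ k) (Wnz x).
  by rewrite ZmX (mulmx1 Zc) (mul1mx Zc) => ->; rewrite addrK.
have -> : Zm ^+ k *m Zm = Zm ^+ k.+1 by rewrite exprSr.
move: (S _ 1%:M (Zm ^+ k.+1)) (S _ 1%:M (Zm ^+ k)) (S _ 1%:M 1%:M) => X Y Y0.
rewrite /lie mulmxBl mulmxBr !mulmxA; mxabel.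
Qed.

Lemma Gi_xflow k : mder (fun t => Gi (Wt t) k) x
  (Gi (Wt x) k.+1 *m a - a *m Gi (Wt x) k.+1 + Gi (Wt x) k *m u).
Proof.
case: k => [|k] /=.
  apply: mder_eq; first exact: mder_cst.
  by rewrite expr0 mul1mx /lie !(mulmxN, mulNmx); mxabel.
apply: mder_eq; first exact: mderN (S_xflow _ _).
have -> : S (Wt x) (Zc ^+ k) (1%:M *m Zm) = S (Wt x) (Zc ^+ k.+1) 1%:M +
    S (Wt x) (Zc ^+ k) 1%:M *m S (Wt x) 1%:M 1%:M.
  have := S_lyapunov z_inj z_conj (Zc ^+ k) 1%:M (Wnz x).
  by rewrite (mulmx1 Zm) ZcXr (mul1mx Zm).
rewrite ZcX.
move: (S _ (Zc ^+ k.+1) 1%:M) (S _ (Zc ^+ k) 1%:M) (S _ 1%:M 1%:M) => X Y Y0.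
by rewrite /lie mulmxDl mulNmx mulmxBr !mulNmx !mulmxN !mulmxA; mxabel.
Qed.

(** The recursion for the [Q_k] is the identity
    [[u, g~ c g~^-1] + (g~ c g~^-1)_x = [g~ c g~^-1, a w]], coefficient by
    coefficient. *)
Lemma Q_xflow c k : lie a c = 0 -> mder (fun t => Qc c (Wt t) k) x
  (lie (Qc c (Wt x) k.+1) a - lie u (Qc c (Wt x) k)).
Proof.
move=> ac; apply: mder_eq.
  apply: mder_sum => i _; apply: mderM (Gi_xflow _).
  by apply: mderMr; exact: Gs_xflow.
rewrite /Qc -(@conv_flow (Gs (Wt x)) (Gi (Wt x)) a c u k) //.
exact: esym (subr0_eq ac).
Qed.

End XFlow.

(** Along the flow the derivative of the sandwich [S 1 1] is the expression [QcS] for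
    the next coefficient. *)
Lemma u_flow (Wt : R -> 'M[C]_(n, N)) a c j s : u_alg c ->
  (forall t, nzcols (Wt t)) ->
  mder Wt s (- (c *m Wt s *m Zc ^+ j)) ->
  mder (fun t => lie (S (Wt t) 1%:M 1%:M) a) s (lie (Qc c (Wt s) j.+1) a).
Proof.
move=> cu Wnz dW; have h := S_flow 1%:M 1%:M cu Wnz dW.
rewrite QcS; apply: mder_eq; first exact: mderB (mderMr a h) (mderMl a h).
rewrite mulmx1 mul1mx /lie; set X := _ + _ - _.
by have -> : S (Wt s) 1%:M (Zm ^+ j) *m c - c *m S (Wt s) (Zc ^+ j) 1%:M -
   \sum_(i < j) S (Wt s) 1%:M (Zm ^+ (j.-1 - i)) *m c *m S (Wt s) (Zc ^+ i) 1%:M = X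
  by rewrite /X; mxabel.
Qed.

End Flows.

(** * Rational maps without poles *)

Section Infinity.
Context {R : realType}.
Local Notation C := R[i].

Definition infty : set_system C := [set P | exists r : R, forall w, r < nrm w -> P w].

Global Instance infty_filter : Filter infty.
Proof.
split.
- by exists 0.
- move=> P Q [r rP] [s sQ]; exists (Num.max r s) => w.
  by rewrite gt_max => /andP[/rP ? /sQ].
by move=> P Q PQ [r rP]; exists r => w /rP /PQ.
Qed.

(** A type of its own, for the same reason as [cdiff]. *)
Variant tends T (F : set_system T) (f : T -> C) (l : C) : Prop :=
  Tends of (f x : C^o) @[x --> F] --> (l : C^o).

Section Tends.
Context {T : Type} {F : set_system T} {FF : Filter F}.
Implicit Types (f g : T -> C).

Lemma tendsP f l : tends F f l <->
  forall e : R, 0 < e -> \forall x \near F, nrm (f x - l) < e.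
Proof. by split=> [[/cvgCP]//|/cvgCP]. Qed.

Lemma tends_cst l : tends F (fun _ => l) l. Proof. by split; exact: cvg_cst. Qed.

Lemma tendsD f g l l' : tends F f l -> tends F g l' ->
  tends F (fun x => f x + g x) (l + l').
Proof. by move=> [fl] [gl]; split; exact: (cvgD fl gl). Qed.

Lemma tendsM f g l l' : tends F f l -> tends F g l' ->
  tends F (fun x => f x * g x) (l * l').
Proof. by move=> [fl] [gl]; split; exact: (cvgM fl gl). Qed.

Lemma tends_ext f g l : f =1 g -> tends F f l -> tends F g l.
Proof. by move=> /funext ->. Qed.

Lemma tendsN f l : tends F f l -> tends F (fun x => - f x) (- l).
Proof.
move=> /(tendsM (tends_cst (-1))); rewrite mulN1r; apply: tends_ext => x.
by rewrite mulN1r.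
Qed.

Lemma tends_sum I (r : seq I) (P : pred I) (G : I -> T -> C) (L : I -> C) :
  (forall i, P i -> tends F (G i) (L i)) ->
  tends F (fun x => \sum_(i <- r | P i) G i x) (\sum_(i <- r | P i) L i).
Proof.
move=> GL; elim: r => [|i r IH].
  rewrite big_nil; apply: tends_ext (tends_cst 0) => x; by rewrite big_nil.
rewrite big_cons; case: ifP => Pi.
  by apply: tends_ext (tendsD (GL i Pi) IH) => x; rewrite big_cons Pi.
by apply: tends_ext IH => x; rewrite big_cons Pi.
Qed.

Definition mtends m p (f : T -> 'M[C]_(m, p)) (L : 'M[C]_(m, p)) : Prop :=
  forall i j, tends F (fun x => f x i j) (L i j).

Lemma mtendsM m p q (f : T -> 'M[C]_(m, p)) (g : T -> 'M[C]_(p, q)) L L' :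
  mtends f L -> mtends g L' -> mtends (fun x => f x *m g x) (L *m L').
Proof.
move=> fL gL i j; rewrite mxE.
have := tends_sum (index_enum _) (P := xpredT)
  (fun k _ => tendsM (fL i k) (gL k j)).
by apply: tends_ext => x; rewrite mxE.
Qed.

Lemma mtendsD m p (f g : T -> 'M[C]_(m, p)) L L' :
  mtends f L -> mtends g L' -> mtends (fun x => f x + g x) (L + L').
Proof.
move=> fL gL i j; rewrite mxE.
by apply: tends_ext (tendsD (fL i j) (gL i j)) => x; rewrite mxE.
Qed.

Lemma mtends_cst m p (A : 'M[C]_(m, p)) : mtends (fun _ => A) A.
Proof. by move=> i j; apply: tends_cst. Qed.

End Tends.

Arguments mtends {T} F {m p} f L.

Lemma tends_infty_inv (z : C) : tends infty (fun w => (w - z)^-1) 0.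
Proof.
apply/tendsP => e e0; exists (nrm z + e^-1) => w wl; rewrite subr0 nrmV.
have h : e^-1 < nrm (w - z).
  have := nrmD (w - z) z; rewrite subrK; lra.
have e1 : 0 < e^-1 by rewrite invr_gt0.
by rewrite -[e]invrK ltf_pV2 // posrE; apply: lt_trans h.
Qed.

Lemma tends_infty_conj (f : C -> C) l : tends infty f l ->
  tends infty (fun w => (f w^*)^*) l^*.
Proof.
move=> /tendsP fl; apply/tendsP => e /fl[r rP]; exists r => w wr.
by rewrite -nrm_conj rmorphB /= !conjCK; apply: rP; rewrite nrm_conj.
Qed.

End Infinity.
Arguments mtends {R T} F {m p} f L.
Arguments infty {R}.

Section Rational.
Context {R : realType}.
Local Notation C := R[i].

Lemma cdiff_horner (p : {poly C}) w : cdiff (fun s => p.[s]) w.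
Proof.
elim/poly_ind: p => [|p c IH].
  by apply: (cdiff_ext _ (cdiff_cst 0 w)) => s; rewrite horner0.
apply: (cdiff_ext _ (cdiffD (cdiffM IH (cdiff_id w)) (cdiff_cst c w))) => s.
by rewrite hornerMXaddC.
Qed.

Lemma poly_roots_seq (q : {poly C}) : q != 0 ->
  exists s : seq C, forall w, root q w -> w \in s.
Proof.
move=> q0; have [s qs] := closed_field_poly_normal q.
exists s => w; rewrite qs rootZ ?lead_coef_eq0 //.
by rewrite root_prod_XsubC.
Qed.

(** In lowest terms a zero of the denominator would be a genuine pole. *)
Lemma dvdp_of_bounded (p q : {poly C}) : q != 0 ->
  (forall w, root q w -> exists B : R,
     \forall s \near (w : C^o)^', nrm (p.[s] / q.[s]) <= B) ->
  (q %| p)%R.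
Proof.
move=> q0 bnd.
pose d := gcdp p q; pose p' := p %/ d; pose q' := q %/ d.
have d0 : d != 0 by rewrite gcdp_eq0 (negPf q0) andbF.
have pE : p = p' * d by rewrite divpK // dvdp_gcdl.
have qE : q = q' * d by rewrite divpK // dvdp_gcdr.
have cop : coprimep p' q' by apply: coprimep_div_gcd; rewrite q0 orbT.
have q'0 : q' != 0 by apply: contraNneq q0 => e; rewrite qE e mul0r.
case: (eqVneq (size q') 1%N) => [/eqP s1|s1].
  have [c c0 q'E] := size_poly1P _ s1.
  by rewrite qE q'E mul_polyC dvdpZl // dvdp_gcdl.
exfalso.
have [w wq'] := closed_rootP q' s1.
have p'w : p'.[w] != 0 by apply: (coprimep_root _ wq'); rewrite coprimep_sym.
have [|B hB] := bnd w; first by rewrite qE rootM wq'.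
have [s1' s1P] := poly_roots_seq q0.
have e0 : 0 < nrm p'.[w] / 2 by rewrite divr_gt0 // nrm_gt0.
have /cvgCP cp := cdiff_cont (cdiff_horner p' w).
have /cvgCP cq := cdiff_cont (cdiff_horner q' w).
have B0 : 0 < `|B| + 1 by have := normr_ge0 B; lra.
have h1 := near_dnear (cp _ e0).
have h2 := near_dnear (cq _ (divr_gt0 e0 B0)).
have h3 := dnear_finite w s1'.
have [s [[[hs1 hs2] hs3] hs4]] :=
  filter_ex (filterI (filterI (filterI h1 h2) h3) hB).
have qs : q.[s] != 0 by apply: contraNneq hs3 => /eqP/s1P.
have [q's ds] : q'.[s] != 0 /\ d.[s] != 0.
  by move: qs; rewrite qE hornerM mulf_eq0 negb_or => /andP[].
move: hs4; rewrite pE qE !hornerM -mulf_div divff // mulr1 nrmM nrmV.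
rewrite ler_pdivrMr ?nrm_gt0 // => hs4.
move: hs2; rewrite (rootP wq') subr0 ltr_pdivlMr // => hs2.
have hb : B * nrm q'.[s] <= (`|B| + 1) * nrm q'.[s].
  by rewrite ler_wpM2r ?nrm_ge0 // (le_trans (ler_norm _)) // lerDl.
have := nrmB p'.[s] (p'.[s] - p'.[w]); rewrite subKr.
by lra.
Qed.

(** A nonconstant polynomial takes every value, and a value that exceeds its bound on
    a disk is taken outside of the disk. *)
Lemma poly_tends_infty (p : {poly C}) l : tends infty (fun w => p.[w]) l ->
  p = l%:P.
Proof.
move=> /tendsP pl; pose s := p - l%:P.
have sE w : s.[w] = p.[w] - l by rewrite !hornerE.
have [r rP] := pl 1 ltr01.
case: (leqP (size s) 1) => [/size1_polyC sc|s1].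
  have : s`_0 = 0.
    apply/eqP; rewrite -nrm_eq0 eq_le nrm_ge0 andbT leNgt; apply/negP => c0.
    have [r' r'P] := pl _ c0.
    have := r'P (((`|r'| + 1)%:C)%C); rewrite -sE sc hornerC coefC eqxx ltxx.
    rewrite nrm_real => h; apply: notF; apply: h.
    have q : 0 <= `|r'| + 1 by rewrite addr_ge0.
    by have := ler_norm r'; rewrite (ger0_norm q); lra.
  move=> c0; apply/eqP; rewrite -subr_eq0 -/s sc c0; exact: eqxx.
have [ub ubP] := poly_disk_bound s ((`|r|%:C)%C).
pose K : C := ((nrm ub + 1)%:C)%C.
have nK : nrm K = nrm ub + 1.
  by rewrite nrm_real ger0_norm // addr_ge0 // nrm_ge0.
have sK : size (s - K%:P) != 1%N.
  rewrite size_polyDl ?gtn_eqF //.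
  by rewrite size_polyN; apply: leq_ltn_trans (size_polyC_leq1 _) s1.
have [w /rootP] := closed_rootP _ sK; rewrite hornerD hornerN hornerC.
move=> /eqP; rewrite subr_eq0 => /eqP sw.
have u0 := nrm_ge0 ub.
case: (ltP r (nrm w)) => [/rP|wr].
  by rewrite -sE sw nK ltNge lerDr u0.
have := ubP w; rewrite nrmE lecR => /(_ (le_trans wr (ler_norm _))).
rewrite sw nrmE nK lecE /= => /andP[_ h].
have := le_trans h (le_trans (ler_norm _) (nrm_Re ub)).
by rewrite leNgt ltrDl ltr01.
Qed.

Definition hmx n w (P : 'M[{poly C}]_n) : 'M[C]_n := map_mx (horner_eval w) P.

Definition rational n (f : C -> 'M[C]_n) (P : 'M[{poly C}]_n) (q : {poly C}) :=
  q != 0 /\ forall w, ~~ root q w -> f w = (q.[w])^-1 *: hmx w P.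

Definition lbounded n (f : C -> 'M[C]_n) w : Prop := exists B : R,
  \forall s \near (w : C^o)^', forall i j, nrm (f s i j) <= B.

(** Without genuine poles the entries are polynomials, and these have a limit at
    infinity only when they are constant. *)
Lemma liouville n (f : C -> 'M[C]_n) P q L : rational f P q ->
  (forall w, root q w -> lbounded f w) -> mtends infty f L ->
  forall w, ~~ root q w -> f w = L.
Proof.
move=> [q0 fE] fb fL.
have [s sP] := poly_roots_seq q0.
have entry i j : exists2 r : {poly C}, P i j = r * q & r = (L i j)%:P.
  have /dvdpP[r Pr] : q %| P i j.
    apply: dvdp_of_bounded => // w wq; have [B hB] := fb w wq.
    exists B; have := dnear_finite w s; apply: filterS2 hB => t hB ts.
    have tq : ~~ root q t by apply: contraNN ts => /sP.
    by have := hB i j; rewrite fE // !mxE mulrC.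
  exists r => //; apply: poly_tends_infty.
  apply/tendsP => e e0; have /tendsP /(_ e e0)[r0 r0P] := fL i j.
  have [M MP] : exists M : R, forall w, w \in s -> nrm w <= M.
    elim: s {sP} => [|y s [M MP]]; first by exists 0.
    exists (Num.max (nrm y) M) => w; rewrite inE le_max => /orP[/eqP->|/MP->].
      by rewrite lexx.
    by rewrite orbT.
  exists (Num.max r0 M) => w; rewrite gt_max => /andP[/r0P wl wM].
  have wq : ~~ root q w.
    by apply/negP => /sP /MP; rewrite leNgt wM.
  have -> : r.[w] = f w i j.
    by rewrite fE // !mxE /horner_eval Pr hornerM mulrCA mulVf ?mulr1.
  exact: wl.
move=> w wq; rewrite fE //; apply/matrixP => i j.
rewrite !mxE /horner_eval; have [r -> ->] := entry i j.
by rewrite hornerM hornerC mulrCA mulVf ?mulr1.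
Qed.

Lemma hmxM n w (P Q : 'M[{poly C}]_n) : hmx w (P *m Q) = hmx w P *m hmx w Q.
Proof. exact: map_mxM. Qed.

Lemma rationalD n (f g : C -> 'M[C]_n) P q P' q' : rational f P q ->
  rational g P' q' ->
  rational (fun w => f w + g w) (q' *: P + q *: P') (q * q').
Proof.
move=> [q0 fE] [q'0 gE]; split; first by rewrite mulf_neq0.
move=> w; rewrite rootM negb_or => /andP[wq wq'].
have hD (X Y : 'M[{poly C}]_n) : hmx w (X + Y) = hmx w X + hmx w Y.
  by apply/matrixP => i j; rewrite !mxE /horner_eval hornerD.
have hZ (r : {poly C}) (X : 'M[{poly C}]_n) : hmx w (r *: X) = r.[w] *: hmx w X.
  by apply/matrixP => i j; rewrite !mxE /horner_eval hornerM.
rewrite fE // gE // hD !hZ hornerM scalerDr !scalerA.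
by congr (_ *: _ + _ *: _); field; rewrite wq wq'.
Qed.

Lemma rationalM n (f g : C -> 'M[C]_n) P q P' q' : rational f P q ->
  rational g P' q' -> rational (fun w => f w *m g w) (P *m P') (q * q').
Proof.
move=> [q0 fE] [q'0 gE]; split; first by rewrite mulf_neq0.
move=> w; rewrite rootM negb_or => /andP[/fE-> /gE->].
by rewrite hmxM hornerM invfM -scalemxAl -scalemxAr scalerA.
Qed.

Definition pconj (q : {poly C}) : {poly C} := map_poly (fun c : C => c^*) q.

Lemma pconjE q w : (pconj q).[w] = (q.[w^*])^*.
Proof. by rewrite -{1}[w]conjCK /pconj horner_map. Qed.

Lemma rational_adj n (f : C -> 'M[C]_n) P q : rational f P q ->
  rational (fun w => (f w^*) ^t*) (map_mx pconj P^T) (pconj q).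
Proof.
move=> [q0 fE]; split; first by rewrite map_poly_eq0.
move=> w; rewrite /root pconjE conjC_eq0 => /fE ->.
apply/matrixP => i j; rewrite adjE !mxE /horner_eval pconjE rmorphM /=.
by rewrite fmorphV.
Qed.

Lemma lboundedM n (f g : C -> 'M[C]_n) w : lbounded f w -> lbounded g w ->
  lbounded (fun s => f s *m g s) w.
Proof.
move=> [B hB] [B' hB']; exists (n%:R * (`|B| * `|B'|)).
move: hB hB'; apply: filterS2 => s h h' i j; rewrite mxE.
apply: le_trans (nrm_sum _ _ _) _.
have e k : nrm (f s i k * g s k j) <= `|B| * `|B'|.
  rewrite nrmM ler_pM ?nrm_ge0 //.
    exact: le_trans (h i k) (ler_norm _).
  exact: le_trans (h' k j) (ler_norm _).
apply: le_trans (ler_sum _ (fun k _ => e k)) _.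
by rewrite sumr_const card_ord mulr_natl.
Qed.

Lemma mdiff_lbounded n (f : C -> 'M[C]_n) w : mdiff f w -> lbounded f w.
Proof.
move=> fd.
have h i j : \forall s \near (w : C^o)^', nrm (f s i j) <= nrm (f w i j) + 1.
  have /cvgCP/(_ 1 ltr01) := cdiff_cont (fd i j).
  move=> /near_dnear; apply: filterS => s hs.
  have := nrmD (f s i j - f w i j) (f w i j); rewrite subrK.
  by have := hs; rewrite /=; lra.
exists (\sum_i \sum_j (nrm (f w i j) + 1)).
have : \forall s \near (w : C^o)^', forall ij : 'I_n * 'I_n,
    nrm (f s ij.1 ij.2) <= nrm (f w ij.1 ij.2) + 1.
  by apply: filter_forall => -[i j]; exact: h.
apply: filterS => s hs i j; apply: le_trans (hs (i, j)) _ => /=.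
have p0 k l : 0 <= nrm (f w k l) + 1 by rewrite addr_ge0 // nrm_ge0.
rewrite (bigD1 i) //= (bigD1 j) //= -addrA lerDl addr_ge0 // sumr_ge0 //.
by move=> k _; rewrite sumr_ge0.
Qed.

End Rational.

(** * The group of rational unitary maps *)

Section GMinus.
Context {R : realType} {n : nat}.
Local Notation C := R[i].
Implicit Types (g f E : C -> 'M[C]_n) (w : C).

(** Poles do not depend on the representation: cross-multiplying, a root of one
    denominator that is not a root of the other is a zero of the numerator. *)
Lemma pole_root g p q w : lowest_terms g p q -> (pole g w <-> root q w).
Proof.
move=> lt; split=> [[p1 [q1 [lt1 w1]]]|wq]; last by exists p, q.
case: lt lt1 => [q0 gE _] [q10 g1E p1nz].
apply: contraT => wq; have /negP := p1nz w w1; case; apply/eqP/matrixP => i j.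
have [s sP] := poly_roots_seq q0; have [s1 s1P] := poly_roots_seq q10.
have e : q.[w] * (p1 i j).[w] = q1.[w] * (p i j).[w].
  apply: (@continuous_eq_off R (fun s => q.[s] * (p1 i j).[s])
    (fun s => q1.[s] * (p i j).[s])).
  - by apply: cdiff_cont; apply: cdiffM; apply: cdiff_horner.
  - by apply: cdiff_cont; apply: cdiffM; apply: cdiff_horner.
  have := dnear_finite w (s ++ s1); apply: filterS => t.
  rewrite mem_cat negb_or => /andP[ts ts1].
  have tq : ~~ root q t by apply: contraNN ts => /sP.
  have tq1 : ~~ root q1 t by apply: contraNN ts1 => /s1P.
  have := congr1 (fun X : 'M[C]_n => X i j) (gE t tq); rewrite g1E // !mxE /horner_eval.
  move: tq tq1; rewrite /root; move: q.[t] q1.[t] => x y x0 y0 e.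
  by rewrite -[(p1 i j).[t]](mulVKf y0) e mulrCA mulVKf.
move: e; rewrite (rootP w1) mul0r => /eqP; rewrite mulf_eq0 -/(root q w) (negPf wq) /=.
by move=> /eqP e; rewrite !mxE.
Qed.

Lemma G_rational g : G_minus g -> exists P q,
  rational g P q /\ forall w, pole g w <-> root q w.
Proof.
case=> [[p [q lt]] _ _ _]; exists p, q; split; last by move=> w; exact: pole_root lt.
by case: lt => q0 h _; split.
Qed.

Lemma G_tends g : G_minus g -> mtends infty g 1%:M.
Proof.
case=> _ _ gl _ i j; apply/tendsP => e e0.
have [r rP] := gl i j e e0.
by exists r => w wr; rewrite -normC_lt; apply: rP; rewrite nrmE ltcR.
Qed.

Lemma mtends_infty_adj g (L : 'M[C]_n) : mtends infty g L ->
  mtends infty (fun w => (g w^*) ^t*) (L ^t*).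
Proof.
move=> gL i j; rewrite adjE.
by apply: tends_ext (tends_infty_conj (gL j i)) => w; rewrite adjE.
Qed.

Lemma dnear_conj w (P : C -> Prop) :
  (\forall s \near (w^* : C^o)^', P s) -> \forall s \near (w : C^o)^', P s^*.
Proof.
move=> /dnear_nrm[r r0 rP]; apply/dnear_nrm; exists r => // s sw sr.
apply: rP; first by rewrite (inj_eq (inv_inj (@conjCK _))).
by rewrite -rmorphB nrm_conj.
Qed.

Lemma lbounded_adj f w : lbounded f w^* -> lbounded (fun s => (f s^*) ^t*) w.
Proof.
case=> B /dnear_conj hB; exists B; apply: filterS hB => s hs i j.
by rewrite adjE nrm_conj.
Qed.

Lemma lbounded_near f g w : (\forall s \near (w : C^o)^', f s = g s) ->
  lbounded f w -> lbounded g w.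
Proof.
move=> fg [B hB]; exists B; move: fg hB; apply: filterS2 => s -> //.
Qed.

Definition cofin (P : C -> Prop) := exists s : seq C, forall w, w \notin s -> P w.

Lemma cofin_near P w : cofin P -> \forall s \near (w : C^o)^', P s.
Proof.
by case=> s sP; have := dnear_finite w s; apply: filterS => t /sP.
Qed.

Lemma cofinI P Q : cofin P -> cofin Q -> cofin (fun w => P w /\ Q w).
Proof.
case=> s sP [t tQ]; exists (s ++ t) => w.
by rewrite mem_cat negb_or => /andP[/sP ? /tQ].
Qed.

Lemma cofin_conj (P : C -> Prop) : cofin P -> cofin (fun w => P w^*).
Proof.
case=> s sP; exists [seq x^* | x <- s] => w ws; apply: sP.
by apply: contraNN ws => ws; apply/mapP; exists w^* => //; rewrite conjCK.
Qed.

Lemma cofin_impl P Q : (forall w, P w -> Q w) -> cofin P -> cofin Q.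
Proof. by move=> PQ [s sP]; exists s => w /sP /PQ. Qed.

Lemma cofin_root (q : {poly C}) : q != 0 -> cofin (fun w => ~~ root q w).
Proof.
move=> q0; have [s sP] := poly_roots_seq q0.
by exists s => w; apply: contraNN => /sP.
Qed.

Lemma cofin_pole g : G_minus g -> cofin (fun w => ~ pole g w).
Proof.
move=> /G_rational[P [q [[q0 _] gq]]].
by apply: cofin_impl (cofin_root q0) => w /negP wq /gq.
Qed.

Lemma G_unitary g : G_minus g -> cofin (fun w => (g w^*) ^t* *m g w = 1%:M).
Proof.
move=> gG; have h := cofin_pole gG.
apply: cofin_impl (cofinI h (cofin_conj h)) => w [w1 w2].
by case: gG => _ _ _; apply.
Qed.

(** Uniqueness of the factorization: the quotient of two factorizations is both
    entire and rational, hence constant. *)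
Lemma factor_unique E1 E2 g1 g2 : G_minus g1 -> G_minus g2 ->
  (forall w, mdiff E1 w) -> (forall w, mdiff E2 w) ->
  (forall w, (E2 w^*) ^t* *m E2 w = 1%:M) ->
  cofin (fun w => E1 w *m g1 w = E2 w *m g2 w) -> forall w, E1 w = E2 w.
Proof.
move=> G1 G2 d1 d2 u2 e12.
pose f w := g2 w *m (g1 w^*) ^t*.
have fE : cofin (fun w => (E2 w^*) ^t* *m E1 w = f w).
  have := cofinI e12 (G_unitary G1); apply: cofin_impl => w [e u].
  have u' := mulmx1C u.
  rewrite /f -[g2 w]mul1mx -(u2 w) -[_ *m E2 w *m g2 w]mulmxA -e.
  by rewrite -!mulmxA u' mulmx1.
have [P1 [q1 [r1 _]]] := G_rational G1; have [P2 [q2 [r2 _]]] := G_rational G2.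
have rf := rationalM r2 (rational_adj r1).
have ft : mtends infty f 1%:M.
  rewrite -[1%:M](mulmx1 (1%:M : 'M[C]_n)) -{2}adj1.
  apply: mtendsM; first exact: G_tends.
  exact: mtends_infty_adj (G_tends G1).
have fb w : lbounded f w.
  apply: (lbounded_near (cofin_near w fE)); apply: lboundedM.
    by apply: lbounded_adj; apply: mdiff_lbounded.
  exact: mdiff_lbounded.
have f1 := liouville rf (fun w _ => fb w) ft.
have [q0 _] := rf.
have e : cofin (fun w => E1 w = E2 w).
  have := cofinI fE (cofin_root q0); apply: cofin_impl => w [ew /f1 fw].
  have := mulmx1C (u2 w) => u2'.
  have fw' : f w = 1%:M := fw.
  by rewrite -[E1 w]mul1mx -u2' -mulmxA ew fw' mulmx1.
by move=> w; apply: mdiff_eq_off (d1 w) (d2 w) (cofin_near w e).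
Qed.

End GMinus.

Section Dressing.
Context {R : realType} {n N : nat}.
Local Notation C := R[i].
Variable z : 'I_N -> C.
Hypothesis z_inj : injective z.
Hypothesis z_conj : forall m k, z m != (z k)^*.
Implicit Types (W : 'M[C]_(n, N)) (w : C).
Local Notation S := (Smx z).
Local Notation gs := (gsol z).
Local Notation gi := (ginv z).

Lemma diag_delta (d : 'rV[C]_N) : diag_mx d = \sum_k d 0 k *: delta_mx k k.
Proof.
apply/matrixP => i j; rewrite mxE summxE (bigD1 i) //= !mxE eqxx /=.
rewrite big1 => [|k ki]; first by rewrite addr0 mulr_natr eq_sym.
by rewrite !mxE eq_sym (negPf ki) mulr0.
Qed.

Lemma S_suml W (I : finType) (G : I -> 'M[C]_N) E :
  S W (\sum_i G i) E = \sum_i S W (G i) E.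
Proof.
elim/big_rec2: _ => [|i A B _ <-]; last by rewrite SDl.
by rewrite /Smx mulmx0 !mul0mx.
Qed.

Lemma S_sumr W (I : finType) (G : I -> 'M[C]_N) D :
  S W D (\sum_i G i) = \sum_i S W D (G i).
Proof.
elim/big_rec2: _ => [|i A B _ <-]; last by rewrite SDr.
by rewrite /Smx mulmx0 !mul0mx.
Qed.

Definition Pk W k := S W 1%:M (delta_mx k k).
Definition Bk W k := S W (delta_mx k k) 1%:M.

Lemma gsolE W w : gs W w = 1%:M + \sum_k (w - z k)^-1 *: Pk W k.
Proof.
rewrite /gsol /Rm diag_delta S_sumr; congr (_ + _); apply: eq_bigr => k _.
by rewrite mxE SZr.
Qed.

Lemma ginvE W w : gi W w = 1%:M - \sum_k (w - (z k)^*)^-1 *: Bk W k.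
Proof.
rewrite /ginv /Rc diag_delta S_suml; congr (_ - _); apply: eq_bigr => k _.
by rewrite mxE SZl.
Qed.

Lemma PkE W k : Pk W k = col k (W *m invmx (FW z W)) *m (col k W) ^t*.
Proof.
rewrite /Pk /Smx mulmx1 -(mul_delta_mx (0 : 'I_1) k k) mulmxA -colE -mulmxA -rowE.
by congr (_ *m _); apply/matrixP => i j; rewrite adjE !mxE.
Qed.

(** Otherwise [f = F^-1 e_k] would satisfy [W f = 0], and by the Lyapunov equation
    it would be an eigenvector of [Zc] for [z k], which is not an eigenvalue. *)
Lemma Pk_neq0 W k : nzcols W -> Pk W k != 0.
Proof.
move=> Wnz; have Fu := F_unit z_inj z_conj Wnz.
apply/eqP; rewrite PkE => P0.
have [l Wl] := Wnz k.
pose f := col k (invmx (FW z W)).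
have Wf : W *m f = 0.
  have uE : W *m f = col k (W *m invmx (FW z W)) by rewrite /f !colE mulmxA.
  apply/matrixP => i j; rewrite ord1 mx0E uE.
  have := congr1 (fun X : 'M[C]_n => X i l) P0; rewrite mx0E mxE big_ord1 adjE.
  move=> /eqP; rewrite mulf_eq0 conjC_eq0 [col k W l 0]mxE (negPf Wl) orbF.
  by move=> /eqP.
have Ff : FW z W *m f = delta_mx k 0.
  by rewrite /f colE mulmxA mulmxV // mul1mx.
have e : Zc z *m f = z k *: f.
  have := congr1 (mulmx^~ f) (F_lyapunov z_conj W).
  rewrite -[RHS]mulmxA Wf mulmx0 mulmxBl -!mulmxA Ff => /eqP; rewrite subr_eq0 => /eqP h.
  rewrite -[Zc z *m f](mulKmx Fu) -h.
  have -> : Zm z *m delta_mx k 0 = z k *: delta_mx k 0 :> 'cV_N.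
    apply/matrixP => i j; rewrite ZmE mxZE !mxE.
    by case: eqP => [->|] //; rewrite !mulr0.
  by rewrite -scalemxAr -Ff mulKmx.
have f0 : f = 0.
  apply/matrixP => m j; rewrite ord1 mx0E.
  have := congr1 (fun X : 'cV[C]_N => X m 0) e.
  rewrite mul_diag_mx mxE mxE mxZE => /eqP; rewrite -subr_eq0 -mulrBl mulf_eq0.
  by rewrite subr_eq0 eq_sym (negPf (z_conj k m)) /= => /eqP.
have := congr1 (fun X : 'cV[C]_N => X k 0) Ff; rewrite f0 mulmx0 !mxE !eqxx /=.
by move=> /esym /eqP; rewrite oner_eq0.
Qed.

(** Numerator and denominator of a partial fraction with simple poles [z k]. *)
Definition pf_den : {poly C} := \prod_k ('X - (z k)%:P).
Definition pf_num (A0 : 'M[C]_n) (A : 'I_N -> 'M[C]_n) : 'M[{poly C}]_n :=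
  pf_den *: map_mx polyC A0 +
  \sum_k (\prod_(m | m != k) ('X - (z m)%:P)) *: map_mx polyC (A k).

Lemma root_pf_den w : root pf_den w <-> exists k, w = z k.
Proof.
rewrite /root horner_prod; split.
  move=> /prodf_eq0 [k _]; rewrite !hornerE subr_eq0 => /eqP ->.
  by exists k.
case=> k ->; apply/prodf_eq0; exists k => //.
by rewrite !hornerE subrr.
Qed.

Lemma hmx_pf_num A0 A w : hmx w (pf_num A0 A) = pf_den.[w] *: A0 +
  \sum_k (\prod_(m | m != k) (w - z m)) *: A k.
Proof.
apply/matrixP => i j; rewrite mxDE summxE [LHS]mxE [pf_num _ _ i j]mxE summxE.
rewrite /horner_eval hornerD.
congr (_ + _); first by rewrite !mxE hornerM hornerC.
rewrite horner_sum; apply: eq_bigr => k _; rewrite !mxE hornerM hornerC horner_prod.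
by congr (_ * _); apply: eq_bigr => m _; rewrite !hornerE.
Qed.

Lemma rational_pf A0 A : rational (fun w => A0 + \sum_k (w - z k)^-1 *: A k)
  (pf_num A0 A) pf_den.
Proof.
split; first by apply/prodf_neq0 => k _; rewrite polyXsubC_eq0.
move=> w wq; rewrite hmx_pf_num scalerDr scalerA mulVf // scale1r; congr (_ + _).
rewrite scaler_sumr; apply: eq_bigr => k _; rewrite scalerA; congr (_ *: _).
have wz : w - z k != 0.
  by apply: contraNneq wq => /eqP; rewrite subr_eq0 => /eqP ->; apply/root_pf_den; exists k.
have d0 : pf_den.[w] != 0 by [].
apply: (mulfI d0); rewrite mulVKf // horner_prod (bigD1 k) //= !hornerE.
rewrite mulrAC mulfV // mul1r; apply: eq_bigr => m _; by rewrite !hornerE.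
Qed.

Lemma gs_lowest W : nzcols W -> lowest_terms (gs W) (pf_num 1%:M (Pk W)) pf_den.
Proof.
move=> Wnz; have [q0 h] := rational_pf 1%:M (Pk W); split => //.
  by move=> w /h <-; exact: gsolE.
move=> w /[dup] wr /root_pf_den [k wk].
rewrite -[map_mx _ _]/(hmx w _) hmx_pf_num (rootP wr) scale0r add0r (bigD1 k) //=.
rewrite [\sum_(_ | _) _]big1 => [|l lk]; last first.
  by rewrite (bigD1 k) ?(eq_sym k) //= wk subrr mul0r scale0r.
rewrite addr0 scaler_eq0 negb_or Pk_neq0 // andbT.
apply/prodf_neq0 => m mk; rewrite subr_eq0 wk; apply: contraNneq mk => /z_inj ->.
exact: eqxx.
Qed.

Lemma gs_pole W w : nzcols W -> (pole (gs W) w <-> exists k, w = z k).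
Proof.
move=> Wnz; have /(_ w) h := pole_root _ (gs_lowest Wnz).
by split=> [/h /root_pf_den|/root_pf_den /h].
Qed.

Definition zlist : seq C := [seq z k | k <- enum 'I_N] ++ [seq (z k)^* | k <- enum 'I_N].

Lemma zlistP w : w \notin zlist ->
  (forall k, w != z k) /\ (forall k, w != (z k)^*).
Proof.
rewrite mem_cat negb_or => /andP[h1 h2]; split=> k.
  by apply: contraNneq h1 => ->; apply/mapP; exists k; rewrite ?mem_enum.
by apply: contraNneq h2 => ->; apply/mapP; exists k; rewrite ?mem_enum.
Qed.

Lemma cofin_z : cofin (fun w => (forall k, w != z k) /\ (forall k, w != (z k)^*)).
Proof. by exists zlist => w /zlistP. Qed.

Lemma mtends_pf (A0 : 'M[C]_n) (A : 'I_N -> 'M[C]_n) (y : 'I_N -> C) :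
  mtends infty (fun w => A0 + \sum_k (w - y k)^-1 *: A k) A0.
Proof.
move=> i j; have -> : A0 i j = A0 i j + \sum_(k < N) 0 * A k i j.
  by rewrite big1 ?addr0 // => k _; rewrite mul0r.
have h := tendsD (tends_cst (F := infty) (A0 i j)) (tends_sum (index_enum 'I_N) (P := xpredT)
  (fun k _ => tendsM (tends_infty_inv (y k)) (tends_cst (F := infty) (A k i j)))).
have fi := @infty_filter R.
refine (tends_ext _ (h fi fi fi fi fi)) => w; rewrite mxDE summxE; congr (_ + _).
by apply: eq_bigr => k _; rewrite mxZE.
Qed.

Lemma gs_G_minus W : nzcols W -> G_minus (gs W).
Proof.
move=> Wnz; split.
- by exists (pf_num 1%:M (Pk W)), pf_den; exact: gs_lowest.
- exists zlist => w /zlistP[w1 w2].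
  by have [] := mulmx1_unit (gsgi z_inj z_conj Wnz w1 w2).
- move=> i j r r0.
  have := mtends_pf 1%:M (Pk W) z i j => /tendsP /(_ r r0)[s sP].
  exists s => w; rewrite nrmE ltcR => /sP; rewrite normC_lt gsolE.
  by [].
move=> w w1 w2; rewrite gs_adj //; apply: gigs => // k.
  by apply/eqP => wk; apply: w1; apply/gs_pole => //; exists k.
apply/eqP => wk; apply: w2; apply/gs_pole => //; exists k.
by rewrite wk conjCK.
Qed.

End Dressing.

(** * A regular rational map is determined by its singularity data *)

Section Explicit.
Context {R : realType} {n N : nat}.
Local Notation C := R[i].
Variables (g : C -> 'M[C]_n) (z : 'I_N -> C) (pi : 'I_N -> 'M[C]_n)
  (v : 'I_N -> 'cV[C]_n).
Hypotheses (gG : G_minus g) (g_reg : regular g) (g_data : singularity_data g z pi)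
  (pi_v : forall k, projects_onto_line (pi k) (v k)).

Lemma data_inj : injective z. Proof. by case: g_data. Qed.

Lemma data_pole w : pole g w <-> exists k, w = z k.
Proof. by case: g_data. Qed.

Lemma data_conj m k : z m != (z k)^*.
Proof.
have pk : pole g (z k) by apply/data_pole; exists k.
have [_ [np _]] := g_reg pk.
by apply/eqP => e; apply: np; apply/data_pole; exists m.
Qed.

Definition Vmx : 'M[C]_(n, N) := \matrix_(i, k) v k i 0.

Lemma col_Vmx k : col k Vmx = v k.
Proof. by apply/matrixP => i j; rewrite ord1 !mxE. Qed.

Lemma Vmx_nz : nzcols Vmx.
Proof.
move=> k; have [vk _] := pi_v k.
have [i vi] : exists i, v k i 0 != 0.
  apply/existsP; apply: contraNT vk; rewrite negb_exists => /forallP h.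
  apply/eqP/matrixP => i j; rewrite ord1 mxE; apply/eqP.
  by have := h i; rewrite negbK.
by exists i; rewrite mxE.
Qed.

Definition sqv k : C := ((v k) ^t* *m v k) 0 0.

Lemma sqv_neq0 k : sqv k != 0.
Proof.
have [l vl] := Vmx_nz k; rewrite mxE in vl.
rewrite /sqv mxE.
have e : \sum_j (v k) ^t* 0 j * v k j 0 = ((\sum_j nrm (v k j 0) ^+ 2)%:C)%C.
  rewrite (raddf_sum (real_complex R)); apply: eq_bigr => j _ /=.
  by rewrite adjE mulrC mul_conj.
rewrite e -nrm_gt0 nrm_real gtr0_norm.
  rewrite (bigD1 l) //= ltr_wpDr //; last by rewrite exprn_gt0 // nrm_gt0.
  by apply: sumr_ge0 => j _; apply: sqr_ge0.
rewrite (bigD1 l) //= ltr_wpDr //; last by rewrite exprn_gt0 // nrm_gt0.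
by apply: sumr_ge0 => j _; apply: sqr_ge0.
Qed.

Lemma pi_fix k : pi k *m v k = v k.
Proof.
have [_ h] := pi_v k; have [_ _ /(_ k)[pp _] _] := g_data.
have [s <-] : exists s, pi k *m s = v k by apply/h; exists 1; rewrite scale1r.
by rewrite mulmxA pp.
Qed.

Lemma piE k : pi k = (sqv k)^-1 *: (v k *m (v k) ^t*).
Proof.
have [_ h] := pi_v k; have [_ _ /(_ k)[pp ps] _] := g_data.
have key (s : 'cV[C]_n) : pi k *m s = (sqv k)^-1 *: (v k *m (v k) ^t*) *m s.
  have [c e] : exists c, pi k *m s = c *: v k by apply/h; exists s.
  have vs : (v k) ^t* *m s = (c * sqv k)%:M.
    have <- : (v k) ^t* *m (pi k *m s) = (v k) ^t* *m s.
      by rewrite -{1}ps mulmxA -adjM pi_fix.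
    rewrite e -scalemxAr; apply/matrixP => i j; rewrite !ord1 mxZE [RHS]mxE eqxx.
    by rewrite mulr1n.
  rewrite e -scalemxAl -mulmxA vs mul_mx_scalar scalerA mulrCA mulVf ?sqv_neq0 //.
  by rewrite mulr1.
by apply/matrixP => i j; have := congr1 (fun X : 'cV[C]_n => X i 0) (key (delta_mx j 0));
   rewrite -!colE !mxE.
Qed.

Lemma h_factor_inv (y w : C) (p : 'M[C]_n) : p *m p = p -> w != y -> w != y^* ->
  h_factor y p w *m (1%:M + ((y^* - y) / (w - y^*)) *: p) = 1%:M.
Proof.
move=> pp wy wyc; rewrite /h_factor mulmxDr mulmx1 mulmxDl mul1mx.
rewrite -scalemxAl -scalemxAr pp scalerA -addrA -!scalerDl.
rewrite [X in X *: p](_ : _ = 0) ?scale0r ?addr0 //.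
by field; rewrite !subr_eq0 wy wyc.
Qed.

Lemma cdiff_quot (f : C -> C) w : cdiff f w -> exists B : R,
  \forall s \near (w : C^o)^', nrm ((f s - f w) / (s - w)) <= B.
Proof.
case=> /cvg_ex[l /cvgCP/(_ 1 ltr01)/dnear_nrm[r r0 rP]].
exists (nrm l + 1); apply/dnear_nrm; exists r => // s sw sr.
have := rP (s - w); rewrite subr0 subr_eq0 sw => /(_ isT sr).
rewrite /= -[_ *: (_ - _)]/(_ * _) -[(s - w) *: 1]/((s - w) * 1) mulr1 subrK mulrC.
move=> h; have := nrmD ((f s - f w) / (s - w) - l) l; rewrite subrK; lra.
Qed.

Lemma lboundedD f1 f2 w : lbounded f1 w -> @lbounded R n f2 w ->
  lbounded (fun s => f1 s + f2 s) w.
Proof.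
move=> [B hB] [B' hB']; exists (B + B'); move: hB hB'; apply: filterS2 => s h h' i j.
by rewrite mxDE; apply: le_trans (nrmD _ _) (lerD (h i j) (h' i j)).
Qed.

Lemma lbounded_quot (f : C -> 'M[C]_n) w : mdiff f w ->
  lbounded (fun s => (s - w)^-1 *: (f s - f w)) w.
Proof.
move=> fd.
have Bx ij : exists B : R, \forall s \near (w : C^o)^',
    nrm ((f s ij.1 ij.2 - f w ij.1 ij.2) / (s - w)) <= B.
  by apply: cdiff_quot; apply: fd.
have [B BP] := choice Bx.
exists (\sum_(ij : 'I_n * 'I_n) `|B ij|).
have : \forall s \near (w : C^o)^', forall ij : 'I_n * 'I_n,
    nrm ((f s ij.1 ij.2 - f w ij.1 ij.2) / (s - w)) <= B ij.
  by apply: filter_forall.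
apply: filterS => s hs i j; rewrite mxZE mxDE mxNE mulrC.
apply: le_trans (hs (i, j)) _ => /=; apply: le_trans (ler_norm _) _.
by rewrite (bigD1 (i, j)) //= lerDl sumr_ge0.
Qed.

Lemma mdiff_pf (A0 : 'M[C]_n) (A : 'I_N -> 'M[C]_n) (y : 'I_N -> C) (P : pred 'I_N) w :
  (forall k, P k -> w != y k) ->
  mdiff (fun s => A0 + \sum_(k | P k) (s - y k)^-1 *: A k) w.
Proof.
move=> wy; apply: mdiffD; first exact: mdiff_cst.
apply: mdiff_sum => k /wy wk; apply: mdiffZ; last exact: mdiff_cst.
apply: cdiffV; first by rewrite subr_eq0.
by apply: cdiffB; [exact: cdiff_id|exact: cdiff_cst].
Qed.

(** Near [z k] the map [g] is a holomorphic factor times [h_factor], so its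
    residue there is a left multiple of the projection; by Liouville's theorem [g] is the
    sum of its polar parts and [1]. The equations for the residues say that [g]
    annihilates [v k] at the conjugate of [z k]; they come from unitarity. *)
Lemma data_residues : exists u : 'I_N -> 'cV[C]_n,
  (forall w, (forall k, w != z k) ->
     g w = 1%:M + \sum_k (w - z k)^-1 *: (u k *m (v k) ^t*)) /\
  forall k, v k + \sum_m ((z k)^* - z m)^-1 *: (u m *m (v m) ^t* *m v k) = 0.
Proof.
have [_ _ pip hol] := g_data.
have hk k := cid (hol k).
pose h k := sval (hk k).
have hP k : [/\ holomorphic_at (h k) (z k), h k (z k) \in unitmx &
    \forall w \near (z k : C^o)^', g w *m invmx (h_factor (z k) (pi k) w) = h k w].
  by rewrite /h; case: (hk k).
have hd k : mdiff (h k) (z k).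
  have [hh _ _] := hP k => i j; split.
  by have := nbhs_singleton hh; apply.
pose cc k : C := z k - (z k)^*.
pose u k : 'cV[C]_n := (cc k / sqv k) *: (h k (z k) *m v k).
pose A k := u k *m (v k) ^t*.
have AE k : A k = cc k *: (h k (z k) *m pi k).
  by rewrite /A /u piE -scalemxAl -scalemxAr scalerA mulmxA.
have zc := data_conj; have zi := data_inj.
have hfu k w : w != z k -> w != (z k)^* -> h_factor (z k) (pi k) w \in unitmx.
  by move=> w1 w2; have [] := mulmx1_unit (h_factor_inv (pip k).1 w1 w2).
have gh k : \forall w \near (z k : C^o)^', g w = h k w *m h_factor (z k) (pi k) w.
  have [_ _] := hP k; have := cofin_near (z k) (cofin_z z).
  apply: filterS2 => w [w1 w2] <-.
  by rewrite mulmxKV // hfu.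
have [P [q [rg gq]]] := G_rational gG.
have rootz w : root q w -> exists k, w = z k by move=> /gq /data_pole.
have ratd : rational (fun w => g w + (0 + \sum_k (w - z k)^-1 *: - A k))
    (pf_den z *: P + q *: pf_num z 0 (fun k => - A k)) (q * pf_den z).
  exact: rationalD rg (rational_pf z 0 (fun k => - A k)).
have bnd w : root (q * pf_den z) w ->
    lbounded (fun w => g w + (0 + \sum_k (w - z k)^-1 *: - A k)) w.
  move=> wr; have {wr} [k ->] : exists k, w = z k.
    by move: wr; rewrite rootM => /orP[/rootz|/root_pf_den].
  have b1 : lbounded (h k) (z k) by apply: mdiff_lbounded.
  have b2 := lbounded_quot (hd k).
  have b3 : lbounded (fun _ => cc k *: pi k) (z k).
    by apply: mdiff_lbounded; apply: mdiff_cst.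
  have b4 : lbounded (fun s => 0 + \sum_(m | m != k) (s - z m)^-1 *: - A m) (z k).
    apply: mdiff_lbounded; apply: mdiff_pf => m; apply: contraNneq => /zi ->.
    exact: eqxx.
  apply: (lbounded_near _ (lboundedD (lboundedD b1 (lboundedM b2 b3)) b4)).
  move: (gh k); apply: filterS => s ->.
  rewrite add0r add0r [in RHS](bigD1 k) //= AE /h_factor mulmxDr mulmx1 -scalemxAr.
  rewrite -scalemxAl -scalemxAr mulmxBl scalerA scalerBr -/(cc k).
  by rewrite mulrC scalerN scalerA !addrA.
have zl := cofin_z z.
have lim : mtends infty (fun w => g w + (0 + \sum_k (w - z k)^-1 *: - A k)) 1%:M.
  rewrite -[1%:M]addr0; apply: mtendsD; first exact: G_tends.
  exact: mtends_pf.
have gE w : (forall k, w != z k) -> g w = 1%:M + \sum_k (w - z k)^-1 *: A k.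
  move=> wz; have wr : ~~ root (q * pf_den z) w.
    rewrite rootM negb_or; apply/andP; split; apply/negP.
      by move=> /rootz [k wk]; have := wz k; rewrite wk eqxx.
    by move=> /root_pf_den [k wk]; have := wz k; rewrite wk eqxx.
  have := liouville ratd bnd lim wr => <-; rewrite add0r -addrA -big_split /=.
  by rewrite big1 ?addr0 // => k _; rewrite scalerN addrC subrr.
exists u; split=> // k.
pose G' w := 1%:M + \sum_m (w - (z m)^*)^-1 *: (A m) ^t*.
have G'E w : (forall k, w^* != z k) -> (g w^*) ^t* = G' w.
  move=> wz; rewrite gE // adjD adj1 adj_sum; congr (_ + _); apply: eq_bigr => m _.
  by rewrite adjZ fmorphV rmorphB /= conjCK.
have zero0 : pi k *m G' (z k) *m h k (z k) = 0.
  have -> : 0 = ((z k - z k) / (z k - (z k)^*)) *: pi k.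
    by rewrite subrr mul0r scale0r.
  apply: (@mdiff_eq_off R n n (fun w => pi k *m G' w *m h k w)
    (fun w => ((w - z k) / (w - (z k)^*)) *: pi k)).
  - apply: mdiffM (hd k); apply: mdiffM; first exact: mdiff_cst.
    by apply: mdiff_pf => m _; exact: zc.
  - apply: mdiffZ; last exact: mdiff_cst.
    apply: cdiffM; first by apply: cdiffB; [exact: cdiff_id|exact: cdiff_cst].
    apply: cdiffV; first by rewrite subr_eq0.
    by apply: cdiffB; [exact: cdiff_id|exact: cdiff_cst].
  have h1 := cofin_near (z k) (cofinI (G_unitary gG) (cofinI zl (cofin_conj zl))).
  move: h1 (gh k); apply: filterS2 => w [uw [[w1 w2] [w3 w4]]] gw.
  move: uw; rewrite G'E // gw mulmxA => uw.
  have e := h_factor_inv (pip k).1 (w1 k) (w2 k).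
  have -> : pi k *m G' w *m h k w = pi k *m (1%:M + (((z k)^* - z k) / (w - (z k)^*)) *: pi k).
    rewrite -mulmxA; congr (_ *m _).
    by rewrite -[LHS]mulmx1 -[X in _ *m X = _]e mulmxA uw mul1mx.
  rewrite mulmxDr mulmx1 -scalemxAr (pip k).1 -{1}[pi k]scale1r -scalerDl.
  by congr (_ *: _); field; rewrite subr_eq0 w2.
have zero1 : pi k *m G' (z k) = 0.
  have [_ hu _] := hP k.
  by rewrite -[LHS](mulmxK hu) zero0 mul0mx.
have zero2 : (G' (z k)) ^t* *m v k = 0.
  rewrite -pi_fix mulmxA -[(pi k)](pip k).2 -adjM zero1 adj0.
  by rewrite mul0mx.
move: zero2; rewrite /G' adjD adj1 adj_sum mulmxDl mul1mx mulmx_suml => zero2.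
rewrite -[RHS]zero2.
congr (_ + _); apply: eq_bigr => m _.
by rewrite adjZ adjK -scalemxAl fmorphV rmorphB /= conjCK.
Qed.

(** The equations for the residues are the linear system [V = U F]. *)
Lemma data_explicit w : (forall k, w != z k) -> g w = gsol z Vmx w.
Proof.
move=> wz; have [u [gE uz]] := data_residues.
have Fu := F_unit data_inj data_conj Vmx_nz.
pose U : 'M[C]_(n, N) := \matrix_(i, k) u k i 0.
have colU k : col k U = u k by apply/matrixP => i j; rewrite ord1 !mxE.
have VU : Vmx = U *m FW z Vmx.
  apply/matrixP => i k.
  have := congr1 (fun X : 'cV[C]_n => X i 0) (uz k).
  rewrite mxDE summxE mx0E => /eqP; rewrite addr_eq0 => /eqP vE.
  rewrite mxE vE mxE -sumrN; apply: eq_bigr => m _.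
  rewrite mxZE FWE -mulmxA [(u m *m _) i 0]mxE big_ord1 [U i m]mxE.
  have -> : (Vmx ^t* *m Vmx) m k = ((v m) ^t* *m v k) 0 0.
    rewrite [LHS]mxE [RHS]mxE; apply: eq_bigr => l _.
    by rewrite !adjE !mxE.
  have -> : z m - (z k)^* = - ((z k)^* - z m) by rewrite opprB.
  by rewrite invrN; move: (_ ^-1) => y; ring.
rewrite gE // gsolE; congr (_ + _); apply: eq_bigr => k _; congr (_ *: _).
rewrite PkE col_Vmx; congr (_ *m _).
by rewrite {1}VU mulmxK.
Qed.

End Explicit.

(** * The vacuum solution and its difference quotients *)

Section Vacuum.
Context {R : realType} {n : nat}.
Local Notation C := R[i].
Variables (a b P : 'M[C]_n) (da db : 'rV[C]_n) (j : nat).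
Hypotheses (Pu : P \in unitmx) (aE : a = invmx P *m diag_mx da *m P)
  (bE : b = invmx P *m diag_mx db *m P).
Implicit Types (c X T w : C).

Fact sim_key : unit. Proof. exact: tt. Qed.

(** Locked, so that unification does not unfold the products. *)
Definition sim (d : 'rV[C]_n) : 'M[C]_n :=
  locked_with sim_key (invmx P *m diag_mx d *m P).

Lemma simE d : sim d = invmx P *m diag_mx d *m P.
Proof. exact: (congr1 (fun f => f) (locked_withE _ _)). Qed.

Lemma simM (d d' : 'rV[C]_n) : sim d *m sim d' = sim (\row_i (d 0 i * d' 0 i)).
Proof.
rewrite !simE !mulmxA; congr (_ *m P).
by rewrite (mulmxK Pu) -mulmxA mulmx_diag.
Qed.

Lemma simD (d d' : 'rV[C]_n) : sim d + sim d' = sim (\row_i (d 0 i + d' 0 i)).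
Proof.
have e : diag_mx d + diag_mx d' = diag_mx (\row_i (d 0 i + d' 0 i)).
  by apply/matrixP => i k; rewrite mxDE !mxE mulrnDl.
by rewrite !simE -e mulmxDr mulmxDl.
Qed.

Lemma simZ c (d : 'rV[C]_n) : c *: sim d = sim (\row_i (c * d 0 i)).
Proof.
have e : c *: diag_mx d = diag_mx (\row_i (c * d 0 i)).
  by apply/matrixP => i k; rewrite mxZE !mxE mulrnAr.
by rewrite !simE -e -scalemxAr -scalemxAl.
Qed.

Lemma sim1 : sim (\row_i 1) = 1%:M.
Proof.
rewrite simE (_ : \row_i 1 = const_mx 1) ?diag_const_mx ?mulmx1 ?mulVmx //.
by apply/rowP => i; rewrite !mxE.
Qed.

Lemma sim_ext (d d' : 'rV[C]_n) : (forall i, d 0 i = d' 0 i) -> sim d = sim d'.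
Proof. by move=> e; congr sim; apply/rowP => i. Qed.

Definition ev c d : 'M[C]_n := sim (\row_i cexp (c * da 0 i + d * db 0 i)).

Lemma comb_sim c d : c *: a + d *: b = sim (\row_i (c * da 0 i + d * db 0 i)).
Proof.
by rewrite aE bE -(simE da) -(simE db) !simZ simD; apply: sim_ext => i; rewrite !mxE.
Qed.

Lemma expmx_ev c d : expmx (c *: a + d *: b) = ev c d.
Proof.
rewrite comb_sim simE; apply: etrans (expmx_similar _ Pu) _.
rewrite -simE.
by apply: sim_ext => i; rewrite !mxE.
Qed.

Lemma ev0 : ev 0 0 = 1%:M.
Proof. by rewrite -sim1; apply: sim_ext => i; rewrite !mxE !mul0r addr0 cexp0. Qed.

Lemma evD c d c' d' : ev (c + c') (d + d') = ev c d *m ev c' d'.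
Proof.
rewrite simM; apply: sim_ext => i; rewrite !mxE -cexpD; congr cexp; ring.
Qed.

Lemma evN c d : ev c d *m ev (- c) (- d) = 1%:M.
Proof.
have := evD c d (- c) (- d); rewrite (subrr c) (subrr d) ev0.
exact: esym.
Qed.

Lemma ev_comm c d e f : (e *: a + f *: b) *m ev c d = ev c d *m (e *: a + f *: b).
Proof.
by rewrite comb_sim !simM; apply: sim_ext => i; rewrite !mxE mulrC.
Qed.

Lemma ev_adj c d : u_alg a -> u_alg b -> (ev c d) ^t* = ev (- c^*) (- d^*).
Proof.
move=> au bu; rewrite -[RHS]expmx_ev.
have <- : (c *: a + d *: b) ^t* = - c^* *: a + - d^* *: b.
  by rewrite adjD !adjZ au bu !scalerN !scaleNr.
rewrite comb_sim simE; apply: esym; apply: etrans (expmx_adj_similar _ Pu) _.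
rewrite -simE.
by congr (_ ^t*); apply: sim_ext => i; rewrite !mxE.
Qed.

Lemma mder_sim (f : R -> 'I_n -> C) x (l : 'I_n -> C) :
  (forall i, cder (fun s => f s i) x (l i)) ->
  mder (fun s => sim (\row_i f s i)) x (sim (\row_i l i)).
Proof.
move=> fl; rewrite simE (funext (fun s => simE _)).
apply: mderMr; apply: mderMl => i k; rewrite !mxE.
have e : (fun s => diag_mx (\row_i f s i) i k) = fun s => (i == k)%:R * f s i.
  by apply/funext => s; rewrite !mxE mulr_natl.
by rewrite e -[l i *+ _]mulr_natl; apply: cderZ.
Qed.

Lemma mdiff_sim (f : C -> 'I_n -> C) w :
  (forall i, cdiff (fun s => f s i) w) -> mdiff (fun s => sim (\row_i f s i)) w.
Proof.
move=> fl; rewrite (funext (fun s => simE _)).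
apply: mdiffM; last exact: mdiff_cst.
apply: mdiffM; first exact: mdiff_cst.
apply: mdiff_diag => k i; apply: (cdiff_ext _ (fl i)) => s.
by rewrite mxE.
Qed.

Definition Mv X T w : 'M[C]_n := ev (w * X) (w ^+ j * T).

(** [(w^j - s^j) / (w - s)]. *)
Definition pj w (s : C) : C := \sum_(i < j) w ^+ (j.-1 - i) * s ^+ i.

Lemma pjE w s : (w - s) * pj w s = w ^+ j - s ^+ j.
Proof.
by rewrite subrXX; congr (_ * _); apply: eq_bigr => i _.
Qed.

Let de X T s w i : C := X * da 0 i + T * pj w s * db 0 i.

(** [(Mv w - Mv s) / (w - s)], extended holomorphically to [w = s]. *)
Definition Dv X T s w : 'M[C]_n := sim (\row_i
  (cexp (s * X * da 0 i + s ^+ j * T * db 0 i) * de X T s w i *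
   phi ((w - s) * de X T s w i))).

Lemma DvE X T s w : (w - s) *: Dv X T s w = Mv X T w - Mv X T s.
Proof.
rewrite -[- Mv _ _ _]scaleN1r !simZ simD; apply: sim_ext => i; rewrite !mxE.
rewrite -mulrA mulrCA [(w - s) * _]mulrA phiE mulrBr mulr1 -cexpD mulN1r.
congr (cexp _ - _); rewrite /de mulrDr.
have -> : (w - s) * (T * pj w s * db 0 i) = ((w - s) * pj w s) * (T * db 0 i) by ring.
rewrite pjE; ring.
Qed.

Lemma Mv_Dv X T s w : Mv X T w = Mv X T s + (w - s) *: Dv X T s w.
Proof. by rewrite DvE addrC subrK. Qed.

Lemma cdiff_pj s w : cdiff (fun w => pj w s) w.
Proof.
apply: cdiff_sum => i _; apply: cdiffM; last exact: cdiff_cst.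
by apply: cdiffX; exact: cdiff_id.
Qed.

Lemma mdiff_Mv X T w : mdiff (Mv X T) w.
Proof.
apply: mdiff_sim => i; apply: cdiff_comp (cdiff_cexp _).
apply: cdiffD; apply: cdiffM; try exact: cdiff_cst; apply: cdiffM; try exact: cdiff_cst.
  exact: cdiff_id.
by apply: cdiffX; exact: cdiff_id.
Qed.

Lemma mdiff_Dv X T s w : mdiff (Dv X T s) w.
Proof.
have dd i : cdiff (fun w => de X T s w i) w.
  apply: cdiffD; first exact: cdiff_cst.
  apply: cdiffM; last exact: cdiff_cst.
  by apply: cdiffM; [exact: cdiff_cst|exact: cdiff_pj].
apply: mdiff_sim => i; apply: cdiffM.
  by apply: cdiffM (dd i); exact: cdiff_cst.
apply: cdiff_comp (cdiff_phi _); apply: cdiffM (dd i).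
by apply: cdiffB; [exact: cdiff_id|exact: cdiff_cst].
Qed.

Section Curve.
Variables (X T : R -> C) (r : R) (x' t' : C).
Hypotheses (dX : cder X r x') (dT : cder T r t').

Lemma mder_Mv w : mder (fun s => Mv (X s) (T s) w) r
  (((w * x') *: a + (w ^+ j * t') *: b) *m Mv (X r) (T r) w).
Proof.
rewrite comb_sim simM; apply: mder_eq.
  apply: mder_sim => i; apply: cder_cexp.
  apply: cderD; (apply: cder_ext; last first).
  - exact: (cderZ (w * da 0 i) dX).
  - by move=> s; rewrite /=; ring.
  - exact: (cderZ (w ^+ j * db 0 i) dT).
  - by move=> s; rewrite /=; ring.
by apply: sim_ext => i; rewrite !mxE; congr (_ * _); ring.
Qed.

Lemma mder_Dv s w : mder (fun q => Dv (X q) (T q) s w) r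
  ((x' *: a + (pj w s * t') *: b) *m Mv (X r) (T r) w +
   ((s * x') *: a + (s ^+ j * t') *: b) *m Dv (X r) (T r) s w).
Proof.
have [->|ws] := eqVneq w s.
  have e : (fun q => Dv (X q) (T q) s s) =
      (fun q => Mv (X q) (T q) s *m (X q *: a + (T q * pj s s) *: b)).
    apply/funext => q; rewrite comb_sim simM; apply: sim_ext => i.
    by rewrite !mxE subrr mul0r /phi eqxx mulr1.
  rewrite e -[Dv _ _ _ _]/((fun q => Dv (X q) (T q) s s) r) e.
  have d1 : mder (fun q => X q *: a + (T q * pj s s) *: b) r
      (x' *: a + (pj s s * t') *: b).
    apply: mderD => k l; rewrite mxZE.
      apply: (cder_ext (f := fun q => a k l * X q)); first by move=> q; rewrite mxZE mulrC.
      by rewrite mulrC; apply: cderZ.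
    apply: (cder_ext (f := fun q => pj s s * b k l * T q)).
      by move=> q; rewrite mxZE; ring.
    by rewrite mulrAC; apply: cderZ.
  apply: mder_eq; first exact: mderM (mder_Mv s) d1.
  by rewrite -ev_comm mulmxA addrC.
have ws0 : w - s != 0 by rewrite subr_eq0.
have DE q : Dv (X q) (T q) s w = (w - s)^-1 *: (Mv (X q) (T q) w - Mv (X q) (T q) s).
  apply: (scalerI ws0); rewrite scalerA (mulfV ws0) scale1r; exact: DvE.
rewrite (funext DE).
apply: mder_eq; first exact: mderZ _ (mderB (mder_Mv w) (mder_Mv s)).
rewrite DE; move: (Mv _ _ w) (Mv _ _ s) => Mw Ms.
apply: (scalerI ws0); rewrite scalerA (mulfV ws0) scale1r.
have e1 : (w - s) *: (((s * x') *: a + (s ^+ j * t') *: b) *m ((w - s)^-1 *: (Mw - Ms)))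
    = ((s * x') *: a + (s ^+ j * t') *: b) *m (Mw - Ms).
  by rewrite -scalemxAr scalerA (mulfV ws0) scale1r.
have e2 : (w - s) *: (x' *: a + (pj w s * t') *: b) =
    ((w * x') *: a + (w ^+ j * t') *: b) - ((s * x') *: a + (s ^+ j * t') *: b).
  rewrite scalerDr !scalerA mulrA pjE !mulrBl !scalerBl; mxabel.
have e3 : (w - s) *: ((x' *: a + (pj w s * t') *: b) *m Mw) =
    (((w * x') *: a + (w ^+ j * t') *: b) - ((s * x') *: a + (s ^+ j * t') *: b)) *m Mw.
  by rewrite scalemxAl e2.
apply: etrans _ (esym (etrans (scalerDr _ _ _) (congr2 +%R e3 e1))).
move: (_ *: a + _ *: b) (_ *: a + _ *: b) => A B.
by rewrite mulmxBl mulmxBr; mxabel.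
Qed.

End Curve.
End Vacuum.

(** Families of matrix functions that are entire in [w], differentiable at [r]
    in the real parameter, with an entire derivative. *)
Section Nice.
Context {R : realType} {n : nat}.
Local Notation C := R[i].
Implicit Types (f : R -> C -> 'M[C]_n) (r : R).

Definition nice f r : Prop := (forall w, mdiff (f r) w) /\
  exists L : C -> 'M[C]_n, (forall w, mder (f^~ w) r (L w)) /\ forall w, mdiff L w.

Lemma nice_cst (A : 'M[C]_n) r : nice (fun _ _ => A) r.
Proof.
split; first by move=> w; exact: mdiff_cst.
by exists (fun _ => 0); split=> w; [exact: mder_cst|exact: mdiff_cst].
Qed.

Lemma niceD f g r : nice f r -> nice g r -> nice (fun s w => f s w + g s w) r.
Proof.
move=> [fd [L [fL dL]]] [gd [L' [gL dL']]]; split.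
  by move=> w; exact: mdiffD (fd w) (gd w).
exists (fun w => L w + L' w); split=> w; first exact: mderD (fL w) (gL w).
exact: mdiffD.
Qed.

Lemma niceN f r : nice f r -> nice (fun s w => - f s w) r.
Proof.
move=> [fd [L [fL dL]]]; split; first by move=> w; exact: mdiffN (fd w).
exists (fun w => - L w); split=> w; first exact: mderN (fL w).
exact: mdiffN.
Qed.

Lemma niceM f g r : nice f r -> nice g r -> nice (fun s w => f s w *m g s w) r.
Proof.
move=> [fd [L [fL dL]]] [gd [L' [gL dL']]]; split.
  by move=> w; exact: mdiffM (fd w) (gd w).
exists (fun w => L w *m g r w + f r w *m L' w); split=> w.
  exact: mderM (fL w) (gL w).
by apply: mdiffD; apply: mdiffM.
Qed.

Lemma niceZ c f r : nice f r -> nice (fun s w => c *: f s w) r.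
Proof.
move=> [fd [L [fL dL]]]; split.
  by move=> w; apply: mdiffZ (fd w); exact: cdiff_cst.
exists (fun w => c *: L w); split=> w; first exact: mderZ (fL w).
by apply: mdiffZ (dL w); exact: cdiff_cst.
Qed.

Lemma nice_sum (I : finType) (G : I -> R -> C -> 'M[C]_n) r :
  (forall i, nice (G i) r) -> nice (fun s w => \sum_i G i s w) r.
Proof.
move=> GG; have L i := cid (GG i).2.
split; first by move=> w; apply: mdiff_sum => i _; exact: (GG i).1.
exists (fun w => \sum_i sval (L i) w); split=> w.
  apply: mder_sum => i _; case: (L i) => l [h _] /=; exact: h.
by apply: mdiff_sum => i _; case: (L i) => l [_ h] /=; exact: h.
Qed.

End Nice.

(** * The dressed trivialization *)

Section SolitonDressing.
Context {R : realType} {n N : nat}.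
Local Notation C := R[i].
Variables (z : 'I_N -> C) (z_inj : injective z) (z_conj : forall m k, z m != (z k)^*).
Variables (a b P : 'M[C]_n) (da db : 'rV[C]_n) (j : nat).
Hypotheses (au : u_alg a) (bu : u_alg b) (Pu : P \in unitmx)
  (aE : a = invmx P *m diag_mx da *m P) (bE : b = invmx P *m diag_mx db *m P).
Variable V : 'M[C]_(n, N).
Hypothesis Vnz : nzcols V.
Implicit Types (x t : R) (w : C).

Local Notation ev := (ev P da db).
Local Notation rc x := ((x%:C)%C : C).
Local Notation M x t w := (Mv P da db j (rc x) (rc t) w).
Local Notation D x t s w := (Dv P da db j (rc x) (rc t) s w).

(** The inverse of the vacuum at the conjugate of [z k], applied to the columns of
    [V]: they span the lines that cancel the singularities of the dressed vacuum. *)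
Definition Wxt x t : 'M[C]_(n, N) := \matrix_(i, k)
  (ev (- ((z k)^* * rc x)) (- ((z k)^* ^+ j * rc t)) *m col k V) i 0.
Local Notation W := Wxt.

Lemma W_col x t k : col k (W x t) =
  ev (- ((z k)^* * rc x)) (- ((z k)^* ^+ j * rc t)) *m col k V.
Proof. by apply/matrixP => i l; rewrite ord1 mxE mxE. Qed.

Lemma M_W x t k : M x t (z k)^* *m col k (W x t) = col k V.
Proof. by rewrite W_col mulmxA (evN _ _ Pu) mul1mx. Qed.

Lemma W_adj x t k : (col k (W x t)) ^t* = (col k V) ^t* *m M x t (z k).
Proof.
rewrite W_col adjM (ev_adj Pu aE bE _ _ au bu) /Mv.
have cr (y : R) : (rc y)^* = rc y by exact: conjc_real.
have cM (y y' : C) : (- (y * y'))^* = - (y^* * y'^*).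
  by rewrite rmorphN rmorphM.
rewrite !cM !cr conjCK !opprK rmorphXn /= conjCK.
exact: erefl.
Qed.

Lemma W_nz x t : nzcols (W x t).
Proof.
move=> k; apply/existsP; apply: contraT; rewrite negb_exists => /forallP h.
have W0 : col k (W x t) = 0.
  by apply/matrixP => i l; rewrite mxE mx0E; have := h i; rewrite negbK => /eqP.
have [l /eqP[]] := Vnz k.
have := M_W x t k; rewrite W0 mulmx0 => /(congr1 (fun X : 'cV[C]_n => X l 0)).
by rewrite mx0E mxE.
Qed.

Lemma mder_W (X T : R -> R) (r : R) (x' t' : C) :
  cder (fun s => rc (X s)) r x' -> cder (fun s => rc (T s)) r t' ->
  mder (fun s => W (X s) (T s)) r (- (x' *: (a *m W (X r) (T r) *m Zc z) +
    t' *: (b *m W (X r) (T r) *m Zc z ^+ j))).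
Proof.
move=> dX dT i k.
have h : mder (fun s => ev (- ((z k)^* * rc (X s))) (- ((z k)^* ^+ j * rc (T s)))) r
    (((- (z k)^* * x') *: a + (- ((z k)^* ^+ j) * t') *: b) *m
      ev (- ((z k)^* * rc (X r))) (- ((z k)^* ^+ j * rc (T r)))).
  have := mder_sim P (fun l => cder_cexp (cderD
    (cderZ (- (z k)^* * da 0 l) dX) (cderZ (- ((z k)^* ^+ j) * db 0 l) dT))).
  move=> h; apply: mder_eq; first apply: mder_ext h => s.
    by apply: sim_ext => l; rewrite !mxE; congr cexp; ring.
  rewrite (comb_sim aE bE) (simM Pu); apply: sim_ext => l; rewrite !mxE.
  by congr (_ * _); first ring; congr cexp; ring.
have h2 := mderMr (col k V) h i 0.
apply: cder_eq; first by apply: cder_ext h2 => s; rewrite [RHS]mxE.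
transitivity ((((- (z k)^* * x') *: a + (- ((z k)^* ^+ j) * t') *: b) *m
    col k (W (X r) (T r))) i 0).
  have eW (G : 'M[C]_n) : G *m col k (W (X r) (T r)) =
      G *m ev (- ((z k)^* * rc (X r))) (- ((z k)^* ^+ j * rc (T r))) *m col k V.
    by rewrite W_col; exact: mulmxA.
  by rewrite eW.
rewrite mulmxDl mxNE !mxDE -!scalemxAl !mxZE ZcE (ZcXE z).
have e (G : 'M[C]_n) : (G *m col k (W (X r) (T r))) i 0 = (G *m W (X r) (T r)) i k.
  by rewrite mxE [RHS]mxE; apply: eq_bigr => l _; rewrite mxE.
by rewrite !e; ring.
Qed.

Lemma W_xflow x t : mder (fun s => W s t) x (- (a *m W x t *m Zc z)).
Proof.
apply: mder_eq; first exact: (@mder_W id (fun _ => t) x _ _ (cder_real x) (cder_cst _ x)).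
by rewrite scale1r scale0r addr0.
Qed.

Lemma W_tflow x t : mder (fun s => W x s) t (- (b *m W x t *m Zc z ^+ j)).
Proof.
apply: mder_eq; first exact: (@mder_W (fun _ => x) id t _ _ (cder_cst _ t) (cder_real t)).
by rewrite scale1r scale0r add0r.
Qed.

(** The product [g M g~^-1] with its removable singularities removed. The
    residues at [z k] and [conj z k] vanish because the vacuum at [conj z k] maps the
    [k]-th column of [W] to that of [V]. *)
Definition Et x t w : 'M[C]_n :=
  M x t w + \sum_k Pk z V k *m D x t (z k) w - \sum_m D x t (z m)^* w *m Bk z (W x t) m
  - \sum_k \sum_m (z k - (z m)^*)^-1 *:
      (Pk z V k *m (D x t (z k) w - D x t (z m)^* w) *m Bk z (W x t) m).

Lemma ginv_row (U : 'M[C]_(n, N)) k : nzcols U ->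
  (col k U) ^t* *m ginv z U (z k) = 0.
Proof.
move=> Unz; have Fu := F_unit z_inj z_conj Unz.
have e : (col k U) ^t* *m U *m Rc z (z k) = row k (FW z U).
  apply/matrixP => i m; rewrite ord1 [RHS]mxE FWE mul_mx_diag !mxE.
  by congr (_ * _); apply: eq_bigr => l _; rewrite !adjE !mxE.
rewrite /ginv mulmxBr mulmx1 /Smx !mulmxA mulmx1 e.
rewrite -row_mul mulmxV // row1 -rowE.
apply/eqP; rewrite subr_eq0; apply/eqP/matrixP => i l.
by rewrite adjE !mxE.
Qed.

Lemma gsol_col (U : 'M[C]_(n, N)) k : nzcols U ->
  gsol z U (z k)^* *m col k U = 0.
Proof.
move=> Unz; have := ginv_row k Unz => /(congr1 (fun X => X ^t*)).
rewrite adj0 adjM adjK => h; rewrite -[RHS]h; congr (_ *m _).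
by rewrite -(gs_adj z_inj z_conj (z k) Unz) adjK.
Qed.

Lemma BkE (U : 'M[C]_(n, N)) k :
  Bk z U k = col k U *m (delta_mx 0 k *m invmx (FW z U) *m U ^t*).
Proof.
rewrite /Bk /Smx mulmx1 -(mul_delta_mx (0 : 'I_1) k k) [U *m _]mulmxA -colE.
by rewrite -!mulmxA.
Qed.

Lemma residue_pole x t k : Pk z V k *m M x t (z k) *m ginv z (W x t) (z k) = 0.
Proof.
have assoc (u : 'cV[C]_n) (v : 'rV[C]_n) (A B : 'M[C]_n) :
  u *m v *m A *m B = u *m (v *m A *m B) by rewrite !mulmxA.
by rewrite PkE assoc -W_adj (ginv_row _ (W_nz x t)) mulmx0.
Qed.

Lemma residue_zero x t m : gsol z V (z m)^* *m M x t (z m)^* *m Bk z (W x t) m = 0.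
Proof.
have assoc p q (A B : 'M[C]_n) (G : 'M[C]_(n, p)) (H : 'M[C]_(p, q)) :
  A *m B *m (G *m H) = A *m (B *m G) *m H by rewrite !mulmxA.
by rewrite BkE assoc M_W (gsol_col _ Vnz) mul0mx.
Qed.

(** A partial fraction identity: the polar parts of the product are the
    residues, which vanish. *)
Lemma product_expansion (A B : 'I_N -> 'M[C]_n) (Mw : 'M[C]_n)
    (Mz Mc Dz Dc : 'I_N -> 'M[C]_n) w :
  (forall k, w != z k) -> (forall k, w != (z k)^*) ->
  (forall k, Mw = Mz k + (w - z k) *: Dz k) ->
  (forall k, Mw = Mc k + (w - (z k)^*) *: Dc k) ->
  (forall k, A k *m Mz k *m (1%:M - \sum_m (z k - (z m)^*)^-1 *: B m) = 0) ->
  (forall m, (1%:M + \sum_k ((z m)^* - z k)^-1 *: A k) *m Mc m *m B m = 0) ->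
  (1%:M + \sum_k (w - z k)^-1 *: A k) *m Mw *m (1%:M - \sum_m (w - (z m)^*)^-1 *: B m)
  = Mw + \sum_k A k *m Dz k - \sum_m Dc m *m B m
    - \sum_k \sum_m (z k - (z m)^*)^-1 *: (A k *m (Dz k - Dc m) *m B m).
Proof.
move=> wz wzc MzE McE rz rc.
have e1 k : (w - z k)^-1 *: (A k *m Mw) = A k *m Dz k + (w - z k)^-1 *: (A k *m Mz k).
  rewrite {1}(MzE k) mulmxDr scalerDr addrC; congr (_ + _).
  by rewrite -scalemxAr scalerA mulVf ?scale1r // subr_eq0.
have e2 m : (w - (z m)^*)^-1 *: (Mw *m B m) =
    Dc m *m B m + (w - (z m)^*)^-1 *: (Mc m *m B m).
  rewrite {1}(McE m) mulmxDl scalerDr addrC; congr (_ + _).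
  by rewrite -scalemxAl scalerA mulVf ?scale1r // subr_eq0.
have e3 k m : (w - z k)^-1 *: ((w - (z m)^*)^-1 *: (A k *m Mw *m B m)) =
    (z k - (z m)^*)^-1 *: (A k *m (Dz k - Dc m) *m B m) +
    (w - z k)^-1 *: ((z k - (z m)^*)^-1 *: (A k *m Mz k *m B m)) +
    (w - (z m)^*)^-1 *: (((z m)^* - z k)^-1 *: (A k *m Mc m *m B m)).
  have -> : (w - z k)^-1 *: ((w - (z m)^*)^-1 *: (A k *m Mw *m B m)) =
      (z k - (z m)^*)^-1 *: ((w - z k)^-1 *: (A k *m Mw)) *m B m -
      A k *m ((z k - (z m)^*)^-1 *: ((w - (z m)^*)^-1 *: (Mw *m B m))).
    rewrite -!scalemxAr -!scalemxAl !mulmxA !scalerA -scalerBl; congr (_ *: _).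
    have d1 : w - z k != 0 by rewrite subr_eq0.
    have d2 : w - (z m)^* != 0 by rewrite subr_eq0.
    have d3 : z k - (z m)^* != 0 by rewrite subr_eq0.
    by field; rewrite d1 d2 d3.
  rewrite e1 e2; move: (Dz k) (Dc m) (Mz k) (Mc m) (A k) (B m) => d d' p p' A' B'.
  have -> : (z m)^* - z k = - (z k - (z m)^*) by rewrite opprB.
  rewrite invrN; move: (w - z k)^-1 (w - (z m)^*)^-1 (z k - (z m)^*)^-1 => r1 r2 r3.
  have f1 : r3 *: (A' *m d + r1 *: (A' *m p)) *m B' =
      r3 *: (A' *m d *m B') + (r3 * r1) *: (A' *m p *m B').
    move: (A' *m d) (A' *m p) => G H.
    by rewrite scalerDr scalerA mulmxDl -!scalemxAl.
  have f2 : A' *m (r3 *: (d' *m B' + r2 *: (p' *m B'))) =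
      r3 *: (A' *m d' *m B') + (r3 * r2) *: (A' *m p' *m B').
    rewrite -(mulmxA A' d') -(mulmxA A' p'); move: (d' *m B') (p' *m B') => G H.
    by rewrite scalerDr scalerA mulmxDr -!scalemxAr.
  have f3 : A' *m (d - d') *m B' = A' *m d *m B' - A' *m d' *m B'.
    by rewrite mulmxBr mulmxBl.
  rewrite f1 f2 f3.
  move: (A' *m d *m B') (A' *m d' *m B') (A' *m p *m B') (A' *m p' *m B').
  move=> G1 G2 G3 G4.
  mxabel.
rewrite mulmxBr mulmx1 mulmxDl mul1mx mulmx_suml mulmxDl.
have -> : \sum_k (w - z k)^-1 *: A k *m Mw =
    \sum_k (A k *m Dz k + (w - z k)^-1 *: (A k *m Mz k)).
  by apply: eq_bigr => k _; rewrite -scalemxAl e1.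
have -> : Mw *m (\sum_m (w - (z m)^*)^-1 *: B m) =
    \sum_m (Dc m *m B m + (w - (z m)^*)^-1 *: (Mc m *m B m)).
  by rewrite mulmx_sumr; apply: eq_bigr => m _; rewrite -scalemxAr e2.
have -> : (\sum_k (A k *m Dz k + (w - z k)^-1 *: (A k *m Mz k))) *m
    (\sum_m (w - (z m)^*)^-1 *: B m) =
    \sum_k \sum_m (w - z k)^-1 *: ((w - (z m)^*)^-1 *: (A k *m Mw *m B m)).
  rewrite mulmx_suml; apply: eq_bigr => k _; rewrite mulmx_sumr.
  by apply: eq_bigr => m _; rewrite -e1 -scalemxAl -scalemxAr.
have rz' k : A k *m Mz k *m (\sum_m (z k - (z m)^*)^-1 *: B m) = A k *m Mz k.
  by have := rz k; rewrite mulmxBr mulmx1 => /eqP; rewrite subr_eq0 => /eqP.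
have rc' m : (\sum_k ((z m)^* - z k)^-1 *: A k) *m Mc m *m B m = - (Mc m *m B m).
  have := rc m; rewrite mulmxDl mulmxDl mul1mx => /eqP.
  by rewrite addrC addr_eq0 => /eqP.
have -> : \sum_k \sum_m (w - z k)^-1 *: ((w - (z m)^*)^-1 *: (A k *m Mw *m B m)) =
    \sum_k \sum_m (z k - (z m)^*)^-1 *: (A k *m (Dz k - Dc m) *m B m) +
    \sum_k (w - z k)^-1 *: (A k *m Mz k) -
    \sum_m (w - (z m)^*)^-1 *: (Mc m *m B m).
  under eq_bigr do under eq_bigr do rewrite e3.
  under eq_bigr do rewrite big_split big_split /=.
  rewrite !big_split /=; congr (_ + _ + _).
    apply: eq_bigr => k _; rewrite -{2}(rz' k) -scaler_sumr mulmx_sumr.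
    by congr (_ *: _); apply: eq_bigr => m _; rewrite -scalemxAr.
  rewrite exchange_big -sumrN; apply: eq_bigr => m _ /=.
  rewrite -scalerN -rc' -scaler_sumr !mulmx_suml; congr (_ *: _).
  by apply: eq_bigr => k _; rewrite -!scalemxAl.
rewrite !big_split /=.
move: (\sum_k A k *m Dz k) (\sum_k Dc k *m B k) (\sum_k _ *: (A k *m Mz k)) => X1 X2 X3.
move: (\sum_k _ *: (Mc k *m B k)) (\sum_k \sum_m _) => X4 X5.
mxabel.
Qed.

(** By the partial fraction identity, with the residues computed above. *)
Lemma Et_generic x t w : (forall k, w != z k) -> (forall k, w != (z k)^*) ->
  Et x t w = gsol z V w *m M x t w *m ginv z (W x t) w.
Proof.
move=> wz wzc; rewrite gsolE ginvE.
apply: esym; apply: (@product_expansion (Pk z V) (Bk z (W x t)) (M x t w)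
  (fun k => M x t (z k)) (fun k => M x t (z k)^*)
  (fun k => D x t (z k) w) (fun k => D x t (z k)^* w) w wz wzc).
- by move=> k; exact: Mv_Dv.
- by move=> k; exact: Mv_Dv.
- by move=> k; rewrite -ginvE; exact: residue_pole.
by move=> m; rewrite -gsolE; exact: residue_zero.
Qed.

Lemma zconj_generic w : (forall k, w != z k) /\ (forall k, w != (z k)^*) ->
  (forall k, w^* != z k) /\ (forall k, w^* != (z k)^*).
Proof.
move=> [w1 w2]; split=> k.
  by rewrite -[z k]conjCK (inj_eq (inv_inj (@conjCK _))).
by rewrite (inj_eq (inv_inj (@conjCK _))).
Qed.

Lemma M_adj x t w : (M x t w^*) ^t* *m M x t w = 1%:M.
Proof.
have -> : (M x t w^*) ^t* = ev (- (w * rc x)) (- (w ^+ j * rc t)).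
  have cr (y : R) : (rc y)^* = rc y by exact: conjc_real.
  have cM (y y' : C) : (y * y')^* = y^* * y'^* by exact: rmorphM.
  rewrite (ev_adj Pu aE bE _ _ au bu) !cM !cr conjCK rmorphXn /= conjCK.
  exact: erefl.
exact: mulmx1C (evN _ _ Pu _ _).
Qed.

Section Nice.
Variables (X T : R -> R) (r : R) (x' t' : C).
Hypotheses (dX : cder (fun s => rc (X s)) r x') (dT : cder (fun s => rc (T s)) r t').

Lemma nice_M : nice (fun s w => M (X s) (T s) w) r.
Proof.
split; first by move=> w; exact: mdiff_Mv.
exists (fun w => ((w * x') *: a + (w ^+ j * t') *: b) *m M (X r) (T r) w).
split=> w.
  exact: (@mder_Mv R n a b P da db j Pu aE bE (fun s => rc (X s)) (fun s => rc (T s))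
    r x' t' dX dT w).
apply: mdiffM; last exact: mdiff_Mv.
apply: mdiffD; (apply: mdiffZ; last exact: mdiff_cst).
  by apply: cdiffM; [exact: cdiff_id|exact: cdiff_cst].
by apply: cdiffM; [apply: cdiffX; exact: cdiff_id|exact: cdiff_cst].
Qed.

Lemma nice_D s : nice (fun q w => D (X q) (T q) s w) r.
Proof.
split; first by move=> w; exact: mdiff_Dv.
exists (fun w => (x' *: a + (pj j w s * t') *: b) *m M (X r) (T r) w +
   ((s * x') *: a + (s ^+ j * t') *: b) *m D (X r) (T r) s w).
split=> w.
  exact: (@mder_Dv R n a b P da db j Pu aE bE (fun s => rc (X s)) (fun s => rc (T s))
    r x' t' dX dT s w).
apply: mdiffD; last by apply: mdiffM; [exact: mdiff_cst|exact: mdiff_Dv].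
apply: mdiffM; last exact: mdiff_Mv.
apply: mdiffD; first exact: mdiff_cst.
apply: mdiffZ; last exact: mdiff_cst.
by apply: cdiffM; [exact: cdiff_pj|exact: cdiff_cst].
Qed.

Lemma nice_Et : (forall k, exists L, mder (fun s => Bk z (W (X s) (T s)) k) r L) ->
  nice (fun s w => Et (X s) (T s) w) r.
Proof.
move=> dB.
have nB k : nice (fun s _ => Bk z (W (X s) (T s)) k) r.
  have [L h] := dB k; split; first by move=> w; exact: mdiff_cst.
  by exists (fun _ => L); split=> // w; exact: mdiff_cst.
apply: niceD.
  apply: niceD.
    apply: niceD; first exact: nice_M.
    by apply: nice_sum => k; apply: niceM; [exact: nice_cst|exact: nice_D].
  by apply: niceN; apply: nice_sum => k; apply: niceM; [exact: nice_D|exact: nB].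
apply: niceN; apply: nice_sum => k; apply: nice_sum => m; apply: niceZ.
apply: niceM (nB m); apply: niceM; first exact: nice_cst.
by apply: niceD; [exact: nice_D|apply: niceN; exact: nice_D].
Qed.

(** Away from the poles the derivative is computed from the product; elsewhere
    it follows by continuity in [w]. *)
Lemma mder_Et (c : 'M[C]_n) (k : nat) : u_alg c ->
  mder (fun s => W (X s) (T s)) r (- (c *m W (X r) (T r) *m Zc z ^+ k)) ->
  (forall w, mder (fun s => M (X s) (T s) w) r (w ^+ k *: (c *m M (X r) (T r) w))) ->
  (forall w, c *m M (X r) (T r) w = M (X r) (T r) w *m c) ->
  forall w, mder (fun s => Et (X s) (T s) w) r
    (Et (X r) (T r) w *m Vw z c (W (X r) (T r)) k w).
Proof.
move=> cu dW dM cM.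
have Wn s : nzcols (W (X s) (T s)) by exact: W_nz.
have dB m : exists L, mder (fun s => Bk z (W (X s) (T s)) m) r L.
  by eexists; exact: (S_flow z_inj z_conj (delta_mx m m) 1%:M cu Wn dW).
have [Ed [L [EL Ld]]] := nice_Et dB.
have Vd w : mdiff (Vw z c (W (X r) (T r)) k) w.
  apply: mdiff_sum => i _; apply: mdiffZ; last exact: mdiff_cst.
  by apply: cdiffX; exact: cdiff_id.
have gen w : (forall k, w != z k) /\ (forall k, w != (z k)^*) ->
    L w = Et (X r) (T r) w *m Vw z c (W (X r) (T r)) k w.
  move=> [w1 w2].
  have dh := gi_flow z_inj z_conj cu Wn w2 dW.
  have := mderM (mderMl (gsol z V w) (dM w)) dh.
  have e : (fun s => gsol z V w *m M (X s) (T s) w *m ginv z (W (X s) (T s)) w) =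
      (fun s => Et (X s) (T s) w).
    by apply/funext => s; rewrite Et_generic.
  rewrite e => h; rewrite (mder_unique (EL w) h) Et_generic //.
  rewrite cM; move: (M _ _ w) (ginv _ _ w) (gsol _ _ w) (Vw _ _ _ _ _) => m h' g' v'.
  rewrite mulmxDr mulmxN -!(scalemxAr, scalemxAl) !mulmxA.
  by rewrite addrA subrr add0r.
move=> w; apply: mder_eq (EL w) _.
apply: (@mdiff_eq_off R n n L (fun w => Et (X r) (T r) w *m Vw z c (W (X r) (T r)) k w)).
- exact: Ld.
- exact: mdiffM (Ed w) (Vd w).
by apply: cofin_near; apply: cofin_impl gen (cofin_z z).
Qed.

End Nice.

Lemma mdiff_Et x t w : mdiff (Et x t) w.
Proof.
have dB m : exists L, mder (fun s => Bk z (W s t) m) x L.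
  eexists; apply: (@S_flow _ _ _ z z_inj z_conj (fun s => W s t) a 1 x (delta_mx m m) 1%:M au).
    by move=> s; exact: W_nz.
  by rewrite expr1; exact: W_xflow.
by have [] := @nice_Et id (fun _ => t) x 1 0 (cder_real x) (cder_cst _ x) dB.
Qed.

Lemma Et_xder x t w : mder (fun s => Et s t w) x
  (Et x t w *m (w *: a + lie (Smx z (W x t) 1%:M 1%:M) a)).
Proof.
rewrite -Vw1.
apply: (@mder_Et id (fun _ => t) x 1 0 (cder_real x) (cder_cst _ x) a 1 au).
- by rewrite expr1; exact: W_xflow.
- move=> w'; apply: mder_eq; first exact: (@mder_Mv R n a b P da db j Pu aE bE _ _ x _ _
    (cder_real x) (cder_cst (rc t) x) w').
  by rewrite mulr1 mulr0 scale0r addr0 expr1 scalemxAl.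
by move=> w'; have := ev_comm Pu aE bE (w' * rc x) (w' ^+ j * rc t) 1 0;
   rewrite scale1r scale0r addr0.
Qed.

Lemma Et_tder x t w : mder (fun s => Et x s w) t
  (Et x t w *m Vw z b (W x t) j w).
Proof.
apply: (@mder_Et (fun _ => x) id t 0 1 (cder_cst _ t) (cder_real t) b j bu).
- exact: W_tflow.
- move=> w'; apply: mder_eq; first exact: (@mder_Mv R n a b P da db j Pu aE bE _ _ t _ _
    (cder_cst (rc x) t) (cder_real t) w').
  by rewrite mulr1 mulr0 scale0r add0r scalemxAl.
by move=> w'; have := ev_comm Pu aE bE (w' * rc x) (w' ^+ j * rc t) 0 1;
   rewrite scale1r scale0r add0r.
Qed.

Lemma Et_unitary x t w : (Et x t w^*) ^t* *m Et x t w = 1%:M.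
Proof.
apply: (@mdiff_eq_off R n n (fun w => (Et x t w^*) ^t* *m Et x t w) (fun _ => 1%:M)).
- apply: mdiffM (mdiff_Et x t w).
  by apply: mdiff_conj; exact: mdiff_Et.
- exact: mdiff_cst.
apply: cofin_near; apply: cofin_impl (cofin_z z) => s /[dup] s12 [s1 s2].
have [s3 s4] := zconj_generic s12.
rewrite !Et_generic // !adjM gi_adj // ?gs_adj //; last exact: W_nz.
have e1 := gigs z_inj z_conj Vnz s1 s2.
have e2 := gsgi z_inj z_conj (W_nz x t) s1 s2.
have e3 := M_adj x t s.
move: (M x t s) ((M x t s^*) ^t*) e3 (gsol z (W x t) s) (ginv z (W x t) s) e2
  (ginv z V s) (gsol z V s) e1 => m m' e3 p p' e2 q q' e1.
transitivity (p *m (m' *m (q *m q') *m m) *m p'); first by rewrite !mulmxA.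
by rewrite e1 mulmx1 e3 mulmx1 e2.
Qed.

Lemma Et_unit x t w : Et x t w \in unitmx.
Proof. exact: (mulmx1_unit (Et_unitary x t w)).2. Qed.

(** By continuity also at the conjugates of the poles, where [ginv] is singular. *)
Lemma Et_factor x t w : (forall k, w != z k) ->
  gsol z V w *m M x t w = Et x t w *m gsol z (W x t) w.
Proof.
move=> wz.
have gd (U : 'M[C]_(n, N)) : mdiff (gsol z U) w.
  apply: (mdiff_ext (fun s => esym (gsolE z U s))).
  by apply: mdiff_pf => k _; exact: wz.
apply: (@mdiff_eq_off R n n (fun w => gsol z V w *m M x t w)
   (fun w => Et x t w *m gsol z (W x t) w)).
- by apply: mdiffM (gd V) _; exact: mdiff_Mv.
- exact: mdiffM (mdiff_Et x t w) (gd _).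
apply: cofin_near; apply: cofin_impl (cofin_z z) => s [s1 s2].
by rewrite Et_generic // -[RHS]mulmxA gigs ?mulmx1 //; exact: W_nz.
Qed.

End SolitonDressing.

(** * Behaviour of the soliton at infinity *)

Section Rapid.
Context {R : realType}.
Local Notation C := R[i].
Variable sg : R.
Implicit Types (f g : R -> C).

(** The sign [sg], which is [1] or [-1], selects one of the two half-lines. *)
Definition rapid f : Prop := forall m : nat, exists B : R, forall x,
  0 <= sg * x -> `|x| ^+ m * nrm (f x) <= B.
Definition bdd f : Prop := exists B : R, forall x, 0 <= sg * x -> nrm (f x) <= B.

Lemma rapid_bdd f : rapid f -> bdd f.
Proof. by move=> /(_ 0)[B hB]; exists B => x /hB; rewrite expr0 mul1r. Qed.

Lemma bdd_cst (c : C) : bdd (fun _ => c). Proof. by exists (nrm c). Qed.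

Lemma bdd_ge0 f : bdd f -> exists2 B : R, 0 <= B & forall x, 0 <= sg * x -> nrm (f x) <= B.
Proof.
case=> B hB; exists `|B| => // x /hB h; exact: le_trans h (ler_norm _).
Qed.

Lemma bddD f g : bdd f -> bdd g -> bdd (fun x => f x + g x).
Proof.
move=> [B hB] [B' hB']; exists (B + B') => x x0.
exact: le_trans (nrmD _ _) (lerD (hB x x0) (hB' x x0)).
Qed.

Lemma bddM f g : bdd f -> bdd g -> bdd (fun x => f x * g x).
Proof.
move=> /bdd_ge0[B B0 hB] /bdd_ge0[B' B'0 hB']; exists (B * B') => x x0.
by rewrite nrmM ler_pM ?nrm_ge0 ?hB ?hB'.
Qed.

Lemma rapid0 : rapid (fun _ => 0).
Proof. by move=> m; exists 0 => x _; rewrite nrm0 mulr0. Qed.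

Lemma rapidD f g : rapid f -> rapid g -> rapid (fun x => f x + g x).
Proof.
move=> hf hg m; have [B hB] := hf m; have [B' hB'] := hg m; exists (B + B') => x x0.
apply: le_trans (lerD (hB x x0) (hB' x x0)); rewrite -mulrDr.
by rewrite ler_wpM2l ?exprn_ge0 // nrmD.
Qed.

Lemma rapidM f g : rapid f -> bdd g -> rapid (fun x => f x * g x).
Proof.
move=> hf /bdd_ge0[B' B'0 hB'] m; have [B hB] := hf m; exists (B * B') => x x0.
rewrite nrmM mulrA ler_pM ?hB ?hB' ?nrm_ge0 // mulr_ge0 ?nrm_ge0 // exprn_ge0 //.
Qed.

Lemma rapidMr f g : bdd f -> rapid g -> rapid (fun x => f x * g x).
Proof.
move=> hf hg; have h := rapidM hg hf => m; have [B hB] := h m.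
by exists B => x /hB; rewrite [f x * _]mulrC.
Qed.

Lemma rapid_ext f g : f =1 g -> rapid f -> rapid g.
Proof. by move=> /funext ->. Qed.

Lemma bdd_ext f g : f =1 g -> bdd f -> bdd g.
Proof. by move=> /funext ->. Qed.

Lemma rapid_sum I (r : seq I) (F : I -> R -> C) :
  (forall i, rapid (F i)) -> rapid (fun x => \sum_(i <- r) F i x).
Proof.
move=> hF; elim: r => [|i r IH].
  by apply: (rapid_ext _ rapid0) => x; rewrite big_nil.
by apply: (rapid_ext _ (rapidD (hF i) IH)) => x; rewrite big_cons.
Qed.

Lemma rapid_conj f : rapid f -> rapid (fun x => (f x)^*).
Proof. by move=> h m; have [B hB] := h m; exists B => x; rewrite nrm_conj; apply: hB. Qed.

(** The exponential series gives [y^m <= (m+1)! exp y] for [0 <= y]. *)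
Lemma rapid_exp (q : C) : (complex.Re q != 0) -> 0 <= sg * complex.Re q ->
  `|sg| = 1 -> rapid (fun x => cexp (- (q * (x%:C)%C))).
Proof.
move=> q0 sq s1 m; exists (m.+1`!%:R / `|complex.Re q| ^+ m + 1) => x x0.
have s2 : sg * sg = 1.
  by have := congr1 (fun y => y * y) s1; rewrite -normrM ger0_norm ?mul1r // -expr2 sqr_ge0.
have e : complex.Re (- (q * (x%:C)%C)) = - (`|complex.Re q| * `|x|).
  rewrite ReN ReM /= mulr0 subr0 -normrM ger0_norm //.
  have -> : complex.Re q * x = (sg * complex.Re q) * (sg * x).
    by rewrite mulrACA s2 mul1r.
  exact: mulr_ge0.
rewrite nrm_cexp e expRN.
set r := `|complex.Re q|; set y := r * `|x|.
have r0 : 0 < r by rewrite normr_gt0.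
have y0 : 0 <= y by rewrite mulr_ge0 // ltW.
have h : y ^+ m <= m.+1`!%:R * expR y.
  case: m => [|m].
    by rewrite expr0 mul1r; apply: le_trans (expR_ge1Dx y); rewrite lerDl.
  have h1 := expR_ge1Dxn m y0.
  have f1 : 0 < m.+1`!%:R :> R by rewrite ltr0n fact_gt0.
  have h2 : y ^+ m.+1 <= m.+1`!%:R * expR y.
    rewrite -ler_pdivrMl // mulrC; apply: le_trans h1; by rewrite lerDr.
  apply: le_trans h2 _; rewrite ler_wpM2r ?expR_ge0 // ler_nat.
  by rewrite [m.+2`!]factS leq_pmull.
have ey : 0 < expR y by exact: expR_gt0.
rewrite ler_pdivrMr //.
have -> : `|x| ^+ m = y ^+ m / r ^+ m.
  by rewrite /y exprMn mulrAC mulfV ?mul1r // expf_neq0 // gt_eqF.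
rewrite mulrDl mul1r; apply: (@le_trans _ _ (m.+1`!%:R * expR y / r ^+ m)).
  by rewrite ler_wpM2r // invr_ge0 exprn_ge0 // ltW.
by rewrite mulrAC lerDl ltW.
Qed.

Definition mbdd m p (f : R -> 'M[C]_(m, p)) : Prop :=
  forall i j, bdd (fun x => f x i j).
Definition mrapid m p (f : R -> 'M[C]_(m, p)) : Prop :=
  forall i j, rapid (fun x => f x i j).
Definition mconv m p (f : R -> 'M[C]_(m, p)) L : Prop :=
  mrapid (fun x => f x - L).

Lemma mbdd_cst m p (A : 'M[C]_(m, p)) : mbdd (fun _ => A).
Proof. by move=> i j; apply: bdd_cst. Qed.

Lemma mconv_bdd m p (f : R -> 'M[C]_(m, p)) L : mconv f L -> mbdd f.
Proof.
move=> h i j; apply: (bdd_ext _ (bddD (rapid_bdd (h i j)) (bdd_cst (L i j)))) => x.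
by rewrite mxDE mxNE subrK.
Qed.

Lemma mrapidM m p q (f : R -> 'M[C]_(m, p)) (g : R -> 'M[C]_(p, q)) :
  mrapid f -> mbdd g -> mrapid (fun x => f x *m g x).
Proof.
move=> hf hg i j.
apply: (rapid_ext _ (rapid_sum (index_enum _) (fun k => rapidM (hf i k) (hg k j)))) => x.
by rewrite mxE.
Qed.

Lemma mrapidMr m p q (f : R -> 'M[C]_(m, p)) (g : R -> 'M[C]_(p, q)) :
  mbdd f -> mrapid g -> mrapid (fun x => f x *m g x).
Proof.
move=> hf hg i j.
apply: (rapid_ext _ (rapid_sum (index_enum _) (fun k => rapidMr (hf i k) (hg k j)))) => x.
by rewrite mxE.
Qed.

Lemma mrapidD m p (f g : R -> 'M[C]_(m, p)) :
  mrapid f -> mrapid g -> mrapid (fun x => f x + g x).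
Proof.
move=> hf hg i j; apply: (rapid_ext _ (rapidD (hf i j) (hg i j))) => x.
by rewrite mxDE.
Qed.

Lemma mrapid_ext m p (f g : R -> 'M[C]_(m, p)) : f =1 g -> mrapid f -> mrapid g.
Proof. by move=> /funext ->. Qed.

Lemma mconvM m p q (f : R -> 'M[C]_(m, p)) (g : R -> 'M[C]_(p, q)) L L' :
  mconv f L -> mconv g L' -> mconv (fun x => f x *m g x) (L *m L').
Proof.
move=> hf hg.
apply: (mrapid_ext _ (mrapidD (mrapidM hf (mconv_bdd hg)) (mrapidMr (mbdd_cst L) hg))) => x.
by rewrite mulmxBl mulmxBr addrA subrK.
Qed.

Lemma mconv_cst m p (A : 'M[C]_(m, p)) : mconv (fun _ => A) A.
Proof. by move=> i j; apply: (rapid_ext _ rapid0) => x; rewrite subrr mx0E. Qed.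

Lemma mconv_adj m p (f : R -> 'M[C]_(m, p)) L :
  mconv f L -> mconv (fun x => (f x) ^t*) (L ^t*).
Proof.
move=> h i j; apply: (rapid_ext _ (rapid_conj (h j i))) => x.
by rewrite !mxDE !mxNE !adjE rmorphB.
Qed.

End Rapid.

Section HalfLine.
Context {R : realType} {n N : nat}.
Local Notation C := R[i].
Variables (z : 'I_N -> C) (z_inj : injective z) (z_conj : forall m k, z m != (z k)^*).
Implicit Types (W : 'M[C]_(n, N)) (d e : 'rV[C]_N) (x : R).
Local Notation F := (FW z).
Local Notation S := (Smx z).

Lemma diagmE m p (v : 'rV[C]_m) (X : 'M[C]_(m, p)) i k :
  (diag_mx v *m X) i k = v 0 i * X i k.
Proof. by rewrite mul_diag_mx mxE. Qed.

Lemma mdiagE m p (v : 'rV[C]_p) (X : 'M[C]_(m, p)) i k :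
  (X *m diag_mx v) i k = X i k * v 0 k.
Proof. by rewrite mul_mx_diag mxE. Qed.

Lemma F_scale W d : F (W *m diag_mx d) = (diag_mx d) ^t* *m F W *m diag_mx d.
Proof.
apply/matrixP => m k; rewrite adj_diag mdiagE diagmE !FWE adjM adj_diag.
rewrite mulmxA mdiagE -mulmxA diagmE mxE; ring.
Qed.

(** The sandwiches depend only on the lines spanned by the columns, which may
    therefore be rescaled to converge. *)
Lemma S_scale W d D E : (forall k, d 0 k != 0) -> nzcols W ->
  S (W *m diag_mx d) (diag_mx D) (diag_mx E) = S W (diag_mx D) (diag_mx E).
Proof.
move=> d0 Wnz; have Fu := F_unit z_inj z_conj Wnz.
pose di : 'rV[C]_N := \row_k (d 0 k)^-1.
have dK : diag_mx d *m diag_mx di = 1%:M.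
  rewrite mulmx_diag -diag_const_mx; congr diag_mx; apply/rowP => k.
  by rewrite !mxE mulfV.
have du : diag_mx d \in unitmx := (mulmx1_unit dK).1.
have comm (d1 d2 : 'rV[C]_N) : diag_mx d1 *m diag_mx d2 = diag_mx d2 *m diag_mx d1.
  by rewrite !mulmx_diag; congr diag_mx; apply/rowP => k; rewrite !mxE mulrC.
have dau : (diag_mx d) ^t* \in unitmx.
  have := congr1 (fun X => X ^t*) dK; rewrite adjM adj1 => /mulmx1_unit[_ //].
have inv : invmx (F (W *m diag_mx d)) =
    diag_mx di *m invmx (F W) *m invmx ((diag_mx d) ^t*).
  have e : F (W *m diag_mx d) *m
     (diag_mx di *m invmx (F W) *m invmx ((diag_mx d) ^t*)) = 1%:M.
    rewrite F_scale; move: (diag_mx d) ((diag_mx d) ^t*) (diag_mx di) (F W) Fu dK dau.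
    move=> g g' gi' f Fu' dK' dau'.
    transitivity (g' *m (f *m (g *m gi') *m invmx f) *m invmx g').
      by rewrite !mulmxA.
    by rewrite dK' mulmx1 mulmxV // mulmx1 mulmxV.
  by rewrite -[RHS](mulKmx (mulmx1_unit e).1) e mulmx1.
rewrite /Smx inv adjM adj_diag.
have c1 : diag_mx d *m diag_mx D = diag_mx D *m diag_mx d by exact: comm.
have c2 : diag_mx E *m diag_mx (map_mx (fun c => c^*) d) =
    diag_mx (map_mx (fun c => c^*) d) *m diag_mx E by exact: comm.
rewrite adj_diag in dau *.
move: (invmx (F W)) (diag_mx d) (diag_mx (map_mx _ d)) (diag_mx di) (diag_mx D)
  (diag_mx E) (W ^t*) dK dau c1 c2 => f g g' gi' D' E' W' dK' dau' c1 c2.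
transitivity (W *m (g *m D') *m gi' *m f *m invmx g' *m (E' *m g') *m W').
  by rewrite !mulmxA.
rewrite c1 c2; transitivity (W *m D' *m (g *m gi') *m f *m (invmx g' *m g') *m E' *m W').
  by rewrite !mulmxA.
by rewrite dK' mulVmx // !mulmx1.
Qed.

Section Limit.
Variables (a : 'M[C]_n) (ad : 'rV[C]_n) (U : 'M[C]_(n, N)) (sg : R).
Hypotheses (aE : a = diag_mx ad) (au : u_alg a) (Unz : nzcols U) (sg1 : `|sg| = 1).

Definition Wx x : 'M[C]_(n, N) :=
  \matrix_(i, k) (cexp (- (ad 0 i * (z k)^* * (x%:C)%C)) * U i k).

Lemma ad_conj i : (ad 0 i)^* = - ad 0 i.
Proof.
have := congr1 (fun X : 'M[C]_n => X i i) au; rewrite adjE aE mxNE !mxE eqxx.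
by rewrite !mulr1n.
Qed.

Lemma ad_Re i : complex.Re (ad 0 i) = 0.
Proof.
have := congr1 (@complex.Re R) (ad_conj i); rewrite Re_conj ReN => h.
by have := h; lra.
Qed.

Lemma z_Im k : complex.Im (z k) != 0.
Proof.
apply/eqP => e; have := z_conj k k; case: (z k) e => p q /= ->.
by rewrite eq_complex /= oppr0 !eqxx.
Qed.

Lemma Re_adz i i' k : ad 0 i != ad 0 i' ->
  complex.Re ((ad 0 i - ad 0 i') * (z k)^*) != 0.
Proof.
move=> ii; rewrite ReM ReD ReN !ad_Re subr0 mul0r sub0r Im_conj mulrN opprK.
rewrite mulf_neq0 ?z_Im // ImD ImN subr_eq0; apply: contraNneq ii => e.
by rewrite [ad 0 i]ReImE [ad 0 i']ReImE !ad_Re e.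
Qed.

(** The entry of the column that grows fastest, or decays slowest, with [sg * x]. *)
Lemma dominant k : exists i0, U i0 k != 0 /\ forall i, U i k != 0 ->
  0 <= sg * complex.Re ((ad 0 i - ad 0 i0) * (z k)^*).
Proof.
have [l Ul] := Unz k.
pose f i := sg * complex.Re (ad 0 i * (z k)^*).
have [i0 Ui0 mi0] := @Order.TotalTheory.arg_minP _ R _ l (fun i => U i k != 0) f Ul.
exists i0; split=> // i /mi0; rewrite /f -subr_ge0 -mulrBr.
by rewrite mulrBl ReD ReN.
Qed.

Definition dom k : 'I_n := sval (cid (dominant k)).

Lemma domP k : U (dom k) k != 0 /\ forall i, U i k != 0 ->
  0 <= sg * complex.Re ((ad 0 i - ad 0 (dom k)) * (z k)^*).
Proof. by rewrite /dom; case: cid. Qed.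

Definition Wscale x : 'rV[C]_N :=
  \row_k cexp (ad 0 (dom k) * (z k)^* * (x%:C)%C).
Definition Wh x := Wx x *m diag_mx (Wscale x).
(** Only the entries belonging to the dominant eigenvalue survive the limit. *)
Definition Winf : 'M[C]_(n, N) :=
  \matrix_(i, k) (if ad 0 i == ad 0 (dom k) then U i k else 0).

Lemma WhE x i k : Wh x i k =
  cexp (- ((ad 0 i - ad 0 (dom k)) * (z k)^* * (x%:C)%C)) * U i k.
Proof.
rewrite /Wh mdiagE !mxE mulrAC -cexpD; congr (cexp _ * _); ring.
Qed.

Lemma Wx_nz x : nzcols (Wx x).
Proof.
move=> k; have [l Ul] := Unz k; exists l.
by rewrite mxE mulf_neq0 // cexp_neq0.
Qed.

Lemma Winf_nz : nzcols Winf.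
Proof. by move=> k; exists (dom k); rewrite mxE eqxx; have [] := domP k. Qed.

Lemma Wh_conv : mconv sg Wh Winf.
Proof.
move=> i k; have [_ h] := domP k.
have [e|ne] := eqVneq (ad 0 i) (ad 0 (dom k)).
  apply: (rapid_ext _ (rapid0 sg)) => x; rewrite mxDE mxNE WhE [Winf _ _]mxE e eqxx subrr.
  by rewrite !mul0r oppr0 cexp0 mul1r subrr.
have [U0|U0] := eqVneq (U i k) 0.
  apply: (rapid_ext _ (rapid0 sg)) => x; rewrite mxDE mxNE WhE [Winf _ _]mxE U0.
  by rewrite mulr0 if_same subr0.
have r := rapid_exp (Re_adz k ne) (h i U0) sg1.
apply: (rapid_ext _ (rapidM r (bdd_cst sg (U i k)))) => x.
by rewrite mxDE mxNE WhE [Winf _ _]mxE (negPf ne) subr0.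
Qed.

Lemma dom_lower : exists2 c0 : R, 0 < c0 & forall k, c0 <= nrm (U (dom k) k) ^+ 2.
Proof.
have p0 k : 0 < nrm (U (dom k) k) ^+ 2.
  by rewrite exprn_gt0 // nrm_gt0; have [] := domP k.
have s0 : 0 < 1 + \sum_k (nrm (U (dom k) k) ^+ 2)^-1.
  by rewrite ltr_pwDl // sumr_ge0 // => k _; rewrite invr_ge0 ltW.
exists (1 + \sum_k (nrm (U (dom k) k) ^+ 2)^-1)^-1; first by rewrite invr_gt0.
move=> k; rewrite -[leRHS]invrK lef_pV2 ?posrE ?invr_gt0 //.
rewrite (bigD1 k) //= addrCA lerDl addr_ge0 // sumr_ge0 // => m _.
by rewrite invr_ge0 ltW.
Qed.

(** [A^-1 - B^-1 = A^-1 (B - A) B^-1], where [A^-1] stays bounded. *)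
Lemma Finv_conv : mconv sg (fun x => invmx (F (Wh x))) (invmx (F Winf)).
Proof.
have [c0 c00 c0P] := dom_lower.
have [B hB] := @Finv_bound R n N z z_inj z_conj c0 c00.
have lowW x k : c0 <= \sum_l nrm (Wh x l k) ^+ 2.
  apply: le_trans (c0P k) _; rewrite (bigD1 (dom k)) //= WhE subrr !mul0r oppr0 cexp0.
  by rewrite mul1r lerDl sumr_ge0 // => l _; apply: sqr_ge0.
have Wnz x : nzcols (Wh x).
  move=> k; exists (dom k); rewrite WhE mulf_neq0 ?cexp_neq0 //.
  by have [] := domP k.
have bF : mbdd sg (fun x => invmx (F (Wh x))).
  by move=> m k; exists B => x _; apply: hB; exact: lowW.
have cF : mconv sg (fun x => F (Wh x)) (F Winf).
  have h := mconvM (mconv_adj Wh_conv) Wh_conv => m k.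
  apply: (rapid_ext _ (rapidM (h m k) (bdd_cst sg (z m - (z k)^*)^-1))) => x.
  by rewrite mxDE mxNE [RHS]mxDE [X in _ = _ + X]mxNE !FWE mulrBl.
have := mrapidM (mrapidMr bF cF) (mbdd_cst sg (- invmx (F Winf))).
apply: mrapid_ext => x.
have u1 := F_unit z_inj z_conj (Wnz x); have u2 := F_unit z_inj z_conj Winf_nz.
move: (F (Wh x)) (F Winf) u1 u2 => f f' u1 u2.
rewrite mulmxBr mulVmx // mulmxBl mul1mx mulmxN mulmxK //.
by rewrite opprK addrC.
Qed.

Lemma S_conv (D E : 'rV[C]_N) :
  mconv sg (fun x => S (Wx x) (diag_mx D) (diag_mx E)) (S Winf (diag_mx D) (diag_mx E)).
Proof.
have h := mconvM (mconvM (mconvM (mconvM Wh_conv (mconv_cst sg (diag_mx D))) Finv_conv)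
   (mconv_cst sg (diag_mx E))) (mconv_adj Wh_conv).
apply: mrapid_ext h => x; congr (_ - _).
rewrite -(S_scale (d := Wscale x)) //; last exact: Wx_nz.
by move=> k; rewrite mxE cexp_neq0.
Qed.

(** The columns of the limit are eigenvectors of [a]. *)
Lemma S_inf_comm (D E : 'rV[C]_N) : lie (S Winf (diag_mx D) (diag_mx E)) a = 0.
Proof.
pose la : 'rV[C]_N := \row_k ad 0 (dom k).
pose L := diag_mx la.
have comm (d1 d2 : 'rV[C]_N) : diag_mx d1 *m diag_mx d2 = diag_mx d2 *m diag_mx d1.
  by rewrite !mulmx_diag; congr diag_mx; apply/rowP => k; rewrite !mxE mulrC.
have aW : a *m Winf = Winf *m L.
  apply/matrixP => i k; rewrite aE diagmE mdiagE !mxE.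
  by case: eqP => [->|_]; rewrite ?mulr0 ?mul0r // mulrC.
have La : L ^t* = - L.
  rewrite adj_diag; apply/matrixP => i k; rewrite mxNE !mxE ad_conj.
  by rewrite mulNrn.
have Wa : Winf ^t* *m a = L *m Winf ^t*.
  have := congr1 (fun X => X ^t*) aW; rewrite !adjM La au mulmxN mulNmx.
  by move=> /oppr_inj.
have Fu := F_unit z_inj z_conj Winf_nz.
have LF : L *m F Winf = F Winf *m L.
  apply/matrixP => m k; rewrite diagmE mdiagE !FWE.
  have e : L *m (Winf ^t* *m Winf) = (Winf ^t* *m Winf) *m L.
    by rewrite mulmxA -Wa -!mulmxA aW.
  have := congr1 (fun X : 'M[C]_N => X m k) e.
  rewrite diagmE mdiagE => e2.
  by rewrite mulrA e2 mulrAC.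
have LFi : L *m invmx (F Winf) = invmx (F Winf) *m L.
  by rewrite -[LHS](mulKmx Fu) [F Winf *m (L *m _)]mulmxA -LF mulmxK.
apply/eqP; rewrite subr_eq0; apply/eqP.
rewrite /Smx; move: (comm D la) (comm E la); rewrite -/L.
clear comm LF Fu; clear La.
move: (invmx (F Winf)) (diag_mx D) (diag_mx E) L (Winf ^t*) aW Wa LFi.
move: Winf => W' f D' E' L' Wa' aW Wa LFi cD cE.
transitivity (W' *m D' *m f *m E' *m (Wa' *m a)); first by rewrite !mulmxA.
rewrite Wa; transitivity (W' *m D' *m f *m (E' *m L') *m Wa'); first by rewrite !mulmxA.
rewrite cE; transitivity (W' *m D' *m (f *m L') *m E' *m Wa'); first by rewrite !mulmxA.
rewrite -LFi; transitivity (W' *m (D' *m L') *m f *m E' *m Wa'); first by rewrite !mulmxA.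
rewrite cD mulmxA -aW; by rewrite !mulmxA.
Qed.

End Limit.

End HalfLine.

(** * The soliton is a Schwartz function *)

Section Schwartz.
Context {R : realType} {n N : nat}.
Local Notation C := R[i].
Variables (z : 'I_N -> C) (z_inj : injective z) (z_conj : forall m k, z m != (z k)^*).
Variables (a : 'M[C]_n) (ad : 'rV[C]_n) (U : 'M[C]_(n, N)).
Hypotheses (aE : a = diag_mx ad) (au : u_alg a) (Unz : nzcols U).
Implicit Types (f g : R -> C) (x : R) (i l : 'I_n).
Local Notation W := (Wx z ad U).

Lemma Wx_flow x : mder W x (- (a *m W x *m Zc z)).
Proof.
move=> i k; apply: cder_eq.
  apply: cder_ext (cderM (cder_cexp (cderN (cderZ (ad 0 i * (z k)^*) (cder_real x))))
    (cder_cst (U i k) x)) => s.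
  by rewrite [RHS]mxE.
by rewrite mxNE ZcE aE diagmE [W x i k]mxE; ring.
Qed.

Definition Spq p q x : 'M[C]_n := Smx z (W x) (Zc z ^+ p) (Zm z ^+ q).

Lemma Spq_der p q x : mder (Spq p q) x
  (- (a *m Spq p.+1 q x) + Spq p q.+1 x *m a - Spq p 0 x *m a *m Spq 0 q x).
Proof.
have h := S_xflow z_inj z_conj au (Wx_nz z ad Unz) (Wx_flow x) (Zc z ^+ p) (Zm z ^+ q).
apply: mder_eq h _; rewrite /Spq !expr0 exprS [Zm z ^+ q.+1]exprSr.
exact: erefl.
Qed.

Lemma Spq_conv sg p q : `|sg| = 1 -> exists L : 'M[C]_n,
  mconv sg (Spq p q) L /\ lie L a = 0.
Proof.
move=> s1; rewrite /Spq !diag_exp.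
exists (Smx z (Winf z ad sg Unz) (diag_mx (map_mx (fun y => y ^+ p) (\row_k (z k)^*)))
  (diag_mx (map_mx (fun y => y ^+ q) (\row_k z k)))); split.
  exact: (S_conv z_inj z_conj aE au Unz s1).
exact: (S_inf_comm z_inj z_conj sg aE au Unz).
Qed.

(** The entries of the matrices [Spq] generate an algebra of bounded functions
    which is closed under differentiation. *)
Inductive soliton_algebra : (R -> C) -> Prop :=
| alg_cst c : soliton_algebra (fun _ => c)
| alg_T p q i l : soliton_algebra (fun x => Spq p q x i l)
| algD f g : soliton_algebra f -> soliton_algebra g -> soliton_algebra (fun x => f x + g x)
| algM f g : soliton_algebra f -> soliton_algebra g -> soliton_algebra (fun x => f x * g x).

(** The entries joining different eigenvalues of [a] generate a differential
    ideal, whose members decay rapidly. *)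
Inductive soliton_ideal : (R -> C) -> Prop :=
| idl0 : soliton_ideal (fun _ => 0)
| idl_T p q i l : ad 0 i != ad 0 l -> soliton_ideal (fun x => Spq p q x i l)
| idlD f g : soliton_ideal f -> soliton_ideal g -> soliton_ideal (fun x => f x + g x)
| idlM f g : soliton_algebra f -> soliton_ideal g -> soliton_ideal (fun x => f x * g x).

Lemma alg_sum (I : Type) (r : seq I) (F : I -> R -> C) : (forall k, soliton_algebra (F k)) ->
  soliton_algebra (fun x => \sum_(k <- r) F k x).
Proof.
move=> h; elim: r => [|k r IH].
  by under eq_fun do rewrite big_nil; exact: alg_cst.
by under eq_fun do rewrite big_cons; exact: algD.
Qed.

Lemma idl_sum (I : Type) (r : seq I) (F : I -> R -> C) : (forall k, soliton_ideal (F k)) ->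
  soliton_ideal (fun x => \sum_(k <- r) F k x).
Proof.
move=> h; elim: r => [|k r IH].
  by under eq_fun do rewrite big_nil; exact: idl0.
by under eq_fun do rewrite big_cons; exact: idlD.
Qed.

Lemma Spq_entry_der p q i l x : cder (fun s => Spq p q s i l) x
  (- ad 0 i * Spq p.+1 q x i l + ad 0 l * Spq p q.+1 x i l +
   \sum_m (- ad 0 m) * (Spq p 0 x i m * Spq 0 q x m l)).
Proof.
apply: cder_eq (Spq_der p q x i l) _.
move: (Spq p.+1 q x) (Spq p q.+1 x) (Spq p 0 x) (Spq 0 q x) => T1 T2 T3 T4.
rewrite 2!mxDE 2!mxNE {1 2}aE diagmE mdiagE mulNr [ad 0 l * _]mulrC; congr (_ + _).
rewrite mxE -sumrN; apply: eq_bigr => m _.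
by rewrite aE mdiagE; ring.
Qed.

Lemma alg_der f : soliton_algebra f -> exists f', soliton_algebra f' /\ forall x, cder f x (f' x).
Proof.
elim=> [c|p q i l|f1 f2 a1 [g1 [b1 d1]] a2 [g2 [b2 d2]]|f1 f2 a1 [g1 [b1 d1]] a2 [g2 [b2 d2]]].
- by exists (fun _ => 0); split=> [|x]; [exact: alg_cst|exact: cder_cst].
- eexists; split; last by move=> x; exact: Spq_entry_der.
  apply: algD.
    apply: algD; (apply: algM; [exact: alg_cst|exact: alg_T]).
  apply: alg_sum => m; apply: algM; first exact: alg_cst.
  by apply: algM; exact: alg_T.
- by exists (fun x => g1 x + g2 x); split=> [|x]; [exact: algD|exact: cderD].
exists (fun x => g1 x * f2 x + f1 x * g2 x); split=> [|x]; last exact: cderM.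
by apply: algD; apply: algM.
Qed.

(** In the quadratic term of the derivative one of the two factors joins different
    eigenvalues of [a]. *)
Lemma idl_der f : soliton_ideal f -> exists f', soliton_ideal f' /\ forall x, cder f x (f' x).
Proof.
elim=> [|p q i l il|f1 f2 a1 [g1 [b1 d1]] a2 [g2 [b2 d2]]|f1 f2 a1 a2 [g2 [b2 d2]]].
- by exists (fun _ => 0); split=> [|x]; [exact: idl0|exact: cder_cst].
- eexists; split; last by move=> x; exact: Spq_entry_der.
  apply: idlD.
    apply: idlD; (apply: idlM; [exact: alg_cst|exact: idl_T]).
  apply: idl_sum => m; apply: idlM; first exact: alg_cst.
  have [im|im] := eqVneq (ad 0 i) (ad 0 m); last first.
    under eq_fun do rewrite mulrC.
    by apply: idlM; [exact: alg_T|exact: idl_T].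
  by apply: idlM; [exact: alg_T|apply: idl_T; rewrite -im].
- by exists (fun x => g1 x + g2 x); split=> [|x]; [exact: idlD|exact: cderD].
have [g1 [b1 d1]] := alg_der a1.
exists (fun x => g1 x * f2 x + f1 x * g2 x); split=> [|x]; last exact: cderM.
by apply: idlD; apply: idlM.
Qed.

Lemma alg_bdd sg f : `|sg| = 1 -> soliton_algebra f -> bdd sg f.
Proof.
move=> s1; elim=> [c|p q i l|f1 f2 _ b1 _ b2|f1 f2 _ b1 _ b2].
- exact: bdd_cst.
- by have [L [cL _]] := Spq_conv p q s1; exact: mconv_bdd cL i l.
- exact: bddD.
exact: bddM.
Qed.

Lemma idl_rapid sg f : `|sg| = 1 -> soliton_ideal f -> rapid sg f.
Proof.
move=> s1; elim=> [|p q i l il|f1 f2 _ b1 _ b2|f1 f2 b1 _ b2].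
- exact: rapid0.
- have [L [cL La]] := Spq_conv p q s1.
  have L0 : L i l = 0.
    have := congr1 (fun X : 'M[C]_n => X i l) La.
    rewrite mxDE mxNE aE diagmE mdiagE mx0E mulrC -mulrBl => /eqP.
    by rewrite mulf_eq0 subr_eq0 eq_sym (negPf il) /= => /eqP.
  by apply: rapid_ext (cL i l) => x; rewrite mxDE mxNE L0 subr0.
- exact: rapidD.
exact: rapidMr (alg_bdd s1 b1) b2.
Qed.

Lemma idl_iter (pr : C -> R) f : (pr = @complex.Re R \/ pr = @complex.Im R) ->
  soliton_ideal f -> forall m, exists g, soliton_ideal g /\ derive1n m (fun x => pr (f x)) = (fun x => pr (g x)).
Proof.
move=> prE fi; elim=> [|m [g [gi e]]]; first by exists f.
have [g' [gi' d]] := idl_der gi; exists g'; split=> //.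
rewrite derive1nS e; apply/funext => x.
have [dr di] := d x.
by case: prE => ->; rewrite derive1E; [case: dr|case: di].
Qed.

Lemma idl_schwartz (pr : C -> R) f : (pr = @complex.Re R \/ pr = @complex.Im R) ->
  soliton_ideal f -> schwartz_fun (fun x => pr (f x)).
Proof.
move=> prE fi; split=> [m x|k m].
  have [g [gi ->]] := idl_iter prE fi m.
  have [g' [_ d]] := idl_der gi; have [dr di] := d x.
  by case: prE => ->; [case: dr|case: di].
have [g [gi ->]] := idl_iter prE fi m.
have [B1 h1] : exists B : R, forall x, 0 <= 1 * x -> `|x| ^+ k * nrm (g x) <= B.
  by apply: (idl_rapid _ gi); rewrite normr1.
have [B2 h2] : exists B : R, forall x, 0 <= -1 * x -> `|x| ^+ k * nrm (g x) <= B.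
  by apply: (idl_rapid _ gi); rewrite normrN1.
exists (Num.max B1 B2) => x.
rewrite normrM normrX; apply: (@le_trans _ _ (`|x| ^+ k * nrm (g x))).
  rewrite ler_wpM2l ?exprn_ge0 //.
  by case: prE => ->; [exact: nrm_Re|exact: nrm_Im].
rewrite le_max; have [x0|x0] := leP 0 x.
  by rewrite h1 // mul1r.
by rewrite h2 ?orbT // mulN1r oppr_ge0 ltW.
Qed.

(** The trace of [[s, a] y] is that of [s [a, y]]. *)
Lemma commutator_U_perp W0 : nzcols W0 -> U_perp a (lie (Smx z W0 1%:M 1%:M) a).
Proof.
move=> Wnz; split.
  have := S_adj z_inj z_conj 1%:M 1%:M Wnz; rewrite adj1.
  move: (Smx _ _ _ _) => s su.
  by rewrite /u_alg /lie adjB !adjM su au mulmxN mulNmx opprK mulmxN mulNmx opprK opprB.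
move=> y _ ay; rewrite /lie mulmxBl raddfB /=.
move: (Smx _ _ _ _) => s.
have e : a *m y = y *m a by apply/eqP; rewrite -subr_eq0; apply/eqP.
by rewrite -mulmxA e -[in X in _ - X]mulmxA [X in _ - X]mxtrace_mulC -mulmxA subrr.
Qed.

(** The entry [(i, l)] of the solution is [ad l - ad i] times that of a sandwich. *)
Lemma soliton_schwartz : schwartz a (fun x => lie (Smx z (W x) 1%:M 1%:M) a).
Proof.
split; first by move=> x; apply: commutator_U_perp; exact: Wx_nz.
move=> i l.
have h : soliton_ideal (fun x => lie (Smx z (W x) 1%:M 1%:M) a i l).
  have e : (fun x => lie (Smx z (W x) 1%:M 1%:M) a i l) =
      (fun x => (ad 0 l - ad 0 i) * Spq 0 0 x i l).
    apply/funext => x; rewrite mxDE mxNE aE diagmE mdiagE mulrBl mulrC.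
    by rewrite /Spq !expr0.
  rewrite e; have [il|il] := eqVneq (ad 0 i) (ad 0 l).
    by rewrite il; under eq_fun do rewrite subrr mul0r; exact: idl0.
  by apply: idlM; [exact: alg_cst|exact: idl_T].
by split; apply: idl_schwartz h; [left|right].
Qed.

End Schwartz.

(** * Expansions at infinity *)

Section Expansions.
Context {R : realType} {n : nat}.
Local Notation C := R[i].
Implicit Types (f g : C -> 'M[C]_n) (c d : nat -> 'M[C]_n) (w y : C).

Definition bounded_infty f : Prop :=
  exists B : R, infty [set w | forall i j, nrm (f w i j) <= B].

(** An expansion given by all its remainders: the [K]-th one is
    [w^K (f w - sum_(k < K) w^-k c_k)], and each determines the next. In this
    form products need no rearrangement of double sums. *)
Definition expansion f c : Prop := exists F : nat -> C -> 'M[C]_n,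
  [/\ infty [set w | f w = F 0%N w],
      forall K, infty [set w | F K w = c K + w^-1 *: F K.+1 w] &
      forall K, bounded_infty (F K)].

Lemma bounded_inftyD f g : bounded_infty f -> bounded_infty g ->
  bounded_infty (fun w => f w + g w).
Proof.
move=> [B hB] [B' hB']; exists (B + B').
apply: filterS2 hB hB' => w h h' i j /=; rewrite mxDE.
exact: le_trans (nrmD _ _) (lerD (h i j) (h' i j)).
Qed.

Lemma bounded_inftyM f g : bounded_infty f -> bounded_infty g ->
  bounded_infty (fun w => f w *m g w).
Proof.
move=> [B hB] [B' hB']; exists (\sum_(k < n) `|B| * `|B'|).
apply: filterS2 hB hB' => w h h' i j /=; rewrite mxE.
apply: le_trans (nrm_sum _ _ _) _; apply: ler_sum => k _.
rewrite nrmM ler_pM ?nrm_ge0 //; first exact: le_trans (h i k) (ler_norm _).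
exact: le_trans (h' k j) (ler_norm _).
Qed.

Lemma bounded_infty_cst (A : 'M[C]_n) : bounded_infty (fun _ => A).
Proof.
exists (\sum_i \sum_j nrm (A i j)), 0 => w _ i j.
rewrite (bigD1 i) //= (bigD1 j) //= -addrA lerDl addr_ge0 // sumr_ge0 // => k _.
  exact: nrm_ge0.
by apply: sumr_ge0 => l _; exact: nrm_ge0.
Qed.

Lemma bounded_infty_sum (I : Type) (r : seq I) (G : I -> C -> 'M[C]_n) :
  (forall i, bounded_infty (G i)) -> bounded_infty (fun w => \sum_(i <- r) G i w).
Proof.
move=> h; elim: r => [|i r IH].
  by under eq_fun do rewrite big_nil; exact: bounded_infty_cst.
by under eq_fun do rewrite big_cons; exact: bounded_inftyD.
Qed.

Lemma bounded_infty_near f g : infty [set w | g w = f w] -> bounded_infty f ->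
  bounded_infty g.
Proof. by move=> h [B hB]; exists B; apply: filterS2 h hB => w /= ->. Qed.

Lemma expansion_near f g c : infty [set w | g w = f w] -> expansion f c ->
  expansion g c.
Proof.
move=> gf [F [f0 FS Fb]]; exists F; split=> //.
by apply: filterS2 gf f0 => w /= -> ->.
Qed.

(** The remainders are [sum_(i < K) c_i G_(K - i) + F_K G_0]. *)
Lemma expansionM f g c d : expansion f c -> expansion g d ->
  expansion (fun w => f w *m g w) (conv c d).
Proof.
move=> [F [f0 FS Fb]] [G [g0 GS Gb]].
exists (fun K w => \sum_(i < K) c i *m G (K - i)%N w + F K w *m G 0%N w); split.
- by apply: filterS2 f0 g0 => w /= -> ->; rewrite big_ord0 add0r.
- move=> K.
  have Gall : infty [set w | forall i, (i <= K)%N -> G i w = d i + w^-1 *: G i.+1 w].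
    elim: K => [|K IH].
      by apply: filterS (GS 0%N) => w h i; rewrite leqn0 => /eqP ->.
    apply: filterS2 IH (GS K.+1) => w h1 h2 i; rewrite leq_eqVlt => /orP[/eqP -> //|].
    by rewrite ltnS; apply: h1.
  apply: filterS2 (FS K) Gall => w /= FK hG.
  rewrite [conv c d K]/conv FK.
  have -> : \sum_(i < K) c i *m G (K - i)%N w =
      \sum_(i < K) (c i *m d (K - i)%N) + w^-1 *: \sum_(i < K) c i *m G (K.+1 - i)%N w.
    rewrite scaler_sumr -big_split /=; apply: eq_bigr => i _.
    by rewrite hG ?leq_subr // mulmxDr -scalemxAr subSn // ltnW.
  rewrite [in RHS]big_ord_recr /= [X in w^-1 *: (X + _)]big_ord_recr /= subnn subSnn.
  have e : c K *m G 0%N w = c K *m d 0%N + w^-1 *: (c K *m G 1%N w).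
    by rewrite hG // mulmxDr -scalemxAr.
  rewrite mulmxDl -scalemxAl e.
  move: (\sum_(i < K) _) (\sum_(i < K) _) (c K *m d 0%N) (c K *m G 1%N w)
    (F K.+1 w *m G 0%N w) => X1 X2 X3 X4 X5.
  by mxabel.
move=> K; apply: bounded_inftyD; last exact: bounded_inftyM (Fb K) (Gb 0%N).
by apply: bounded_infty_sum => i; exact: bounded_inftyM (bounded_infty_cst _) (Gb _).
Qed.

Lemma expansionMr f c (A : 'M[C]_n) : expansion f c ->
  expansion (fun w => f w *m A) (fun k => c k *m A).
Proof.
move=> [F [f0 FS Fb]]; exists (fun K w => F K w *m A); split.
- by apply: filterS f0 => w /= ->.
- by move=> K; apply: filterS (FS K) => w /= ->; rewrite mulmxDl -scalemxAl.
by move=> K; exact: bounded_inftyM (Fb K) (bounded_infty_cst A).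
Qed.

Lemma infty_neq y : infty [set w | w != y].
Proof. by exists (nrm y) => w; apply: contraTneq => ->; rewrite ltxx. Qed.

Lemma infty_forall (I : finType) (P : I -> C -> Prop) :
  (forall i, infty [set w | P i w]) -> infty [set w | forall i, P i w].
Proof.
move=> /choice[r hr]; exists (\sum_i `|r i|) => w wr i; apply: hr.
apply: le_lt_trans wr; rewrite (bigD1 i) //=.
by apply: le_trans (ler_norm _) _; rewrite lerDl sumr_ge0.
Qed.

Lemma mtends_bounded f (L : 'M[C]_n) : mtends infty f L -> bounded_infty f.
Proof.
move=> h; have h1 : infty [set w | forall i j, nrm (f w i j - L i j) < 1].
  apply: infty_forall => i; apply: infty_forall => j.
  by have /tendsP := h i j; apply.
have [B hB] := bounded_infty_cst L; exists (1 + B).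
apply: filterS2 h1 hB => w h1 hB i j /=; rewrite -[f w i j](subrK (L i j)).
by apply: le_trans (nrmD _ _) (lerD (ltW (h1 i j)) (hB i j)).
Qed.

(** The remainders are explicit because [w / (w - y) = 1 + w^-1 (y w / (w - y))]. *)
Lemma expansion_pf N (A0 : 'M[C]_n) (A : 'I_N -> 'M[C]_n) (y : 'I_N -> C) :
  expansion (fun w => A0 + \sum_k (w - y k)^-1 *: A k)
    (fun K => if K is K'.+1 then \sum_k y k ^+ K' *: A k else A0).
Proof.
exists (fun K w => if K is K'.+1 then
  \sum_k (y k ^+ K' * (w / (w - y k))) *: A k else
  A0 + \sum_k (w - y k)^-1 *: A k); split.
- by exists 0.
- have w0 := infty_neq 0.
  have wy : infty [set w | forall k, w != y k].
    by apply: infty_forall => k; exact: infty_neq.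
  move=> K; apply: filterS2 w0 wy => w /= w0 wy.
  case: K => [|K] /=.
    congr (_ + _); rewrite scaler_sumr; apply: eq_bigr => k _; rewrite scalerA.
    by rewrite expr0 mul1r mulrA mulVf // mul1r.
  rewrite scaler_sumr -big_split /=; apply: eq_bigr => k _.
  rewrite scalerA -scalerDl; congr (_ *: _); rewrite exprS.
  have d1 : w - y k != 0 by rewrite subr_eq0.
  by field; rewrite w0 d1.
case=> [|K]; first by apply: mtends_bounded (mtends_pf A0 A y).
have h := mtends_pf (\sum_k y k ^+ K *: A k) (fun k => y k ^+ K.+1 *: A k) y.
apply: bounded_infty_near (mtends_bounded h).
have wy : infty [set w | forall k, w != y k].
  by apply: infty_forall => k; exact: infty_neq.
apply: filterS wy => w wy /=; rewrite -big_split /=; apply: eq_bigr => k _.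
rewrite scalerA -scalerDl; congr (_ *: _); rewrite exprS.
have d1 : w - y k != 0 by rewrite subr_eq0.
by field; rewrite d1.
Qed.

Lemma expansion_asymptotic f c : expansion f c -> asymptotic f c.
Proof.
move=> [F [f0 FS Fb]] K.
have rem q : infty [set w | f w = \sum_(k < q) w ^- k *: c k + w ^- q *: F q w].
  elim: q => [|q IH].
    by apply: filterS f0 => w /= ->; rewrite big_ord0 add0r expr0 invr1 scale1r.
  apply: filterS2 IH (FS q) => w /= -> ->.
  rewrite big_ord_recr /= scalerDr scalerA addrA; congr (_ + _ *: _).
  by rewrite exprSr invfM.
have [B hB] := Fb K.+1.
have [r hr] := filterI (filterI (rem K.+1) hB) (infty_neq 0).
exists B, r => w _; rewrite nrmE ltcR => /hr[[/= -> h] w0] i j.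
rewrite addrC addKr mxZE !nrmE nrmM nrmV nrmX -rmorphXn -fmorphV -rmorphM /=.
by rewrite lecR mulrC ler_wpM2r ?invr_ge0 ?exprn_ge0 ?nrm_ge0 ?h.
Qed.

End Expansions.

(** * The reduced wave function of a soliton *)

Section Holomorphy.
Context {R : realType} {n : nat}.
Local Notation C := R[i].
Implicit Types (f g : C -> 'M[C]_n) (w : C).

Lemma holomorphic_atP f w : holomorphic_at f w <-> \forall s \near (w : C^o), mdiff f s.
Proof.
by split; apply: filterS => s h i j; [apply/cdiffP; exact: h|have /cdiffP := h i j].
Qed.

Lemma holomorphic_entire f w : (forall s, mdiff f s) -> holomorphic_at f w.
Proof. by move=> h; apply/holomorphic_atP; apply: filterE. Qed.

Lemma holomorphic_mdiff f w : holomorphic_at f w -> mdiff f w.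
Proof. by move=> /holomorphic_atP; exact: nbhs_singleton. Qed.

Lemma dnear_near (P : C -> Prop) w : (\forall s \near (w : C^o)^', P s) -> P w ->
  \forall s \near (w : C^o), P s.
Proof.
move=> /dnear_nrm[r r0 h] Pw; apply/near_nrm; exists r => // s sw.
by have [->|/h] := eqVneq s w; last exact.
Qed.

Lemma holomorphicM f g w : holomorphic_at f w -> holomorphic_at g w ->
  holomorphic_at (fun s => f s *m g s) w.
Proof.
move=> /holomorphic_atP fh /holomorphic_atP gh; apply/holomorphic_atP.
by apply: filterS2 fh gh => s; exact: mdiffM.
Qed.

Lemma meromorphicM f g w : meromorphic_at f w -> meromorphic_at g w ->
  meromorphic_at (fun s => f s *m g s) w.
Proof.
move=> [m [h [hh fE]]] [m' [h' [hh' gE]]]; exists (m + m')%N, (fun s => h s *m h' s).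
split; first exact: holomorphicM.
apply: filterS2 fE gE => s /= -> ->.
by rewrite -scalemxAl -scalemxAr scalerA -invfM -exprD.
Qed.

(** The poles are simple, so one factor [s - w] suffices at every point. *)
Lemma meromorphic_pf N (A0 : 'M[C]_n) (A : 'I_N -> 'M[C]_n) (y : 'I_N -> C) w :
  meromorphic_at (fun s => A0 + \sum_k (s - y k)^-1 *: A k) w.
Proof.
pose r k s := if y k == w then 1 else (s - w) / (s - y k).
exists 1%N, (fun s => (s - w) *: A0 + \sum_k r k s *: A k); split.
  apply/holomorphic_atP.
  have : \forall s \near (w : C^o), forall k, y k != w -> s != y k.
    apply: dnear_near => [|k]; last by rewrite eq_sym.
    have := dnear_finite w [seq y k | k <- enum 'I_N].
    apply: filterS => s /negP h k _; apply/eqP => e; apply: h.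
    by rewrite e map_f // mem_enum.
  apply: filterS => s hs; apply: mdiffD.
    by apply: mdiffZ (mdiff_cst _ _); apply: cdiffB; [exact: cdiff_id|exact: cdiff_cst].
  apply: mdiff_sum => k _; apply: mdiffZ (mdiff_cst _ _); rewrite /r.
  have [_|ykw] := eqVneq (y k) w; first exact: cdiff_cst.
  apply: cdiffM; first by apply: cdiffB; [exact: cdiff_id|exact: cdiff_cst].
  apply: cdiffV; first by rewrite subr_eq0 hs.
  by apply: cdiffB; [exact: cdiff_id|exact: cdiff_cst].
have := dnear_finite w [:: w]; apply: filterS => s; rewrite inE => sw.
have d : s - w != 0 by rewrite subr_eq0.
rewrite expr1 scalerDr scalerA mulVf // scale1r; congr (_ + _).
rewrite scaler_sumr; apply: eq_bigr => k _; rewrite scalerA /r; congr (_ *: _).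
have [->|_] := eqVneq (y k) w; first by rewrite mulr1.
by rewrite mulrA mulVf // mul1r.
Qed.

Lemma rapid_tends (f : R -> C) : rapid (-1) f -> tends (ninfty_nbhs R) f 0.
Proof.
move=> /(_ 1%N)[B hB]; apply/tendsP => e e0.
near=> x; rewrite subr0.
have x0 : x < 0 by near: x; exact: nbhs_ninfty_lt.
have xB : x < - (B / e) by near: x; apply: nbhs_ninfty_lt; rewrite num_real.
have := hB x; rewrite mulN1r oppr_ge0 ltW // => /(_ isT).
rewrite expr1 ltr0_norm // => h.
have x1 : 0 < - x by rewrite oppr_gt0.
rewrite -(ltr_pM2l x1); apply: le_lt_trans h _.
by rewrite -ltr_pdivrMr // ltrNr.
Unshelve. all: by end_near.
Qed.

End Holomorphy.

Section ReducedWave.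
Context {R : realType} {n N : nat}.
Local Notation C := R[i].
Variables (z : 'I_N -> C) (z_inj : injective z) (z_conj : forall m k, z m != (z k)^*).
Variables (a : 'M[C]_n) (ad : 'rV[C]_n) (U : 'M[C]_(n, N)).
Hypotheses (aE : a = diag_mx ad) (au : u_alg a) (Unz : nzcols U).
Implicit Types (x : R) (w : C).
Local Notation W := (Wx z ad U).
Local Notation Wi := (Winf z ad (-1) Unz).
Local Notation rc x := ((x%:C)%C : C).

Lemma expmx_diag w : expmx (w *: a) = diag_mx (\row_i cexp (w * ad 0 i)).
Proof.
have e : w *: a = invmx 1%:M *m diag_mx (\row_i (w * ad 0 i)) *m 1%:M.
  rewrite invmx1 mul1mx mulmx1 aE; apply/matrixP => i k.
  by rewrite mxZE !mxE mulrnAr.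
rewrite e expmx_similar ?unitmx1 // invmx1 mul1mx mulmx1; congr diag_mx.
by apply/rowP => i; rewrite !mxE.
Qed.

Lemma Wx_exp x : W x = \matrix_(i, k) (expmx (- ((z k)^* * rc x) *: a) *m col k U) i 0.
Proof.
apply/matrixP => i k; rewrite [LHS]mxE [RHS]mxE expmx_diag diagmE !mxE.
by congr (cexp _ * _); ring.
Qed.

Lemma comm_expmx (X : 'M[C]_n) w : lie X a = 0 ->
  expmx (w *: a) *m X = X *m expmx (w *: a).
Proof.
move=> Xa; rewrite expmx_diag; apply/matrixP => i l; rewrite diagmE mdiagE !mxE.
have := congr1 (fun Y : 'M[C]_n => Y i l) Xa.
rewrite mxDE mxNE aE diagmE mdiagE mx0E mulrC -mulrBl => /eqP.
rewrite mulf_eq0 => /orP[|/eqP ->]; last by rewrite mulr0 mul0r.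
by rewrite subr_eq0 => /eqP ->; rewrite mulrC.
Qed.

(** The left factor is constant in [x] and commutes with [a]. It normalizes the wave
    function at [x = -oo], where [ginv z (W x)] tends to the inverse of this factor. *)
Definition mu x w : 'M[C]_n := gsol z Wi w *m ginv z (W x) w.

Definition mu_coef k x : 'M[C]_n := conv (Gs z Wi) (Gi z (W x)) k.

Lemma Wi_nz : nzcols Wi. Proof. exact: Winf_nz. Qed.
Lemma Wx_curve_nz x : nzcols (W x). Proof. exact: Wx_nz. Qed.

Lemma Gs_expansion (Y : 'M[C]_(n, N)) : expansion (gsol z Y) (Gs z Y).
Proof.
have := expansion_pf 1%:M (Pk z Y) z.
have -> : (fun K => if K is K'.+1 then \sum_k z k ^+ K' *: Pk z Y k else 1%:M) = Gs z Y.
  apply/funext => -[|K] //=; rewrite diag_exp diag_delta S_sumr.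
  by apply: eq_bigr => k _; rewrite !mxE (SZr z).
by apply: expansion_near; exists 0 => w _ /=; rewrite gsolE.
Qed.

Lemma Gi_expansion (Y : 'M[C]_(n, N)) : expansion (ginv z Y) (Gi z Y).
Proof.
have := expansion_pf 1%:M (fun k => - Bk z Y k) (fun k => (z k)^*).
have -> : (fun K => if K is K'.+1 then \sum_k (z k)^* ^+ K' *: - Bk z Y k else 1%:M)
    = Gi z Y.
  apply/funext => -[|K] //=; rewrite diag_exp diag_delta S_suml -sumrN.
  by apply: eq_bigr => k _; rewrite !mxE (SZl z) scalerN.
apply: expansion_near; exists 0 => w _ /=; rewrite ginvE -sumrN; congr (_ + _).
by apply: eq_bigr => k _; rewrite scalerN.
Qed.

Lemma gs_inf_comm w : lie (gsol z Wi w) a = 0.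
Proof.
have h := S_inf_comm z_inj z_conj (-1) aE au Unz (const_mx 1) (\row_k (w - z k)^-1).
rewrite diag_const_mx in h.
rewrite /lie mulmxDl mulmxDr mul1mx mulmx1 opprD addrACA subrr add0r.
exact: h.
Qed.

Lemma mu_unit x w : (forall k, w != z k) -> (forall k, w != (z k)^*) ->
  mu x w \in unitmx /\ invmx (mu x w) = gsol z (W x) w *m ginv z Wi w.
Proof.
move=> w1 w2.
have e1 := gsgi z_inj z_conj Wi_nz w1 w2.
have e2 := gigs z_inj z_conj (Wx_curve_nz x) w1 w2.
have e : mu x w *m (gsol z (W x) w *m ginv z Wi w) = 1%:M.
  rewrite /mu; move: (gsol z Wi w) (ginv z Wi w) e1 (gsol z (W x) w) (ginv z (W x) w) e2.
  move=> p p' e1 q q' e2; transitivity (p *m (q' *m q) *m p'); first by rewrite !mulmxA.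
  by rewrite e2 mulmx1.
have [mu1 _] := mulmx1_unit e; split=> //.
by rewrite -[RHS](mulKmx mu1) e mulmx1.
Qed.

(** Matrices that commute with the normalizing factor do not see it. *)
Lemma mu_similarity (X : 'M[C]_n) x y w : (forall k, w != z k) -> (forall k, w != (z k)^*) ->
  X *m gsol z Wi w = gsol z Wi w *m X ->
  invmx (mu y w) *m X *m mu x w = gsol z (W y) w *m X *m ginv z (W x) w.
Proof.
move=> w1 w2 Xg; have [_ ->] := mu_unit y w1 w2.
have e1 := gigs z_inj z_conj Wi_nz w1 w2; rewrite /mu.
move: (gsol z Wi w) (ginv z Wi w) e1 Xg (gsol z (W y) w) (ginv z (W x) w).
move=> p p' e1 Xg q q'.
transitivity (q *m p' *m (X *m p) *m q'); first by rewrite !mulmxA.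
rewrite Xg; transitivity (q *m (p' *m p) *m X *m q'); first by rewrite !mulmxA.
by rewrite e1 mulmx1.
Qed.

Lemma mu_coef1 x : lie a (mu_coef 1 x) = lie (Smx z (W x) 1%:M 1%:M) a.
Proof.
rewrite /mu_coef /conv !big_ord_recl big_ord0 addr0 /= mulmx1 mul1mx !expr0.
have h := S_inf_comm z_inj z_conj (-1) aE au Unz (const_mx 1) (const_mx 1).
rewrite !diag_const_mx in h.
change (lie a (- Smx z (W x) 1%:M 1%:M + Smx z Wi 1%:M 1%:M) =
  lie (Smx z (W x) 1%:M 1%:M) a).
move: (Smx z (W x) _ _) (Smx z Wi _ _) h => s s' h.
have e : s' *m a = a *m s' by apply/eqP; rewrite -subr_eq0; apply/eqP.
rewrite /lie mulmxDr mulmxDl e mulmxN mulNmx opprD opprK addrACA subrr addr0.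
by rewrite addrC.
Qed.

Lemma mdiff_mu x w : (forall k, w != z k) -> (forall k, w != (z k)^*) -> mdiff (mu x) w.
Proof.
move=> w1 w2; apply: mdiffM.
  apply: mdiff_ext (mdiff_pf 1%:M (Pk z Wi) (P := predT) (fun k _ => w1 k)) => s.
  by rewrite gsolE.
have := mdiff_pf 1%:M (fun k => - Bk z (W x) k) (P := predT) (fun k _ => w2 k).
apply: mdiff_ext => s; rewrite ginvE -sumrN; congr (_ + _).
by apply: eq_bigr => k _; rewrite scalerN.
Qed.

Lemma mu_lim w : mtends (ninfty_nbhs R) (mu^~ w) (gsol z Wi w *m ginv z Wi w).
Proof.
have sg1 : `|-1 : R| = 1 by rewrite normrN1.
have h := S_conv z_inj z_conj aE au Unz sg1 (\row_k (w - (z k)^*)^-1) (const_mx 1).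
rewrite diag_const_mx in h.
apply: mtendsM; first exact: mtends_cst.
move=> i j; have := tendsD (tends_cst (ginv z Wi w i j)) (tendsN (rapid_tends (h i j))).
rewrite oppr0 addr0 => h2; have FF : Filter (ninfty_nbhs R) by exact: _.
apply: (tends_ext _ (h2 FF FF FF)) => x.
have e Y : ginv z Y w i j = (1%:M : 'M[C]_n) i j - Smx z Y (Rc z w) 1%:M i j.
  by rewrite mxDE mxNE.
rewrite !e mxDE mxNE; move: (Smx z (W x) _ _ i j) (Smx z Wi _ _ i j) => s s'.
by rewrite opprD opprK addrACA addrA subrK.
Qed.

Section Wave.
Variable H : R -> C -> 'M[C]_n.
Hypotheses (Hd : forall x w, mdiff (H x) w) (Hu : forall x w, H x w \in unitmx)
  (Hx : forall x w, mder (H^~ w) x (H x w *m (w *: a + lie (Smx z (W x) 1%:M 1%:M) a)))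
  (HE : forall x w, (forall k, w != z k) -> (forall k, w != (z k)^*) ->
    H x w = gsol z (W 0) w *m expmx ((w * rc x) *: a) *m ginv z (W x) w).

(** The normalizing factor also cancels in [mu(0)^-1 e^(a w x) mu(x)], which is [H]. *)
Lemma mu_reduced_wave : reduced_wave a (fun x => lie (Smx z (W x) 1%:M 1%:M) a) mu.
Proof.
exists mu_coef, [set w | w \in zlist z], H.
have off w : ~ [set w | w \in zlist z] w ->
    (forall k, w != z k) /\ (forall k, w != (z k)^*).
  by move=> /negP; exact: zlistP.
have comm w c : expmx (c *: a) *m gsol z Wi w = gsol z Wi w *m expmx (c *: a).
  exact: comm_expmx (gs_inf_comm w).
split.
- move=> x; split; last by rewrite mu_coef1.
    by apply: expansion_asymptotic; exact: expansionM (Gs_expansion _) (Gi_expansion _).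
  by rewrite /mu_coef /conv big_ord_recl big_ord0 addr0 /= mulmx1.
- split=> [w _|x w _].
    by have := dnear_finite w (zlist z); apply: filterS => s /negP.
  apply: meromorphicM.
    rewrite (_ : gsol z Wi = fun s => 1%:M + \sum_k (s - z k)^-1 *: Pk z Wi k).
      exact: meromorphic_pf.
    by apply/funext => s; rewrite gsolE.
  rewrite (_ : ginv z (W x) = fun s => 1%:M + \sum_k (s - (z k)^*)^-1 *: - Bk z (W x) k).
    exact: meromorphic_pf.
  apply/funext => s; rewrite ginvE -sumrN; congr (_ + _).
  by apply: eq_bigr => k _; rewrite scalerN.
- move=> w _ wZ x; have [w1 w2] := off w wZ; split.
  + apply/holomorphic_atP.
    have h : \forall s \near (w : C^o), s \notin zlist z.
      by apply: dnear_near; [exact: dnear_finite|apply/negP].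
    by apply: filterS h => s /zlistP[s1 s2]; exact: mdiff_mu.
  + by have [] := mu_unit x w1 w2.
  by rewrite (mu_similarity _ _ w1 w2 (comm w _)) HE.
- move=> w _ wZ i j; have [w1 w2] := off w wZ.
  by have := mu_lim w i j; rewrite (gsgi z_inj z_conj Wi_nz w1 w2); case.
move=> x w; split; first exact: holomorphic_entire (Hd x).
  exact: Hu.
exact: mder_is_mderive (Hx x w).
Qed.

(** The normalizing factor commutes with [a], hence with [b], so that the
    coefficients are those of [g~ b g~^-1]. *)
Lemma soliton_Qcoeffs b : (forall X : 'M[C]_n, lie X a = 0 -> lie b X = 0) ->
  Qcoeffs a b (fun x => lie (Smx z (W x) 1%:M 1%:M) a) (fun k x => Qc z b (W x) k).
Proof.
move=> hb; exists mu; split; first exact: mu_reduced_wave.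
move=> x; apply: expansion_asymptotic.
have := expansionM (expansionMr b (Gs_expansion (W x))) (Gi_expansion (W x)).
apply: expansion_near.
have h : infty [set w | (forall k, w != z k) /\ (forall k, w != (z k)^*)].
  by apply: filterI; apply: infty_forall => k; exact: infty_neq.
apply: filterS h => w [w1 w2] /=; apply: mu_similarity => //.
by apply/eqP; rewrite -subr_eq0; apply/eqP; exact: hb (gs_inf_comm w).
Qed.

End Wave.
End ReducedWave.

(** A matrix is a combination of two skew-Hermitian ones, which commute with [a]
    when it does. *)
Lemma centralizer_complex {R : realType} {n : nat} (a b : 'M[R[i]]_n) : u_alg a ->
  (forall y, u_alg y -> lie a y = 0 -> lie b y = 0) ->
  forall X, lie X a = 0 -> lie b X = 0.
Proof.
move=> au h X Xa.
have linD (c Y Y' : 'M[R[i]]_n) : lie c (Y + Y') = lie c Y + lie c Y'.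
  by rewrite /lie mulmxDr mulmxDl opprD addrACA.
have linZ (c Y : 'M[R[i]]_n) s : lie c (s *: Y) = s *: lie c Y.
  by rewrite /lie -scalemxAr -scalemxAl scalerBr.
have linN (c Y : 'M[R[i]]_n) : lie c (- Y) = - lie c Y.
  by rewrite -scaleN1r linZ scaleN1r.
have aX : lie a X = 0 by rewrite /lie -opprB -/(lie X a) Xa oppr0.
have aX' : lie a (X ^t*) = 0.
  have := congr1 (fun Y => Y ^t*) Xa.
  rewrite adj0 /lie adjB !adjM au mulNmx mulmxN opprK addrC => e.
  by rewrite -opprB e oppr0.
have h1 : lie b (X - X ^t*) = 0.
  apply: h; first by rewrite /u_alg adjB adjK opprB.
  by rewrite linD linN aX aX' subrr.
have h2 : lie b ('i%C *: (X + X ^t*)) = 0.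
  apply: h; last by rewrite linZ linD aX aX' addr0 scaler0.
  rewrite /u_alg adjZ adjD adjK addrC -scaleNr; congr (_ *: _).
  by apply/eqP; rewrite eq_complex /= oppr0 !eqxx.
have i0 : 'i%C != 0 :> R[i] by rewrite eq_complex /= oner_eq0 andbF.
have h3 : lie b (X + X ^t*) = 0.
  by apply/eqP; have /eqP := h2; rewrite linZ scaler_eq0 (negPf i0).
have : lie b ((X - X ^t*) + (X + X ^t*)) = 0 by rewrite linD h1 h3 addr0.
rewrite addrACA [- _ + _]addrC subrr addr0 linD -mulr2n => /eqP.
by rewrite -scaler_nat scaler_eq0 pnatr_eq0 /= => /eqP.
Qed.

(** * The N-soliton *)

Section Soliton.
Context {R : realType} {n N : nat}.
Local Notation C := R[i].
Variables (z : 'I_N -> C) (z_inj : injective z) (z_conj : forall m k, z m != (z k)^*).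
Variables (a b P : 'M[C]_n) (ad da db : 'rV[C]_n) (j : nat).
Hypotheses (au : u_alg a) (bu : u_alg b) (Pu : P \in unitmx)
  (aE : a = invmx P *m diag_mx da *m P) (bE : b = invmx P *m diag_mx db *m P)
  (a_diag : a = diag_mx ad) (ab : lie a b = 0).
Variable V : 'M[C]_(n, N).
Hypothesis Vnz : nzcols V.
Implicit Types (x t : R) (w : C).
Local Notation rc x := ((x%:C)%C : C).
Local Notation Wt := (Wxt z P da db j).
Local Notation W := (Wt V).
Local Notation E := (Et z P da db j V).

Definition soliton x t : 'M[C]_n := lie (Smx z (W x t) 1%:M 1%:M) a.

Lemma expmx_ev0 w : expmx (w *: a) = ev P da db w 0.
Proof. by have := expmx_ev Pu aE bE w 0; rewrite scale0r addr0. Qed.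

Lemma W00 (V' : 'M[C]_(n, N)) : Wt V' 0 0 = V'.
Proof.
apply/matrixP => i k; rewrite mxE !mulr0 oppr0 (ev0 da db Pu) mul1mx.
by rewrite mxE.
Qed.

Lemma W_comp (V' : 'M[C]_(n, N)) x t : Wt V' x t = Wx z ad (Wt V' 0 t) x.
Proof.
have e k : col k (Wt V' x t) = expmx (- ((z k)^* * rc x) *: a) *m col k (Wt V' 0 t).
  have eM c d c' d' (y : 'cV[C]_n) :
    ev P da db c d *m (ev P da db c' d' *m y) = ev P da db (c + c') (d + d') *m y.
    by rewrite (evD da db Pu) mulmxA.
  have := W_col z P da db j V' 0 t k; have := W_col z P da db j V' x t k.
  move: (Wt V' x t) (Wt V' 0 t) => A B -> ->; rewrite expmx_ev0.
  rewrite [RHS]eM.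
  have s1 (c : C) : c = c + - ((z k)^* * rc 0) by rewrite (_ : rc 0 = 0) // mulr0 subr0.
  exact: (congr2 (fun c d => ev P da db c d *m col k V') (s1 _) (esym (add0r _))).
rewrite (Wx_exp _ _ a_diag); apply/matrixP => i k; rewrite [RHS]mxE -e.
by rewrite [RHS]mxE.
Qed.

Lemma W_restart t x : Wt (W 0 t) x 0 = Wx z ad (W 0 t) x.
Proof. by rewrite W_comp W00. Qed.

Lemma solitonE t : soliton^~ t = fun x => lie (Smx z (Wx z ad (W 0 t) x) 1%:M 1%:M) a.
Proof. by apply/funext => x; rewrite /soliton W_comp. Qed.

Let V0nz t : nzcols (W 0 t).
Proof. exact: (W_nz z da db j Pu Vnz). Qed.

Lemma soliton_decay t : schwartz a (soliton^~ t).
Proof. by rewrite solitonE; exact: (soliton_schwartz z_inj z_conj a_diag au (V0nz t)). Qed.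

(** The trivialization started at time [t] from the columns [W 0 t] is the
    entire function required of a reduced wave function. *)
Lemma soliton_Q : (forall X : 'M[C]_n, lie X a = 0 -> lie b X = 0) ->
  forall t, Qcoeffs a b (soliton^~ t) (fun k x => Qc z b (W x t) k).
Proof.
move=> hb t; rewrite solitonE.
have -> : (fun k x => Qc z b (W x t) k) =
    (fun k x => Qc z b (Wx z ad (W 0 t) x) k).
  by apply/funext => k; apply/funext => x; rewrite W_comp.
apply: (soliton_Qcoeffs z_inj z_conj a_diag au (V0nz t)
  (H := fun x w => Et z P da db j (W 0 t) x 0 w)) hb.
- move=> x w; exact: (mdiff_Et z_inj z_conj j au Pu aE bE (V0nz t) x 0 w).
- move=> x w; exact: (Et_unit z_inj z_conj j au bu Pu aE bE (V0nz t)).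
- move=> x w; rewrite -W_restart.
  exact: (Et_xder z_inj z_conj j au bu Pu aE bE (V0nz t)).
move=> x w w1 w2.
have e0 : Wx z ad (W 0 t) 0 = W 0 t by rewrite -W_restart W00.
rewrite e0 expmx_ev0 -(W_restart t x).
apply: etrans (Et_generic z_inj z_conj j au bu Pu aE bE (V0nz t) x 0 w1 w2) _.
exact: (congr1 (fun d => gsol z (W 0 t) w *m ev P da db (w * rc x) d *m
  ginv z (Wt (W 0 t) x 0) w) (mulr0 _)).
Qed.

Lemma soliton_jflow : (forall X : 'M[C]_n, lie X a = 0 -> lie b X = 0) ->
  jflow_solution a b j soliton.
Proof.
move=> hb; split; first exact: soliton_decay.
exists (fun k x t => Qc z b (W x t) k); split; first exact: soliton_Q.
move=> x t; exists (lie (Qc z b (W x t) j.+1) a - lie (soliton x t) (Qc z b (W x t) j)).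
  apply: mder_is_mderive.
  apply: (Q_xflow z_inj z_conj au (fun s => W_nz z da db j Pu Vnz s t) _ j ab).
  exact: (W_xflow z j Pu aE bE V x t).
rewrite subrK; apply: mder_is_mderive.
apply: (u_flow z_inj z_conj a bu (fun s => W_nz z da db j Pu Vnz x s)).
exact: (W_tflow z j Pu aE bE V x t).
Qed.

Lemma soliton_trivialization : (forall X : 'M[C]_n, lie X a = 0 -> lie b X = 0) ->
  trivialization a b j soliton E.
Proof.
move=> hb; exists (fun k x t => Qc z b (W x t) k); split; first exact: soliton_Q.
move=> w; split=> [|x t|x t].
- apply: (@mdiff_eq_off R n n (E 0 0) (fun _ => 1%:M)).
  + exact: (mdiff_Et z_inj z_conj j au Pu aE bE Vnz 0 0 w).
  + exact: mdiff_cst.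
  apply: cofin_near; apply: cofin_impl (cofin_z z) => s [s1 s2].
  rewrite (Et_generic z_inj z_conj j au bu Pu aE bE Vnz) // W00 /Mv !mulr0.
  rewrite (ev0 da db Pu) mulmx1.
  exact: (gsgi z_inj z_conj Vnz s1 s2).
- apply: mder_is_mderive.
  exact: (Et_xder z_inj z_conj j au bu Pu aE bE Vnz).
apply: mder_is_mderive.
apply: mder_eq; first exact: (Et_tder z_inj z_conj j au bu Pu aE bE Vnz).
congr (_ *m _); rewrite /Vw -(big_mkord predT (fun k => w ^+ (j - k) *: Qc z b (W x t) k)).
by rewrite big_ltn // subn0 Qc0.
Qed.

Lemma sum_Pk (U : 'M[C]_(n, N)) : \sum_k Pk z U k = Smx z U 1%:M 1%:M.
Proof.
rewrite -S_sumr; congr Smx; rewrite -diag_const_mx diag_delta.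
by apply: eq_bigr => k _; rewrite mxE scale1r.
Qed.

Lemma Pk_adj (U : 'M[C]_(n, N)) k : nzcols U -> (Pk z U k) ^t* = - Bk z U k.
Proof.
move=> Unz; have := S_adj z_inj z_conj 1%:M (delta_mx k k) Unz; rewrite adj1.
have -> : (delta_mx k k : 'M[C]_N) ^t* = delta_mx k k; last by [].
by apply/matrixP => i l; rewrite adjE mxE [RHS]mxE rmorph_nat andbC.
Qed.

Section Formulas.
Variable v : 'I_N -> 'cV[C]_n.
Hypothesis Vv : forall k, col k V = v k.

Lemma soliton_FE x t : soliton_F a b j z v x t = FW z (W x t).
Proof.
apply/matrixP => m k; rewrite FWE mxE; congr (_ / _).
have -> : ((W x t) ^t* *m W x t) m k = ((col m (W x t)) ^t* *m col k (W x t)) 0 0.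
  by rewrite mxE [RHS]mxE; apply: eq_bigr => l _; rewrite !adjE !mxE.
rewrite (W_adj z j au bu Pu aE bE) W_col !Vv (expmx_ev Pu aE bE).
have -> : ev P da db ((z m - (z k)^*) * rc x) ((z m ^+ j - (z k)^* ^+ j) * rc t) =
    Mv P da db j (rc x) (rc t) (z m) *m
    ev P da db (- ((z k)^* * rc x)) (- ((z k)^* ^+ j * rc t)).
  by rewrite /Mv -(evD da db Pu) -!mulrBl.
move: (Mv _ _ _ _ _ _ _) (ev _ _ _ _ _) ((v m) ^t*) (v k) => X Y r c.
by congr (fun_of_matrix _ 0 0); rewrite !mulmxA.
Qed.

Lemma expmx_col x t k :
  expmx (- (((z k)^* * rc x) *: a + ((z k)^* ^+ j * rc t) *: b)) *m v k = col k (W x t).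
Proof.
rewrite W_col Vv; congr (_ *m _); rewrite opprD -!scaleNr.
exact: (expmx_ev Pu aE bE).
Qed.

Lemma soliton_PE k x t : soliton_P a b j z v k x t = Pk z (W x t) k.
Proof.
rewrite /soliton_P soliton_FE PkE (W_adj z j au bu Pu aE bE) Vv (expmx_ev Pu aE bE).
congr (_ *m _); apply/matrixP => i l.
rewrite summxE [RHS]mxE mxE; apply: eq_bigr => m _.
rewrite expmx_col; move: (W x t) (invmx _) => A F.
by rewrite mxZE mulrC ord1 mxE.
Qed.

Lemma soliton_formula x t : soliton x t = \sum_k lie (soliton_P a b j z v k x t) a.
Proof.
under eq_bigr do rewrite soliton_PE.
by rewrite /lie sumrB -mulmx_suml -mulmx_sumr sum_Pk.
Qed.

(** The adjoints of the [P_k] are the residues of [ginv]. *)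
Lemma trivialization_formula x t w :
  (forall k, w != z k) -> (forall k, w != (z k)^*) ->
  E x t w = gsol z V w *m vacuum a b j x t w *m
    (1%:M + \sum_k (w - (z k)^*)^-1 *: (soliton_P a b j z v k x t) ^t*).
Proof.
move=> w1 w2; rewrite (Et_generic z_inj z_conj j au bu Pu aE bE Vnz) //.
rewrite /vacuum (expmx_ev Pu aE bE) ginvE; congr (_ *m _).
congr (_ + _); rewrite -sumrN; apply: eq_bigr => k _.
by rewrite soliton_PE Pk_adj ?scalerN //; exact: (W_nz z da db j Pu Vnz).
Qed.

End Formulas.

Section Dressed.
Variable g : C -> 'M[C]_n.
Hypotheses (gG : G_minus g) (g_pole : forall w, pole g w <-> exists k, w = z k)
  (gE : forall w, (forall k, w != z k) -> g w = gsol z V w).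

Let off_pole w : ~ pole g w -> forall k, w != z k.
Proof. by move=> gw k; apply/eqP => wk; apply: gw; apply/g_pole; exists k. Qed.

Lemma soliton_dressed : dressed a g (vacuum a b j) soliton E.
Proof.
exists (fun x t => gsol z (W x t)); split.
- by move=> x t; apply: (gs_G_minus z_inj z_conj); exact: (W_nz z da db j Pu Vnz).
- move=> x t w; split.
  + apply: holomorphic_entire => s.
    exact: (mdiff_Et z_inj z_conj j au Pu aE bE Vnz x t s).
  + exact: (Et_unit z_inj z_conj j au bu Pu aE bE Vnz).
  exact: (Et_unitary z_inj z_conj j au bu Pu aE bE Vnz).
- move=> x t w /off_pole wz _; rewrite gE // /vacuum (expmx_ev Pu aE bE).
  exact: (Et_factor z_inj z_conj j au bu Pu aE bE Vnz).
move=> x t w; apply: mder_is_mderive.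
exact: (Et_xder z_inj z_conj j au bu Pu aE bE Vnz).
Qed.

(** The trivialization is unique by [factor_unique], and it determines the solution
    through its derivative in [x]. *)
Lemma dressed_unique ut Et' : dressed a g (vacuum a b j) ut Et' ->
  ut = soliton /\ Et' = E.
Proof.
move=> [gt [gtG EtP fact der]].
have EE : Et' = E.
  apply/funext => x; apply/funext => t; apply/funext => w.
  have Gx : G_minus (gsol z (W x t)).
    by apply: (gs_G_minus z_inj z_conj); exact: (W_nz z da db j Pu Vnz).
  apply: (factor_unique (gtG x t) Gx).
  - by move=> s; have [h _ _] := EtP x t s; exact: holomorphic_mdiff.
  - move=> s; exact: (mdiff_Et z_inj z_conj j au Pu aE bE Vnz x t s).
  - move=> s; exact: (Et_unitary z_inj z_conj j au bu Pu aE bE Vnz).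
  apply: cofin_impl (cofinI (cofin_pole gG) (cofin_pole (gtG x t))) => s [gs gts].
  rewrite -fact // gE; last exact: off_pole.
  rewrite /vacuum (expmx_ev Pu aE bE).
  by apply: (Et_factor z_inj z_conj j au bu Pu aE bE Vnz); exact: off_pole.
split=> //; apply/funext => x; apply/funext => t.
have h1 := der x t 0; rewrite EE in h1.
have h2 := Et_xder z_inj z_conj j au bu Pu aE bE Vnz x t 0.
have := mder_unique h1 h2.
have Eu := Et_unit z_inj z_conj j au bu Pu aE bE Vnz x t 0.
move=> /(congr1 (fun X => invmx (E x t 0) *m X)).
by rewrite !(mulKmx Eu) !scale0r !add0r.
Qed.

End Dressed.
End Soliton.

Theorem mainTheorem12 (R : realType) (n : nat) (a b : 'M[R[i]]_n) (j : nat)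
    (a_diag : is_diag_mx a) (a_u : u_alg a) (b_u : u_alg b)
    (ab : lie a b = 0) (j_ge1 : (1 <= j)%N)
    (g : R[i] -> 'M[R[i]]_n) (gG : G_minus g) (g_reg : regular g)
    (N : nat) (z : 'I_N -> R[i]) (pi : 'I_N -> 'M[R[i]]_n)
    (g_data : singularity_data g z pi)
    (v : 'I_N -> 'cV[R[i]]_n)
    (pi_v : forall k, projects_onto_line (pi k) (v k)) :
  (exists ut Et, dressed a g (vacuum a b j) ut Et) /\
  (forall ut Et, dressed a g (vacuum a b j) ut Et ->
     [/\ forall x t, soliton_F a b j z v x t \in unitmx ->
           ut x t = \sum_k lie (soliton_P a b j z v k x t) a /\
           forall w, (forall k, w != z k /\ w != (z k)^*) ->
             Et x t w = g w *m vacuum a b j x t w *m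
               (1%:M + \sum_k (w - (z k)^*)^-1 *:
                         (soliton_P a b j z v k x t) ^t*),
         forall t, schwartz a (ut^~ t) &
         (forall y, u_alg y -> lie a y = 0 -> lie b y = 0) ->
         jflow_solution a b j ut /\ trivialization a b j ut Et]).

Proof.
have [P [da [db [Pu aE bE]]]] := codiagonal a_diag b_u ab.
have a_dg : a = diag_mx (\row_i a i i).
  apply/matrixP => i l; rewrite !mxE; have [->|il] := eqVneq i l; first by rewrite mulr1n.
  by rewrite mulr0n; move/is_diag_mxP: a_diag; apply.
have z_inj := data_inj g_data.
have z_conj := data_conj g_reg g_data.
have Vnz := Vmx_nz pi_v.
have Vv := col_Vmx v.
have gP := data_pole g_data.
have gE := data_explicit gG g_reg g_data pi_v.
split.
  exists (soliton z a P da db j (Vmx v)), (Et z P da db j (Vmx v)).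
  exact: (soliton_dressed z_inj z_conj j a_u b_u Pu aE bE Vnz gP gE).
move=> ut Et' h.
have [-> ->] := dressed_unique z_inj z_conj a_u b_u Pu aE bE Vnz gG gP gE h.
split.
- move=> x t _; split.
    exact: (soliton_formula z j a_u b_u Pu aE bE Vv).
  move=> w hw; have w1 k : w != z k by have [] := hw k.
  have w2 k : w != (z k)^* by have [] := hw k.
  rewrite gE //; exact: (trivialization_formula z_inj z_conj j a_u b_u Pu aE bE Vnz Vv).
- exact: (soliton_decay z_inj z_conj j a_u Pu aE bE a_dg Vnz).
move=> /(centralizer_complex a_u) hb; split.
  exact: (soliton_jflow z_inj z_conj j a_u b_u Pu aE bE a_dg ab Vnz hb).
exact: (soliton_trivialization z_inj z_conj j a_u b_u Pu aE bE a_dg Vnz hb).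
Qed.
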